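(* Let $n\ge 2$, let $\mathfrak g=\mathfrak{sl}_n(\mathbb R)$, and let $I=\mathbb R^n$ be the standard representation of $\mathfrak{sl}_n(\mathbb R)$, with basis $\frac{\partial}{\partial x^1},\dots,\frac{\partial}{\partial x^n}$. Let $\mathfrak h$ be the extension $0\to I\to\mathfrak h\to\mathfrak g\to0$ with $I$ Abelian. Then $$HL_*(\mathfrak h)\simeq[\Lambda^*(I)]^{\mathfrak{sl}_n(\mathbb R)}=\Big\langle\frac{\partial}{\partial x^1}\wedge\frac{\partial}{\partial x^2}\wedge\dots\wedge\frac{\partial}{\partial x^n}\Big\rangle ,$$ where $\langle v\rangle$ denotes the (unital) subalgebra of $\Lambda^*(I)$ generated by $v$, i.e. here the real span of $1\in\Lambda^0(I)$ and the volume element in $\Lambda^n(I)$.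
   Context: $\mathfrak h=\mathfrak g\oplus I$ as a vector space with $[g_1+a,\,g_2+b]=[g_1,g_2]+[g_1,b]-[g_2,a]$ for $g_i\in\mathfrak g$, $a,b\in I$, where $\mathfrak g$ acts on $I=\mathbb R^n$ by matrix multiplication on vectors. $\mathfrak g$ acts on $\Lambda^*(I)$ by derivations and $M^{\mathfrak g}$ denotes the $\mathfrak g$-invariants. Leibniz homology $HL_*(\mathfrak h)$ (real coefficients) is the homology of $T(\mathfrak h)=\bigoplus_{k\ge0}\mathfrak h^{\otimes k}$ with $d(g_1,\dots,g_k)=\sum_{i<j}(-1)^j(g_1,\dots,g_{i-1},[g_i,g_j],g_{i+1},\dots,\widehat{g_j},\dots,g_k)$, where $(g_1,\dots,g_k)=g_1\otimes\dots\otimes g_k$. The isomorphism is of graded vector spaces. *)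

(* Defs.v *)
From HB Require Import structures.
From mathcomp Require Import all_boot all_order all_algebra all_field.
From mathcomp Require Import ring.
From mathcomp Require Export reals.

Set Implicit Arguments.
Unset Strict Implicit.
Unset Printing Implicit Defensive.

Import GRing.Theory.
Local Open Scope ring_scope.
Local Open Scope quotient_scope.

(* The library's additive quotient {quot W}, for a subspace W of V, is given  *)
(* its structure of K-module.                                                 *)
Section QuotientSpace.
Variables (K : fieldType) (V : vectType K) (W : {vspace V}).

Local Notation quotv := (Quotient.quot W).

Definition quotv_pi (x : V) : quotv := \pi_quotv x.

Lemma quotv_pi_eq x y : (quotv_pi x == quotv_pi y) = (x - y \in W).
Proof. exact: esym (Quotient.idealrBE _ _ _). Qed.

Lemma quotv_pi_surj q : {x | q = quotv_pi x}.
Proof. by exists (repr q); rewrite /quotv_pi reprK. Qed.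

Lemma quotv_piB : {morph quotv_pi : x y / x - y}.
Proof. by move=> x y; rewrite /quotv_pi raddfB. Qed.

Lemma quotv_piD : {morph quotv_pi : x y / x + y}.
Proof. by move=> x y; rewrite /quotv_pi raddfD. Qed.

Definition quotv_scale (a : K) (q : quotv) : quotv :=
  quotv_pi (a *: repr q).

Lemma quotv_scale_pi a x : quotv_scale a (quotv_pi x) = quotv_pi (a *: x).
Proof.
apply/eqP; rewrite quotv_pi_eq -scalerBr memvZ // -quotv_pi_eq.
by rewrite /quotv_pi reprK.
Qed.

Fact quotv_scalerA a b q :
  quotv_scale a (quotv_scale b q) = quotv_scale (a * b) q.
Proof. by have [x ->] := quotv_pi_surj q; rewrite !quotv_scale_pi scalerA. Qed.

Fact quotv_scale1r : left_id 1 quotv_scale.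
Proof.
by move=> q; have [x ->] := quotv_pi_surj q; rewrite quotv_scale_pi scale1r.
Qed.

Fact quotv_scalerDr : right_distributive quotv_scale +%R.
Proof.
move=> a q r; have [x ->] := quotv_pi_surj q; have [y ->] := quotv_pi_surj r.
by rewrite -quotv_piD !quotv_scale_pi -quotv_piD scalerDr.
Qed.

Fact quotv_scalerDl q : {morph quotv_scale^~ q : a b / a + b}.
Proof.
move=> a b; have [x ->] := quotv_pi_surj q.
by rewrite !quotv_scale_pi -quotv_piD scalerDl.
Qed.

HB.instance Definition _ := GRing.Zmodule_isLmodule.Build K quotv
  quotv_scalerA quotv_scale1r quotv_scalerDr quotv_scalerDl.

Fact quotv_pi_is_linear : linear quotv_pi.
Proof. by move=> a x y; rewrite quotv_piD -quotv_scale_pi. Qed.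
HB.instance Definition _ :=
  GRing.isLinear.Build K V quotv _ quotv_pi quotv_pi_is_linear.

End QuotientSpace.

(* The tensor power of V is realized by coordinates in the basis              *)
(* vbasis {:V}; tlift is its universal property (see tlift_tensor).           *)
Section TensorPower.
Variables (K : fieldType) (V : vectType K).

Definition tpow (k : nat) : vectType K :=
  {ffun {ffun 'I_k -> 'I_(\dim {:V})} -> K^o}.

Definition tensor k (x : {ffun 'I_k -> V}) : tpow k :=
  [ffun s : {ffun 'I_k -> 'I_(\dim {:V})} =>
     \prod_(i < k) coord (vbasis {:V}) (s i) (x i)].

Definition fupd (T : Type) k (x : {ffun 'I_k -> T}) (i : 'I_k) (v : T) :=
  [ffun j => if j == i then v else x j].

Definition multilinear k (W : lmodType K) (f : {ffun 'I_k -> V} -> W) : Prop :=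
  forall x i, linear (fun v => f (fupd x i v)).

Lemma tensor_multilinear k : multilinear (@tensor k).
Proof.
move=> x i a u v; apply/ffunP=> s.
have E w : (tensor (fupd x i w) : {ffun _ -> _}) s = coord (vbasis {:V}) (s i) w
    * \prod_(j < k | j != i) coord (vbasis {:V}) (s j) (x j) :> K.
  rewrite ffunE (bigD1 i) //= ffunE eqxx; congr (_ * _).
  by apply: eq_bigr => j /negPf ji; rewrite ffunE ji.
rewrite E [RHS]ffunE [X in _ = X + _]ffunE !E /GRing.scale /= mulrA -mulrDl.
by congr (_ * _); rewrite -[a * _]/(a *: (_ : K^o)); rewrite linearD linearZ.
Qed.

Definition basis_family k (s : {ffun 'I_k -> 'I_(\dim {:V})}) :
  {ffun 'I_k -> V} := [ffun i => (vbasis {:V})`_(s i)].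

Section Lift.
Variables (k : nat) (W : lmodType K) (f : {ffun 'I_k -> V} -> W).

Definition tlift (w : tpow k) : W :=
  \sum_(s : {ffun 'I_k -> 'I_(\dim {:V})})
    (w : {ffun {ffun 'I_k -> 'I_(\dim {:V})} -> K^o}) s *: f (basis_family s).

Fact tlift_is_linear : linear tlift.
Proof.
move=> a u v; rewrite scaler_sumr -big_split /=; apply: eq_bigr => s _.
by rewrite !ffunE scalerDl scalerA.
Qed.
HB.instance Definition _ :=
  GRing.isLinear.Build K (tpow k) W _ tlift tlift_is_linear.

End Lift.

Definition fcons (T : Type) k (p : T * {ffun 'I_k -> T}) : {ffun 'I_k.+1 -> T} :=
  [ffun i => if unlift ord0 i is Some j then p.2 j else p.1].

Lemma fcons0 T k p : @fcons T k p ord0 = p.1.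
Proof. by rewrite ffunE unlift_none. Qed.

Lemma fconsS T k p i : @fcons T k p (lift ord0 i) = p.2 i.
Proof. by rewrite ffunE liftK. Qed.

Lemma multilinear_expand k (W : lmodType K) (f : {ffun 'I_k -> V} -> W) :
  multilinear f -> forall x, f x = \sum_(s : {ffun 'I_k -> 'I_(\dim {:V})})
    (\prod_(i < k) coord (vbasis {:V}) (s i) (x i)) *: f (basis_family s).
Proof.
elim: k => [|k IHk] in f * => f_lin x.
  have s0 : {ffun 'I_0 -> 'I_(\dim {:V})} by apply: finfun; case.
  have u (T : Type) (a b : {ffun 'I_0 -> T}) : a = b by apply/ffunP; case.
  rewrite (bigD1 s0) //= big_ord0 scale1r big_pred0 ?addr0 => [|s].
    by congr f; apply: u.
  by rewrite (u _ s s0) eqxx.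
pose y : {ffun 'I_k -> V} := [ffun i => x (lift ord0 i)].
have fE v z : fupd (fcons (v, z)) ord0 =1 fun u => fcons (u, z).
  move=> w; apply/ffunP=> i; rewrite !ffunE.
  by case: unliftP => [j|] ->.
have g_lin v : multilinear (fun z => f (fcons (v, z))).
  move=> z i a u w; have:= f_lin (fcons (v, z)) (lift ord0 i) a u w.
  have E t : fupd (fcons (v, z)) (lift ord0 i) t = fcons (v, fupd z i t).
    apply/ffunP=> j; rewrite !ffunE.
    by case: unliftP => [l|] -> //; rewrite ?ffunE ?(inj_eq lift_inj).
  by rewrite !E.
pose F v := f (fcons (v, y)).
have F_lin : linear F.
  by move=> a u w; have:= f_lin (fcons (0, y)) ord0 a u w; rewrite !fE.
pose FL : {linear V -> W} := HB.pack F (GRing.isLinear.Build K V W _ F F_lin).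
have ->: f x = FL (x ord0).
  rewrite /= /F; congr f; apply/ffunP=> i; rewrite ffunE.
  by case: unliftP => [j|] -> //=; rewrite ffunE.
rewrite {1}(coord_vbasis (memvf (x ord0))) linear_sum /=.
rewrite (reindex (@fcons 'I_(\dim {:V}) k)) /=; last first.
  exists (fun s => (s ord0, [ffun i => s (lift ord0 i)])) => [[d s] _ | s _] /=.
    by congr pair; rewrite ?fcons0 //; apply/ffunP=> i; rewrite ffunE fconsS.
  by apply/ffunP=> i; rewrite ffunE; case: unliftP => [j|] -> //=; rewrite ffunE.
rewrite -(pair_bigA _ (fun d s => (\prod_(i < k.+1)
  coord (vbasis {:V}) (fcons (d, s) i) (x i)) *: f (basis_family (fcons (d, s))))).
apply: eq_bigr => d _; rewrite -[F]/(FL : V -> W) linearZ /= /F (IHk _ (g_lin _)).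
rewrite scaler_sumr; apply: eq_bigr => s _.
rewrite scalerA big_ord_recl fcons0 /=; congr (_ * _ *: f _).
  by apply: eq_bigr => i _; rewrite fconsS ffunE.
by apply/ffunP=> i; rewrite !ffunE; case: unliftP => [j|] _; rewrite ?ffunE.
Qed.

Lemma tlift_tensor k (W : lmodType K) (f : {ffun 'I_k -> V} -> W) :
  multilinear f -> forall x, tlift f (tensor x) = f x.
Proof.
move=> f_lin x; rewrite [RHS](multilinear_expand f_lin).
by apply: eq_bigr => s _; rewrite ffunE.
Qed.

Lemma tlift_unique k (W : lmodType K) (g : {linear tpow k -> W}) :
  g =1 tlift (g \o @tensor k).
Proof.
move=> w; rewrite {1}(_ : w = tlift (@tensor k) w).
  by rewrite linear_sum; apply: eq_bigr => s _; rewrite linearZ.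
apply/ffunP=> s; rewrite sum_ffunE (bigD1 s) //= big1 ?addr0 => [|t ts].
  rewrite !ffunE big1 /GRing.scale /= ?mulr1 // => i _.
  by rewrite ffunE coord_free ?(basis_free (vbasisP _)) // eqxx.
rewrite !ffunE; have [i si]: exists i, t i != s i.
  by apply/existsP; rewrite -negb_forall; apply: contra ts => /eqfunP/ffunP->.
rewrite (bigD1 i) //= ffunE coord_free ?(basis_free (vbasisP _)) //.
by move: si; rewrite -val_eqE eq_sym => /negPf->; rewrite mul0r scaler0.
Qed.

End TensorPower.

Section LeibnizHomology.
Variables (K : fieldType) (V : vectType K) (br : V -> V -> V).

Definition leibniz_face k (x : {ffun 'I_k -> V}) (i j : 'I_k) :
    {ffun 'I_k.-1 -> V} :=
  [ffun l => if lift j l == i then br (x i) (x j) else x (lift j l)].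

(* Indices start from 0 here: the factor (-1)^j of the usual formula, where   *)
(* indices start from 1, becomes (-1)^(j+1).                                  *)
Definition leibniz_formula k (x : {ffun 'I_k -> V}) : tpow V k.-1 :=
  \sum_(i < k) \sum_(j < k | (i < j)%N)
    (-1) ^+ j.+1 *: tensor (leibniz_face x i j).

Definition leibniz_d k : 'Hom(tpow V k, tpow V k.-1) :=
  linfun (tlift (@leibniz_formula k)).

Lemma leibniz_d_tensor k (x : {ffun 'I_k -> V}) :
    (forall u, linear (br u)) -> (forall u, linear (br^~ u)) ->
  leibniz_d k (tensor x) = leibniz_formula x.
Proof.
move=> brl brr; rewrite lfunE /= tlift_tensor // => {}x m a u v.
rewrite /leibniz_formula scaler_sumr -big_split /=; apply: eq_bigr => i _.
rewrite scaler_sumr -big_split /=; apply: eq_bigr => j lt_ij.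
rewrite scalerA mulrC -scalerA -scalerDr; congr (_ *: _).
have neq_ij: i != j by rewrite neq_ltn lt_ij.
have [p def_i|] := unliftP j i; last by move/eqP; rewrite (negPf neq_ij).
have Ei l : (lift j l == i) = (l == p) by rewrite def_i (inj_eq lift_inj).
have jl l : (lift j l == j) = false by rewrite eq_sym (negPf (neq_lift _ _)).
pose y := leibniz_face x i j.
have [->{m} | mi] := eqVneq m i.
  have E w : leibniz_face (fupd x i w) i j = fupd y p (br w (x j)).
    apply/ffunP=> l; rewrite !ffunE eqxx (eq_sym j) (negPf neq_ij) !Ei.
    by case: (l == p).
  by rewrite !E brr tensor_multilinear.
have [->{m mi} | mj] := eqVneq m j.
  have E w : leibniz_face (fupd x j w) i j = fupd y p (br (x i) w).
    by apply/ffunP=> l; rewrite !ffunE eqxx (negPf neq_ij) jl !Ei; case: (l == p).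
  by rewrite !E brl tensor_multilinear.
have [q def_m|] := unliftP j m; last by move/eqP; rewrite (negPf mj).
have Em l : (lift j l == m) = (l == q) by rewrite def_m (inj_eq lift_inj).
have E w : leibniz_face (fupd x m w) i j = fupd y q w.
  apply/ffunP=> l; rewrite !ffunE (eq_sym i) (negPf mi) (eq_sym j) (negPf mj).
  by rewrite -Em; have [->|//] := eqVneq (lift j l) m; rewrite (negPf mi).
by rewrite !E tensor_multilinear.
Qed.

Definition leibniz_boundaries k : {vspace subvs_of (lker (leibniz_d k))} :=
  (linfun vsval @^-1: limg (leibniz_d k.+1))%VS.

Definition HL (k : nat) : lmodType K := Quotient.quot (leibniz_boundaries k).

End LeibnizHomology.

Section SemidirectProduct.
Variables (K : fieldType) (n : nat).

Definition slv : {vspace 'M[K]_n} := lker (linfun (@mxtrace K n : 'M[K]_n -> K^o)).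

Lemma mem_slv A : (A \in slv) = (\tr A == 0).
Proof. by rewrite memv_ker lfunE. Qed.

Lemma slv_bracket (A B : 'M[K]_n) : A *m B - B *m A \in slv.
Proof. by rewrite mem_slv linearB /= mxtrace_mulC subrr. Qed.

Definition sl_bracket (A B : subvs_of slv) : subvs_of slv :=
  Subvs (slv_bracket (vsval A) (vsval B)).

Definition sl_semidirect : vectType K := (subvs_of slv * 'cV[K]_n)%type.

Definition sd_bracket (x y : sl_semidirect) : sl_semidirect :=
  (sl_bracket x.1 y.1, vsval x.1 *m y.2 - vsval y.1 *m x.2).

Lemma sd_bracket_linearl u : linear (sd_bracket^~ u).
Proof.
move=> a x y; congr pair; first apply: val_inj.
  by rewrite /= mulmxDl mulmxDr -scalemxAl -scalemxAr scalerBr opprD addrACA.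
by rewrite /= mulmxDl mulmxDr -scalemxAl -scalemxAr scalerBr opprD addrACA.
Qed.

Lemma sd_bracketxx x : sd_bracket x x = 0.
Proof. by congr pair; first apply: val_inj; rewrite /= subrr. Qed.

Lemma sd_bracketC x y : sd_bracket x y = - sd_bracket y x.
Proof. by congr pair; first apply: val_inj; rewrite /= opprB. Qed.

Lemma sd_bracket_linearr u : linear (sd_bracket u).
Proof.
move=> a x y; rewrite ![sd_bracket u _]sd_bracketC sd_bracket_linearl.
by rewrite opprD scalerN.
Qed.

Lemma sd_bracket_jacobi x y z : sd_bracket x (sd_bracket y z) =
  sd_bracket (sd_bracket x y) z - sd_bracket (sd_bracket x z) y.
Proof.
congr pair; first apply: val_inj; rewrite /= !(mulmxBl, mulmxBr) !mulmxA.
  move: (vsval x.1) (vsval y.1) (vsval z.1) => A B C.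
  move: (A *m B *m C) (A *m C *m B) (B *m A *m C) (B *m C *m A) (C *m A *m B).
  by move: (C *m B *m A) => ? ? ? ? ? ?; apply/matrixP=> i j; rewrite !mxE; ring.
move: (vsval x.1) (vsval y.1) (vsval z.1) x.2 y.2 z.2 => A B C a b c.
move: (A *m B *m c) (A *m C *m b) (B *m A *m c) (B *m C *m a) (C *m A *m b).
by move: (C *m B *m a) => ? ? ? ? ? ?; apply/matrixP=> i j; rewrite !mxE; ring.
Qed.

End SemidirectProduct.

(* The basis of the exterior algebra of K^n is indexed by the subsets of      *)
(* 'I_n: ebasis [set i1; ...; ik], where i1 < ... < ik, is the product        *)
(* e_i1 /\ ... /\ e_ik (see ebasisE), and ext_inv_num S T is the number of    *)
(* inversions in the concatenation of the increasing enumerations of S and T. *)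
Section ExteriorAlgebra.
Variables (K : fieldType) (n : nat).
Implicit Types (S T U : {set 'I_n}).

Definition exterior : Type := {ffun {set 'I_n} -> K^o}.
HB.instance Definition _ := Vector.on exterior.

Definition ext_coef (a : exterior) : {ffun {set 'I_n} -> K} := a.
Definition ext_of (f : {ffun {set 'I_n} -> K}) : exterior := f.

Definition ext_inv_num S T : nat := \sum_(s in S) \sum_(t in T) (t < s)%N.

Definition ebasis S : exterior := ext_of [ffun T : {set 'I_n} => (T == S)%:R].

Definition ext_mul (a b : exterior) : exterior :=
  ext_of [ffun U : {set 'I_n} => \sum_(S : {set 'I_n} | S \subset U)
    (-1) ^+ ext_inv_num S (U :\: S) * (ext_coef a S * ext_coef b (U :\: S))].

Lemma extP a b : ext_coef a =1 ext_coef b -> a = b.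
Proof. by move/ffunP. Qed.

Lemma ext_coef0 S : ext_coef 0 S = 0.
Proof. by rewrite /ext_coef ffunE. Qed.

Lemma ext_coefD a b S : ext_coef (a + b) S = ext_coef a S + ext_coef b S.
Proof. by rewrite /ext_coef ffunE. Qed.

Lemma ext_coefZ c a S : ext_coef (c *: a) S = c * ext_coef a S.
Proof. by rewrite /ext_coef ffunE. Qed.

Lemma ext_coef_mul a b U : ext_coef (ext_mul a b) U =
  \sum_(S : {set 'I_n} | S \subset U)
    (-1) ^+ ext_inv_num S (U :\: S) * (ext_coef a S * ext_coef b (U :\: S)).
Proof. by rewrite /ext_coef ffunE. Qed.

Lemma ext_coef_basis S T : ext_coef (ebasis S) T = (T == S)%:R.
Proof. by rewrite /ext_coef ffunE. Qed.

Lemma ext_inv_numUl S T U : [disjoint S & T] ->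
  ext_inv_num (S :|: T) U = (ext_inv_num S U + ext_inv_num T U)%N.
Proof.
move=> dST; rewrite /ext_inv_num -bigU //=.
by apply: eq_bigl => s; rewrite !inE.
Qed.

Lemma ext_inv_numUr S T U : [disjoint T & U] ->
  ext_inv_num S (T :|: U) = (ext_inv_num S T + ext_inv_num S U)%N.
Proof.
move=> dTU; rewrite /ext_inv_num -big_split /=; apply: eq_bigr => s _.
by rewrite -bigU //=; apply: eq_bigl => t; rewrite !inE.
Qed.

Lemma setDUK S (W : {set 'I_n}) : S \subset W -> S :|: (W :\: S) = W.
Proof. by move=> sSW; rewrite -[RHS](setID W S) (setIidPr sSW). Qed.

Fact ext_mulA : associative ext_mul.
Proof.
move=> a b c; apply: extP => U; rewrite !ext_coef_mul.
pose F S T := (-1) ^+ (ext_inv_num S T + ext_inv_num S (U :\: S :\: T)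
           + ext_inv_num T (U :\: S :\: T))
    * (ext_coef a S * ext_coef b T * ext_coef c (U :\: S :\: T)).
transitivity (\sum_(S : {set 'I_n} | S \subset U)
    \sum_(T : {set 'I_n} | T \subset U :\: S) F S T).
  apply: eq_bigr => S sSU; rewrite ext_coef_mul !mulr_sumr.
  apply: eq_bigr => T sTU; rewrite -{1}(setID (U :\: S) T) (setIidPr sTU).
  rewrite ext_inv_numUr; last by rewrite disjoint_sym -setI_eq0 setIDAC setDIl setDv setI0.
  by rewrite /F !exprD; ring.
under [RHS]eq_bigr => W _ do rewrite ext_coef_mul mulr_suml mulr_sumr.
rewrite [RHS](exchange_big_dep (fun S => S \subset U)) => [|W S sWU sSW] /=; last exact: subset_trans sSW sWU.
apply: eq_bigr => S sSU.
rewrite [RHS](reindex_onto (fun T => S :|: T) (fun W => W :\: S)) /=; last first.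
  by move=> W /andP[_ sSW]; exact: setDUK.
apply: eq_big => [T | T sTU].
  rewrite subUset sSU subsetUl andbT /= setDUl setDv set0U subsetD.
  by congr andb; apply: (sameP setDidPl eqP).
have [sTU' dTS] : T \subset U /\ [disjoint T & S] by apply/subsetDP.
rewrite setDUl setDv set0U (setDidPl dTS) -setDDl.
by rewrite ext_inv_numUl 1?disjoint_sym // /F !exprD; ring.
Qed.

Lemma ext_inv_num0l T : ext_inv_num set0 T = 0%N.
Proof. by rewrite /ext_inv_num big_set0. Qed.

Lemma ext_inv_num0r S : ext_inv_num S set0 = 0%N.
Proof. by rewrite /ext_inv_num big1 // => s _; rewrite big_set0. Qed.

Fact ext_mul1r : left_id (ebasis set0) ext_mul.
Proof.
move=> a; apply: extP => U; rewrite ext_coef_mul (bigD1 set0) ?sub0set //=.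
rewrite big1 => [|S /andP[_ /negPf S0]]; rewrite ext_coef_basis.
  by rewrite eqxx ext_inv_num0l setD0 !mul1r addr0.
by rewrite S0 mul0r mulr0.
Qed.

Fact ext_mulr1 : right_id (ebasis set0) ext_mul.
Proof.
move=> a; apply: extP => U; rewrite ext_coef_mul (bigD1 U) //=.
rewrite big1 => [|S /andP[sSU neqS]]; rewrite ext_coef_basis.
  by rewrite setDv eqxx ext_inv_num0r mul1r mulr1 addr0.
by rewrite setD_eq0 -[_ \subset _]andTb -sSU -eqEsubset (negPf neqS) !mulr0.
Qed.

Fact ext_mulDl : left_distributive ext_mul +%R.
Proof.
move=> a b c; apply: extP => U; rewrite ext_coefD !ext_coef_mul -big_split.
by apply: eq_bigr => S _; rewrite /= ext_coefD; ring.
Qed.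

Fact ext_mulDr : right_distributive ext_mul +%R.
Proof.
move=> a b c; apply: extP => U; rewrite ext_coefD !ext_coef_mul -big_split.
by apply: eq_bigr => S _; rewrite /= ext_coefD; ring.
Qed.

Fact ext_oner_neq0 : ebasis set0 != 0.
Proof.
apply/eqP => /(congr1 (fun a => ext_coef a set0)); rewrite ext_coef_basis eqxx.
by rewrite /ext_coef ffunE; apply/eqP/oner_neq0.
Qed.

HB.instance Definition _ := GRing.Zmodule_isNzRing.Build exterior
  ext_mulA ext_mul1r ext_mulr1 ext_mulDl ext_mulDr ext_oner_neq0.

Fact ext_scalerAl (c : K) (a b : exterior) : c *: (a * b) = c *: a * b.
Proof.
apply: extP => U; rewrite ext_coefZ !ext_coef_mul mulr_sumr.
by apply: eq_bigr => S _; rewrite ext_coefZ; ring.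
Qed.
HB.instance Definition _ :=
  GRing.Lmodule_isLalgebra.Build K exterior ext_scalerAl.

Fact ext_scalerAr (c : K) (a b : exterior) : c *: (a * b) = a * (c *: b).
Proof.
apply: extP => U; rewrite ext_coefZ !ext_coef_mul mulr_sumr.
by apply: eq_bigr => S _; rewrite ext_coefZ; ring.
Qed.
HB.instance Definition _ :=
  GRing.Lalgebra_isAlgebra.Build K exterior ext_scalerAr.
HB.instance Definition _ := Algebra_isFalgebra.Build K exterior.

Lemma ext_sum_basis (a : exterior) : a = \sum_S ext_coef a S *: ebasis S.
Proof.
apply: extP => U; rewrite {2}/ext_coef sum_ffunE (bigD1 U) //= big1 ?addr0.
  by rewrite -/(ext_coef _ U) ext_coefZ ext_coef_basis eqxx mulr1.
move=> S /negPf neqS; rewrite -/(ext_coef _ U) ext_coefZ ext_coef_basis.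
by rewrite eq_sym neqS mulr0.
Qed.

Lemma ebasisM S T : ebasis S * ebasis T =
  if [disjoint S & T] then (-1) ^+ ext_inv_num S T *: ebasis (S :|: T) else 0.
Proof.
apply: extP => U; rewrite ext_coef_mul.
have ->: \sum_(R : {set 'I_n} | R \subset U) (-1) ^+ ext_inv_num R (U :\: R) *
      (ext_coef (ebasis S) R * ext_coef (ebasis T) (U :\: R)) =
    (-1) ^+ ext_inv_num S T * ((S \subset U) && (U :\: S == T))%:R :> K.
  have [sSU|nsSU] := boolP (S \subset U); last first.
    rewrite mulr0 big1 // => R sRU; rewrite !ext_coef_basis.
    have [defR|_] := eqVneq R S; last by rewrite mul0r mulr0.
    by rewrite -defR sRU in nsSU.
  rewrite (bigD1 S) //= big1 ?addr0 => [|R /andP[_ /negPf neqR]].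
    rewrite !ext_coef_basis eqxx mul1r; case: eqP => [->//|_].
    by rewrite !mulr0.
  by rewrite !ext_coef_basis neqR mul0r mulr0.
have [dST|ndST] := boolP [disjoint S & T].
  rewrite ext_coefZ ext_coef_basis; congr (_ * _%:R); congr nat_of_bool.
  apply/andP/eqP => [[sSU /eqP<-] | ->]; first by rewrite setDUK.
  by rewrite subsetUl setDUl setDv set0U (setDidPl _) // disjoint_sym.
rewrite ext_coef0; case: andP => [[_ /eqP defT]|_]; rewrite ?mulr0 //.
by rewrite -defT disjoint_sym -setI_eq0 setIDAC setDIl setDv setI0 eqxx in ndST.
Qed.

Definition ext_vec (v : 'cV[K]_n) : exterior :=
  \sum_i v i ord0 *: ebasis [set i].

Fact ext_vec_is_linear : linear ext_vec.
Proof.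
move=> c u v; rewrite /ext_vec scaler_sumr -big_split /=.
by apply: eq_bigr => i _; rewrite !mxE scalerDl scalerA.
Qed.
HB.instance Definition _ :=
  GRing.isLinear.Build K 'cV[K]_n exterior _ ext_vec ext_vec_is_linear.

Definition ext_partial (i : 'I_n) : 'cV[K]_n := delta_mx i ord0.

Lemma ext_vec_partial i : ext_vec (ext_partial i) = ebasis [set i].
Proof.
rewrite /ext_vec (bigD1 i) //= big1 ?addr0 => [|j /negPf ji].
  by rewrite mxE !eqxx scale1r.
by rewrite mxE ji scale0r.
Qed.

Lemma ext_vec_sq v : ext_vec v * ext_vec v = 0.
Proof.
have E2 i : ebasis [set i] * ebasis [set i] = 0.
  by rewrite ebasisM disjoints1 inE eqxx.
have EC (i j : 'I_n) : (i < j)%N ->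
    ebasis [set i] * ebasis [set j] + ebasis [set j] * ebasis [set i] = 0.
  move=> ltij; rewrite !ebasisM !disjoints1 !inE (eq_sym j i).
  rewrite (ltn_eqF ltij : (i == j) = false) /ext_inv_num !big_set1.
  by rewrite ltij ltnNge (ltnW ltij) /= expr0 expr1 scaleN1r scale1r setUC subrr.
rewrite {1}/ext_vec mulr_suml.
pose F i j := (v i ord0 * v j ord0) *: (ebasis [set i] * ebasis [set j]).
transitivity (\sum_i \sum_j F i j).
  apply: eq_bigr => i _; rewrite mulr_sumr; apply: eq_bigr => j _.
  by rewrite -scalerAl -scalerAr scalerA.
have splitF i : \sum_j F i j = \sum_(j < n | (i < j)%N) F i j + \sum_(j < n | (j < i)%N) F i j.
  rewrite (bigID (fun j : 'I_n => (i < j)%N)) /=; congr (_ + _).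
  rewrite (bigD1 i) ?ltnn //= /F E2 scaler0 add0r; apply: eq_bigl => j.
  by rewrite -leqNgt ltn_neqAle andbC.
rewrite (eq_bigr _ (fun i _ => splitF i)) big_split /=.
rewrite [X in _ + X](exchange_big_dep predT) //= -big_split big1 // => i _.
rewrite -big_split big1 //= => j ltij.
by rewrite /F [v j _ * _]mulrC -scalerDr EC ?scaler0.
Qed.

Lemma ext_vecC u v : ext_vec u * ext_vec v = - (ext_vec v * ext_vec u).
Proof.
apply/eqP; rewrite -addr_eq0; apply/eqP.
have:= ext_vec_sq (u + v); rewrite linearD mulrDl !mulrDr !ext_vec_sq.
by rewrite add0r addr0.
Qed.

Lemma sorted_enum_set S : sorted (fun i j : 'I_n => i < j)%N (enum S).
Proof.
rewrite /enum_mem -enumT sorted_filter //; first exact: ltn_trans.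
by have:= iota_ltn_sorted 0 n; rewrite -val_enum_ord sorted_map.
Qed.

Definition ext_word (l : seq 'I_n) : exterior :=
  \prod_(i <- l) ext_vec (ext_partial i).

Lemma ext_word_cons i l :
  ext_word (i :: l) = ext_vec (ext_partial i) * ext_word l.
Proof. by rewrite /ext_word big_cons. Qed.

Lemma ext_word_sorted l : sorted (fun i j : 'I_n => i < j)%N l ->
  ext_word l = ebasis [set i in l].
Proof.
elim: l => [_|i l IHl sl]; first by rewrite /ext_word big_nil; congr ebasis; apply/setP=> i; rewrite !inE.
have /allP lt_il := order_path_min (fun _ _ _ => @ltn_trans _ _ _) sl.
rewrite ext_word_cons IHl ?(path_sorted sl) // ext_vec_partial ebasisM disjoints1.
rewrite inE; case: ifP => [il | /negbFE/lt_il]; last by rewrite ltnn.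
rewrite /ext_inv_num big_set1 big1 ?scale1r => [|j]; last first.
  by rewrite inE => /lt_il ltij; rewrite ltnNge (ltnW ltij).
by congr ebasis; apply/setP=> j; rewrite !inE.
Qed.

Lemma ebasisE S : ebasis S = ext_word (enum S).
Proof.
rewrite ext_word_sorted ?sorted_enum_set //; congr ebasis.
by apply/setP=> i; rewrite inE mem_enum.
Qed.

(* The action of A on e_i1 /\ ... /\ e_ik replaces, in turn, each factor e_i  *)
(* by A e_i; it is the derivation that extends A (see ext_actM, ext_act_vec). *)
Definition ext_act (A : 'M[K]_n) (a : exterior) : exterior :=
  \sum_S ext_coef a S *: \sum_(i in S) \prod_(j <- enum S)
    ext_vec (if j == i then A *m ext_partial j else ext_partial j).

Fact ext_act_is_linear A : linear (ext_act A).
Proof.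
move=> c a b; rewrite scaler_sumr -big_split /=; apply: eq_bigr => S _.
by rewrite ext_coefD ext_coefZ scalerDl scalerA.
Qed.
HB.instance Definition _ A :=
  GRing.isLinear.Build K exterior exterior _ (ext_act A) (ext_act_is_linear A).

Section Derivation.
Variable A : 'M[K]_n.

Fixpoint ext_dword (l : seq 'I_n) : exterior :=
  if l is i :: l' then ext_vec (A *m ext_partial i) * ext_word l'
    + ext_vec (ext_partial i) * ext_dword l' else 0.

Lemma ext_word_cat l1 l2 : ext_word (l1 ++ l2) = ext_word l1 * ext_word l2.
Proof. exact: big_cat. Qed.

Lemma ext_dword_cat l1 l2 : ext_dword (l1 ++ l2) =
  ext_dword l1 * ext_word l2 + ext_word l1 * ext_dword l2.
Proof.
elim: l1 => [|i l1 IHl] /=; first by rewrite mul0r add0r /ext_word big_nil mul1r.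
by rewrite IHl ext_word_cat ext_word_cons mulrDl mulrDr !mulrA addrA.
Qed.

Lemma ext_act_basis S : ext_act A (ebasis S) = ext_dword (enum S).
Proof.
rewrite /ext_act (bigD1 S) //= [X in _ + X]big1 ?addr0 => [|T /negPf TS]; last first.
  by rewrite ext_coef_basis TS scale0r.
rewrite ext_coef_basis eqxx scale1r -big_enum.
elim: (enum S) (enum_uniq S) => [|i l IHl] /=; first by rewrite big_nil.
case/andP=> i_notin_l uniq_l; rewrite big_cons -IHl // mulr_sumr.
congr (_ + _); first rewrite big_cons eqxx; last rewrite big_seq [RHS]big_seq.
  congr (_ * _); apply: eq_big_seq => j lj.
  by case: eqP lj i_notin_l => // -> ->.
apply: eq_bigr => j lj; rewrite big_cons.
by case: eqP lj i_notin_l => // -> ->.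
Qed.

Lemma ext_dword_swap i j l :
  ext_dword [:: i, j & l] = - ext_dword [:: j, i & l].
Proof.
rewrite /= !ext_word_cons !mulrDr !mulrA.
rewrite (ext_vecC (A *m ext_partial i)) (ext_vecC _ (A *m ext_partial j)).
by rewrite (ext_vecC (ext_partial i) (ext_partial j)) !mulNr !opprD addrCA.
Qed.

Lemma ext_word_swap i j l :
  ext_word [:: i, j & l] = - ext_word [:: j, i & l].
Proof. by rewrite !ext_word_cons !mulrA ext_vecC mulNr. Qed.

Lemma ext_word_insert i l : sorted (fun i j : 'I_n => i < j)%N l ->
  exists c l', [/\ sorted (fun i j : 'I_n => i < j)%N l',
    {subset l' <= i :: l},
    ext_word (i :: l) = c *: ext_word l' &
    ext_dword (i :: l) = c *: ext_dword l'].
Proof.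
elim: l => [_|j l IHl sl]; first by exists 1, [:: i]; split; rewrite ?scale1r.
have [ltij | ltji | /val_inj eqij] := ltngtP i j.
- by exists 1, [:: i, j & l]; split; rewrite ?scale1r //= ?ltij.
- have [c [l' [sl' l'P wE dE]]] := IHl (path_sorted sl).
  exists (- c), (j :: l'); split.
  + rewrite /= path_sortedE ?sl' ?andbT; last exact: (fun _ _ _ => @ltn_trans _ _ _).
    apply/allP=> m /l'P; rewrite inE => /orP[/eqP->//|].
    by have /allP := order_path_min (fun _ _ _ => @ltn_trans _ _ _) sl; apply.
  + move=> m; rewrite !inE => /orP[->|/l'P]; first by rewrite orbT.
    by rewrite inE => /orP[->|->]; rewrite ?orbT.
  + by rewrite ext_word_swap ext_word_cons wE -scalerAr -ext_word_cons scaleNr.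
  rewrite ext_dword_swap [X in - X]/= -/(ext_dword (i :: l)) dE wE.
  by rewrite -!scalerAr -scalerDr scaleNr.
exists 0, [::]; rewrite !scale0r {}eqij; split=> //.
  by rewrite !ext_word_cons mulrA ext_vec_sq mul0r.
rewrite /= ext_word_cons mulrDr !mulrA ext_vec_sq mul0r addr0 -mulrDl.
by rewrite ext_vecC addNr mul0r.
Qed.

Lemma ext_act_word l : ext_act A (ext_word l) = ext_dword l.
Proof.
have [c [l' [sl' wE ->]]] : exists c l', [/\ sorted (fun i j : 'I_n => i < j)%N l',
    ext_word l = c *: ext_word l' & ext_dword l = c *: ext_dword l'].
  elim: l => [|i l [c [l' [sl' wE dE]]]]; first by exists 1, [::]; split; rewrite ?scale1r.
  have [c' [l'' [sl'' _ wE' dE']]] := ext_word_insert i sl'.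
  exists (c * c'), l''; split=> //; rewrite -scalerA.
    by rewrite -wE' !ext_word_cons wE -scalerAr.
  by rewrite -dE' /= wE dE -!scalerAr -scalerDr.
rewrite wE linearZ /= ext_word_sorted // ext_act_basis; congr (_ *: ext_dword _).
apply: irr_sorted_eq (sorted_enum_set _) sl' _ => [? ? ?|?|i].
- exact: ltn_trans.
- exact: ltnn.
by rewrite mem_enum inE.
Qed.

Lemma ext_derivation_basis (D : {linear exterior -> exterior}) :
    (forall S T, D (ebasis S * ebasis T) =
       D (ebasis S) * ebasis T + ebasis S * D (ebasis T)) ->
  forall a b, D (a * b) = D a * b + a * D b.
Proof.
move=> D_basis a b.
rewrite [a]ext_sum_basis mulr_suml !linear_sum !mulr_suml -big_split /=.
apply: eq_bigr => S _; rewrite [b]ext_sum_basis !mulr_sumr !linear_sum.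
rewrite mulr_sumr -big_split; apply: eq_bigr => T _ /=.
rewrite -scalerAl -!scalerAr !linearZ /= D_basis.
rewrite -!scalerAl -!scalerAr scalerDr scalerDr; congr (_ + _).
by rewrite !scalerA mulrC.
Qed.

Lemma ext_actM a b : ext_act A (a * b) = ext_act A a * b + a * ext_act A b.
Proof.
apply: ext_derivation_basis => S T /=.
by rewrite !ebasisE -ext_word_cat !ext_act_word ext_dword_cat.
Qed.

Lemma ext_act_vec v : ext_act A (ext_vec v) = ext_vec (A *m v).
Proof.
have act_partial i : ext_act A (ext_vec (ext_partial i)) = ext_vec (A *m ext_partial i).
  have:= ext_act_word [:: i].
  by rewrite ext_word_cons /= /ext_word big_nil mulr0 addr0 !mulr1.
have ->: v = \sum_i v i ord0 *: ext_partial i.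
  apply/colP=> i; rewrite summxE (bigD1 i) //= big1 ?addr0 => [|j /negPf ji].
    by rewrite !mxE !eqxx mulr1.
  by rewrite !mxE eq_sym ji mulr0.
rewrite mulmx_sumr ![ext_vec _]linear_sum linear_sum; apply: eq_bigr => i _.
by rewrite -scalemxAr /= ![ext_vec (_ *: _)]linearZ /= linearZ /= act_partial.
Qed.

End Derivation.

Lemma ext_act_linearl a : linear (ext_act^~ a).
Proof.
have E M : ext_act M a = \sum_S ext_coef a S *: ext_dword M (enum S).
  rewrite {1}[a]ext_sum_basis [LHS]linear_sum; apply: eq_bigr => S _.
  by rewrite linearZ /= ext_act_basis.
move=> c A B; rewrite !E scaler_sumr -big_split; apply: eq_bigr => S _ /=.
rewrite scalerA mulrC -scalerA -scalerDr; congr (_ *: _).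
elim: (enum S) => [|i l IHl] /=; first by rewrite scaler0 addr0.
rewrite IHl mulmxDl -scalemxAl linearD linearZ /= mulrDl mulrDr -scalerAl.
by rewrite -scalerAr scalerDr addrACA.
Qed.

Definition ext_deg (k : nat) : {vspace exterior} := (limg (linfun ext_vec) ^+ k)%VS.

Definition ext_sl_inv : {vspace exterior} :=
  (\bigcap_(A <- vbasis (slv K n)) lker (linfun (ext_act A)))%VS.

Lemma ext_sl_invP a : reflect (forall A, \tr A = 0 -> ext_act A a = 0)
  (a \in ext_sl_inv).
Proof.
pose FL : {linear 'M[K]_n -> exterior} := HB.pack (ext_act^~ a)
  (GRing.isLinear.Build K _ exterior _ (ext_act^~ a) (ext_act_linearl a)).
have memE : a \in ext_sl_inv =
    all (fun A => ext_act A a == 0) (vbasis (slv K n)).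
  rewrite /ext_sl_inv; elim: (tval _) => [|A l IHl] /=; first by rewrite big_nil memvf.
  by rewrite big_cons memv_cap IHl memv_ker lfunE.
rewrite memE; apply: (iffP allP) => [inv_a A /eqP | inv_a A /vbasis_mem].
  rewrite -mem_slv => /coord_vbasis->; rewrite -[LHS]/(FL _) linear_sum big1 // => i _.
  by rewrite linearZ /= (eqP (inv_a _ _)) ?scaler0 // mem_nth ?size_tuple.
by rewrite mem_slv => /eqP/inv_a->.
Qed.

Definition ext_volume : exterior := \prod_(i < n) ext_vec (ext_partial i).

End ExteriorAlgebra.

(* Main.v *)
Require Import Defs.
From HB Require Import structures.
From mathcomp Require Import all_boot all_order all_algebra all_field.
From mathcomp Require Import boolp functions reals ring lra zify.

Set Implicit Arguments.
Unset Strict Implicit.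
Unset Printing Implicit Defensive.

Import Order.TTheory GRing.Theory Num.Theory.
Local Open Scope ring_scope.

(** Dualize: a cochain is a multilinear form f on h^k, and the Leibniz boundary
    satisfies d(w, y) = (dw, y) + (-1)^(k+1) (w . y), where w . y is the derivation
    action of y on words. Hence y . f is a coboundary for every cocycle f. Since
    sl_n acts reductively on tensors (its Casimir operator is self-adjoint for a
    positive definite form, transposition being the adjoint), every cocycle is
    cohomologous to an sl_n-invariant one.

    Filter the invariant forms by F_p: those that are, in their last p arguments,
    alternating functions of the I-components. On invariant forms the coboundary
    preserves F_p, and on F_p / F_{p+1} = (h^(k-p-1) (x) U_p)^*, where U_p is the
    kernel of h (x) Lambda^p I -> Lambda^(p+1) I, it only sees the first k-p-1
    arguments. A weight computation shows that U_p has no sl_n-coinvariants, so splitting off the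
    Casimir of the last p+1 arguments makes each F_p / F_{p+1} acyclic. Thus every
    cocycle is cohomologous to an invariant alternating form on I, that is to 0
    unless the degree is 0 or n, and to a multiple of the determinant in degree n. *)

(** The Casimir of the last p+1 arguments is compatible with the coboundary in the other arguments,
    rather than with the full one. So each filtration step solves its equation for that partial
    coboundary, modulo F_{p+1}. The solution is then made invariant by a polynomial in the Casimir
    of all arguments, which keeps the congruence, and on invariant forms of F_p the partial and the
    full coboundary agree modulo F_{p+1}. Since p stops at the degree, this finite induction takes
    the place of a spectral sequence.

    The return to homology uses linear functionals. A cycle outside the boundaries is detected by a
    functional that kills the boundaries. Such a functional is a cocycle, hence a coboundary plus a
    multiple of the volume form, and coboundaries vanish on cycles. So in positive degree a cycle on
    which the volume form vanishes is a boundary. *)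

Lemma fct_addE (T : Type) (W : zmodType) (f g : T -> W) s : (f + g) s = f s + g s.
Proof. by []. Qed.

Lemma fct_scaleE (K : pzRingType) (T : Type) (W : lmodType K) (c : K) (f : T -> W) s :
  (c *: f) s = c *: f s.
Proof. by []. Qed.

(** * Leibniz cochains as functions on words *)

Section LeibnizForms.
Variables (K : fieldType) (V : vectType K) (br : V -> V -> V).

(* Words are written backwards: the head of the list is the last tensor factor, *)
(* the one that the boundary peels off first. act_words q y s lists the words   *)
(* obtained by bracketing one of the q last factors of s with y.                *)
Fixpoint act_words q (y : V) (s : seq V) : seq (seq V) :=
  if q is q'.+1 then
    if s is x :: s' then (br x y :: s') :: map (cons x) (act_words q' y s') else [::]
  else [::].

Fixpoint bdry_words (s : seq V) : seq (K * seq V) :=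
  if s is y :: s' then
    [seq (ct.1, y :: ct.2) | ct <- bdry_words s'] ++
    [seq ((-1) ^+ (size s').+1, t) | t <- act_words (size s') y s']
  else [::].

Section Operators.
Variable W : lmodType K.
Implicit Types f g : seq V -> W.

Definition fix_head x f : seq V -> W := fun t => f (x :: t).
Definition fix_prefix u f : seq V -> W := fun t => f (u ++ t).
Definition fix_suffix w f : seq V -> W := fun t => f (t ++ w).
Definition act q y f : seq V -> W := fun s => \sum_(t <- act_words q y s) f t.
Definition cobdry f : seq V -> W := fun s => \sum_(ct <- bdry_words s) ct.1 *: f ct.2.
(* cobdry_after q is the coboundary in the tensor factors that precede the q    *)
(* last ones; insert_at q a evaluates at a in the factor just before those q.   *)
(* Both are 0 on shorter words.                                                 *)
Fixpoint cobdry_after q f : seq V -> W :=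
  if q is q'.+1 then fun s => if s is x :: s' then cobdry_after q' (fix_head x f) s' else 0
  else cobdry f.
Fixpoint insert_at q a f : seq V -> W :=
  if q is q'.+1 then fun s => if s is x :: s' then insert_at q' a (fix_head x f) s' else 0
  else fix_head a f.

(** A cochain is defined on words of all lengths at once, with [supp_size k] singling out degree k.
    This keeps the length of a word out of the types. *)
Definition mlinear f := forall s1 s2 c u v,
  f (s1 ++ (c *: u + v) :: s2) = c *: f (s1 ++ u :: s2) + f (s1 ++ v :: s2).
Definition supp_size k f := forall s, size s != k -> f s = 0.

Lemma act0 y f : act 0 y f = 0.
Proof. by apply: funext => s; rewrite /act /= big_nil. Qed.

Lemma act_nil q y f : act q y f [::] = 0.
Proof. by case: q => [|q]; rewrite /act /= big_nil. Qed.

Lemma act_fix_head q y f x : fix_head x (act q.+1 y f) = fix_head (br x y) f +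
  act q y (fix_head x f).
Proof. by apply: funext => s; rewrite /fix_head /act /= big_cons big_map. Qed.

Lemma act_cons q y f x s : act q.+1 y f (x :: s) = f (br x y :: s) +
  act q y (fix_head x f) s.
Proof. by rewrite -[LHS]/(fix_head x (act q.+1 y f) s) act_fix_head. Qed.

Lemma cobdry_nil f : cobdry f [::] = 0.
Proof. by rewrite /cobdry /= big_nil. Qed.

Lemma cobdry_cons f y s : cobdry f (y :: s) =
  cobdry (fix_head y f) s + (-1) ^+ (size s).+1 *: act (size s) y f s.
Proof.
rewrite /cobdry /= big_cat !big_map /=; congr (_ + _).
by rewrite /act scaler_sumr.
Qed.

Lemma size_act_words q y s t : t \in act_words q y s -> size t = size s.
Proof.
elim: q s t => [|q IH] [|x s] t //=; rewrite inE => /orP[/eqP->//|/mapP[t' t'P ->]] /=.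
by rewrite (IH _ _ t'P).
Qed.

Lemma act_words_fuel N y s : (size s <= N)%N ->
  act_words N y s = act_words (size s) y s.
Proof. by elim: N s => [|N IH] [|x s] //= le; rewrite IH. Qed.

(** Once N reaches the length of the word, [act N] is the action on all letters. One value of N thus
    serves several degrees. *)
Lemma act_fuel N y f s : (size s <= N)%N -> act N y f s = act (size s) y f s.
Proof. by move=> le; rewrite /act act_words_fuel. Qed.

Lemma size_bdry_words ct s : ct \in bdry_words s -> (size ct.2).+1 = size s.
Proof.
elim: s ct => [|y s IH] ct //=; rewrite mem_cat => /orP[] /mapP.
  by case=> ct' /IH <- ->.
by case=> t /size_act_words <- ->.
Qed.

Lemma actD q y f g : act q y (f + g) = act q y f + act q y g.
Proof. by apply: funext => s; rewrite fct_addE /act -big_split. Qed.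

Lemma actZ q y c f : act q y (c *: f) = c *: act q y f.
Proof. by apply: funext => s; rewrite fct_scaleE /act scaler_sumr. Qed.

Lemma cobdryD f g : cobdry (f + g) = cobdry f + cobdry g.
Proof.
by apply: funext => s; rewrite fct_addE /cobdry -big_split; apply: eq_bigr => ct _;
  rewrite fct_addE scalerDr.
Qed.

Lemma cobdryZ c f : cobdry (c *: f) = c *: cobdry f.
Proof.
apply: funext => s; rewrite fct_scaleE /cobdry scaler_sumr; apply: eq_bigr => ct _.
by rewrite scalerA mulrC -scalerA.
Qed.

Lemma cobdry_sum I (r : seq I) (F : I -> seq V -> W) :
  cobdry (\sum_(i <- r) F i) = \sum_(i <- r) cobdry (F i).
Proof.
apply: (big_morph cobdry cobdryD).
by rewrite -[X in cobdry X](scale0r 0) cobdryZ scale0r.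
Qed.

Lemma eq_act q y f g s : (forall t, size t = size s -> f t = g t) ->
  act q y f s = act q y g s.
Proof. by move=> fg; apply: eq_big_seq => t /size_act_words; apply: fg. Qed.

Lemma eq_cobdry f g s : (forall t, (size t).+1 = size s -> f t = g t) ->
  cobdry f s = cobdry g s.
Proof. by move=> fg; apply: eq_big_seq => ct /size_bdry_words /fg ->. Qed.

Lemma mlinear_fix_head x f : mlinear f -> mlinear (fix_head x f).
Proof. by move=> fl s1 s2 c u v; have := fl (x :: s1) s2 c u v. Qed.

Lemma mlinear_head f c u v s :
  mlinear f -> f ((c *: u + v) :: s) = c *: f (u :: s) + f (v :: s).
Proof. by move=> fl; exact: (fl [::]). Qed.

Lemma fix_head_lin f c u v : mlinear f ->
  fix_head (c *: u + v) f = c *: fix_head u f + fix_head v f.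
Proof. by move=> fl; apply: funext => s; exact: mlinear_head. Qed.

Lemma mlinear_rec f : (forall c u v s, f ((c *: u + v) :: s) = c *: f (u :: s) + f (v :: s))
  -> (forall x, mlinear (fix_head x f)) -> mlinear f.
Proof. by move=> f0 f1 [|x s1] s2 c u v; [exact: f0 | exact: (f1 x)]. Qed.

Lemma mlinear0 f s1 s2 : mlinear f -> f (s1 ++ 0 :: s2) = 0.
Proof.
move=> fl; have := fl s1 s2 (-1) 0 0; rewrite scaler0 addr0 scaleN1r => ->.
by rewrite addNr.
Qed.

Lemma mlinearD f s1 s2 u v : mlinear f ->
  f (s1 ++ (u + v) :: s2) = f (s1 ++ u :: s2) + f (s1 ++ v :: s2).
Proof. by move=> fl; have := fl s1 s2 1 u v; rewrite !scale1r. Qed.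

Lemma mlinearZ f s1 s2 c u : mlinear f ->
  f (s1 ++ (c *: u) :: s2) = c *: f (s1 ++ u :: s2).
Proof. by move=> fl; have := fl s1 s2 c u 0; rewrite !addr0 mlinear0 // addr0. Qed.

Lemma mlinearN f s1 s2 u : mlinear f -> f (s1 ++ (- u) :: s2) = - f (s1 ++ u :: s2).
Proof. by move=> fl; rewrite -[- u]scaleN1r mlinearZ // scaleN1r. Qed.

Lemma mlinear_sum f s1 s2 I (r : seq I) (P : pred I) (F : I -> V) : mlinear f ->
  f (s1 ++ (\sum_(i <- r | P i) F i) :: s2) = \sum_(i <- r | P i) f (s1 ++ F i :: s2).
Proof.
move=> fl; apply: (big_morph (fun v => f (s1 ++ v :: s2))); last exact: mlinear0.
by move=> u v; exact: mlinearD.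
Qed.

Lemma mlinear_add f g : mlinear f -> mlinear g -> mlinear (f + g).
Proof. by move=> fl gl s1 s2 c u v;
  rewrite /= ?(fct_addE, fct_scaleE) fl gl scalerDr addrACA. Qed.

Lemma mlinear_scale c f : mlinear f -> mlinear (c *: f).
Proof.
by move=> fl s1 s2 d u v;
  rewrite /= ?(fct_addE, fct_scaleE) fl scalerDr !scalerA [c * d]mulrC.
Qed.

Lemma mlinear_fix_prefix u f : mlinear f -> mlinear (fix_prefix u f).
Proof. by move=> fl s1 s2 c x v; rewrite /fix_prefix !catA; apply: fl. Qed.

Lemma mlinear_fix_suffix w f : mlinear f -> mlinear (fix_suffix w f).
Proof. by move=> fl s1 s2 c x v; rewrite /fix_suffix -!catA; apply: fl. Qed.

Lemma supp_add k f g : supp_size k f -> supp_size k g -> supp_size k (f + g).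
Proof. by move=> fl gl s sk; rewrite ?(fct_addE, fct_scaleE) fl // gl // addr0. Qed.

Lemma supp_scale k c f : supp_size k f -> supp_size k (c *: f).
Proof. by move=> fl s sk; rewrite ?(fct_addE, fct_scaleE) fl // scaler0. Qed.

Lemma supp_act k q y f : supp_size k f -> supp_size k (act q y f).
Proof.
by move=> fk s sk; rewrite /act big_seq big1 // => t /size_act_words st; rewrite fk ?st.
Qed.

Lemma supp_cobdry k f : supp_size k f -> supp_size k.+1 (cobdry f).
Proof.
move=> fk s sk; rewrite /cobdry big_seq big1 // => ct /size_bdry_words st.
by rewrite fk ?scaler0 // -eqSS st.
Qed.

Lemma supp_fix_head k x f : supp_size k.+1 f -> supp_size k (fix_head x f).
Proof. by move=> fk s sk; apply: fk. Qed.

Lemma supp_cobdry_after k q f : supp_size k f -> supp_size k.+1 (cobdry_after q f).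
Proof.
elim: q k f => [|q IH] k f fk /=; first exact: supp_cobdry.
case=> [|x s] //= sk; case: k fk sk => [|k] fk sk; last first.
  by apply: (IH k) => //; apply: supp_fix_head.
suff -> : fix_head x f = 0 by elim: (q) (s) => [|q' IH'] s' /=;
  [rewrite -[X in cobdry X](scale0r 0) cobdryZ scale0r | case: s' => //].
by apply: funext => t; apply: fk.
Qed.

Lemma supp_insert_at k q a f : supp_size k.+1 f -> supp_size k (insert_at q a f).
Proof.
elim: q k f => [|q IH] k f fk /=; first exact: supp_fix_head.
case=> [|x s] //= sk; case: k fk sk => [|k] fk sk; last first.
  by apply: (IH k) => //; apply: supp_fix_head.
case: q {IH} => [|q]; first by rewrite /= /fix_head fk.
elim: q x s (fix_head x f) (@supp_fix_head 0 x f fk) {sk} => [|q IH] y [|x s] g gk //=.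
  by rewrite /fix_head gk.
by apply: (IH x s) => t tk; apply: gk.
Qed.

Lemma act_add_fix_prefix u q y f w : act (size u + q) y f (u ++ w) =
  act (size u) y (fix_suffix w f) u + act q y (fix_prefix u f) w.
Proof.
elim: u f => [|x u IH] f /=; first by rewrite act0 add0r.
by rewrite !act_cons IH addrA.
Qed.

Lemma act_fix_suffix u y f w :
  act (size u) y f (u ++ w) = act (size u) y (fix_suffix w f) u.
Proof. by rewrite -{1}[size u]addn0 act_add_fix_prefix act0 addr0. Qed.

End Operators.

Section Bracket.
Hypothesis br_l : forall c u v y, br (c *: u + v) y = c *: br u y + br v y.
Hypothesis br_r : forall c y u v, br y (c *: u + v) = c *: br y u + br y v.
Hypothesis br_jac : forall s x y, br (br s x) y = br s (br x y) + br (br s y) x.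

Variable W : lmodType K.
Implicit Types f g : seq V -> W.

Lemma act_lin f q c x y s : mlinear f ->
  act q (c *: x + y) f s = c *: act q x f s + act q y f s.
Proof.
elim: q f s => [|q IH] f [|z s] fl; rewrite ?act_nil ?act0 ?scaler0 ?addr0 //.
rewrite !act_cons IH; last exact: mlinear_fix_head.
by rewrite br_r (mlinear_head _ _ _ _ fl) scalerDr addrACA.
Qed.

Lemma act_sumr f q I (r : seq I) (F : I -> V) s : mlinear f ->
  act q (\sum_(i <- r) F i) f s = \sum_(i <- r) act q (F i) f s.
Proof.
move=> fl; apply: (big_morph (fun y => act q y f s)).
  by move=> x y; have := act_lin q 1 x y s fl; rewrite !scale1r.
by have := act_lin q (-1) 0 0 s fl; rewrite scaler0 addr0 scaleN1r addNr.
Qed.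

Lemma act_mlinear q y f : mlinear f -> mlinear (act q y f).
Proof.
elim: q f => [|q IH] f fl; first by rewrite act0 => s1 s2 c u v; rewrite scaler0 addr0.
apply: mlinear_rec => [c u v s|x].
  rewrite !act_cons (fix_head_lin _ _ _ fl) actD actZ ?(fct_addE, fct_scaleE) br_l (mlinear_head _ _ _ _ fl).
  by rewrite scalerDr addrACA.
by rewrite act_fix_head; apply: mlinear_add;
  [apply: mlinear_fix_head | apply/IH/mlinear_fix_head].
Qed.

Lemma cobdry_mlinear f : mlinear f -> mlinear (cobdry f).
Proof.
move=> fl s1; elim: s1 f fl => [|x s1 IH] f fl s2 c u v /=.
  rewrite !cobdry_cons (fix_head_lin _ _ _ fl) cobdryD cobdryZ ?(fct_addE, fct_scaleE) act_lin // !scalerDr.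
  by rewrite addrACA !scalerA [c * _]mulrC.
rewrite !cobdry_cons IH; last exact: mlinear_fix_head.
rewrite !size_cat /= act_mlinear // !scalerDr addrACA !scalerA.
by rewrite [c * _]mulrC.
Qed.

Lemma cobdry_after_mlinear q f : mlinear f -> mlinear (cobdry_after q f).
Proof.
elim: q f => [|q IH] f fl; first exact: cobdry_mlinear.
apply: mlinear_rec => [c u v s|x] /=; last by apply/IH/mlinear_fix_head.
rewrite (fix_head_lin _ _ _ fl);
  elim: q (fix_head u f) (fix_head v f) s {IH} => [|q IH] g h s /=.
  by rewrite cobdryD cobdryZ.
by case: s => [|y s]; rewrite ?scaler0 ?addr0 // -IH.
Qed.

Lemma cobdry_afterD q f g s : cobdry_after q (f + g) s = cobdry_after q f s +
  cobdry_after q g s.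
Proof.
elim: q f g s => [|q IH] f g s /=; first by rewrite cobdryD.
by case: s => [|y s]; rewrite ?addr0 // -IH.
Qed.

Lemma cobdry_afterZ q c f s : cobdry_after q (c *: f) s = c *: cobdry_after q f s.
Proof.
elim: q f s => [|q IH] f s /=; first by rewrite cobdryZ.
by case: s => [|y s]; rewrite ?scaler0 // -IH.
Qed.

Lemma insert_at_mlinear q a f : mlinear f -> mlinear (insert_at q a f).
Proof.
elim: q f => [|q IH] f fl; first exact: mlinear_fix_head.
apply: mlinear_rec => [c u v s|x] /=; last by apply/IH/mlinear_fix_head.
rewrite (fix_head_lin _ _ _ fl);
  elim: q (fix_head u f) (fix_head v f) s {IH} => [|q IH] g h s //=.
by case: s => [|y s]; rewrite ?scaler0 ?addr0 // -IH.
Qed.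

Lemma insert_at_cat u a f w : insert_at (size u) a f (u ++ w) = f (u ++ a :: w).
Proof. by elim: u f => [|x u IH] f //=; rewrite IH. Qed.

Lemma cobdry_after_cat u f w :
  cobdry_after (size u) f (u ++ w) = cobdry (fix_prefix u f) w.
Proof. by elim: u f => [|x u IH] f //=; rewrite IH. Qed.

(** On a single letter this is the Leibniz identity [br_jac]. Brackets taken in two different
    letters commute. *)
Lemma act_comm q x y f : mlinear f ->
  act q x (act q y f) = act q y (act q x f) + act q (br x y) f.
Proof.
elim: q f => [|q IH] f fl; first by rewrite !act0 addr0.
apply: funext => -[|z s]; rewrite ?(fct_addE, fct_scaleE) ?act_nil ?addr0 //.
rewrite !act_cons !act_fix_head !actD ?(fct_addE, fct_scaleE) IH;
  last exact: mlinear_fix_head.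
have brD : fix_head (br (br z x) y) f =
  fix_head (br z (br x y)) f + fix_head (br (br z y) x) f.
  by rewrite br_jac -[X in fix_head (X + _)]scale1r fix_head_lin // scale1r.
have := congr1 (fun h => h s) brD; rewrite ?(fct_addE, fct_scaleE) /fix_head => ->.
by rewrite [LHS](AC ((2*1)*(1*2)) ((2*4)*(3*5)*(1*6)))/=.
Qed.

(** When the last factor x is peeled off, the two sides differ by the commutator of the actions of x
    and y, which [act_comm] identifies with the action of [br x y]. *)
Lemma cobdry_act N y f s : mlinear f -> (size s <= N)%N ->
  cobdry (act N y f) s = act N y (cobdry f) s.
Proof.
elim: N f s => [|N IH] f [|x s] fl //= sN; rewrite ?cobdry_nil ?act_nil //.
rewrite cobdry_cons act_fix_head cobdryD !fct_addE IH //; last exact: mlinear_fix_head.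
rewrite act_cons cobdry_cons.
have -> : fix_head x (cobdry f) =
  fun s => cobdry (fix_head x f) s + (-1) ^+ (size s).+1 *: act (size s) x f s.
  by apply: funext => t; rewrite /fix_head cobdry_cons.
set M := size s;
  rewrite [X in _ = _ + X](@eq_act _ N y _ (cobdry (fix_head x f) + (-1) ^+ M.+1 *: act M x f)); last first.
  by move=> t st; rewrite fct_addE fct_scaleE st.
rewrite actD actZ fct_addE fct_scaleE -!addrA; congr (_ + _); rewrite [RHS]addrCA;
  congr (_ + _).
rewrite -scalerDr; congr (_ *: _).
rewrite (@eq_act _ M x (act N.+1 y f) (act M y f)) => [|t st]; last first.
  by rewrite act_fuel ?st // ltnW.
by rewrite act_comm // fct_addE [act N y _ _]act_fuel // addrC.
Qed.

(* This and cobdry_act are Cartan's formulas: d(w, y) = (dw, y) +- w . y makes  *)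
(* d o d = 0 equivalent to the equivariance of d, by induction on the length.   *)
Lemma cobdry_cobdry f : mlinear f -> cobdry (cobdry f) = 0.
Proof.
move=> fl; apply: funext => s; elim: s f fl => [|x s IH] f fl; first exact: cobdry_nil.
rewrite cobdry_cons; set M := size s.
rewrite (@eq_cobdry _ _ (cobdry (fix_head x f) + (-1) ^+ M *: act M x f)) => [|t];
  last first.
  by rewrite -/M => st;
    rewrite {1}/fix_head cobdry_cons -st fct_addE fct_scaleE [in RHS]act_fuel.
rewrite cobdryD fct_addE IH ?add0r; last exact: mlinear_fix_head.
by rewrite cobdryZ fct_scaleE cobdry_act // exprS mulN1r scaleNr addrN.
Qed.

Lemma cobdry_after_act_total N q y f s : mlinear f -> (size s <= N)%N ->
  cobdry_after q (act N y f) s = act N y (cobdry_after q f) s.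
Proof.
elim: q N f s => [|q IH] N f s fl sN; first exact: cobdry_act.
case: s N sN => [|x s] [|N] //= sN; rewrite ?act_nil //.
rewrite act_fix_head cobdry_afterD IH //; last exact: mlinear_fix_head.
by rewrite act_cons /=; congr (_ + act _ _ _ _); apply: funext.
Qed.

(** The two operators work on disjoint sets of letters. *)
Lemma cobdry_after_act q y f s :
  cobdry_after q (act q y f) s = act q y (cobdry_after q f) s.
Proof.
elim: q f s => [|q IH] f s /=.
  by rewrite !act0 -[X in cobdry X](scale0r 0) cobdryZ scale0r.
case: s => [|x s]; first by rewrite act_nil.
by rewrite act_fix_head cobdry_afterD IH act_cons.
Qed.

End Bracket.
End LeibnizForms.

(** * The filtration by alternating forms on I *)

Section Filtration.
Variables (K : fieldType) (n : nat).
Local Notation V := (sl_semidirect K n).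
Local Notation br := (@sd_bracket K n).

Lemma sd_bracket_l c (u v y : V) : br (c *: u + v) y = c *: br u y + br v y.
Proof. exact: sd_bracket_linearl. Qed.

Lemma sd_bracket_r c (y u v : V) : br y (c *: u + v) = c *: br y u + br y v.
Proof. exact: sd_bracket_linearr. Qed.

Lemma sd_bracket_leibniz (s x y : V) : br (br s x) y = br s (br x y) + br (br s y) x.
Proof. by rewrite [in RHS]sd_bracket_jacobi subrK. Qed.

Definition sd_act_mlinear := act_mlinear sd_bracket_l.
Definition sd_cobdry_mlinear := cobdry_mlinear sd_bracket_l sd_bracket_r.
Definition sd_cobdry_after_mlinear := cobdry_after_mlinear sd_bracket_l sd_bracket_r.

Definition vec_in (z : 'cV[K]_n) : V := (0, z).

Lemma vec_in_linear c u v : vec_in (c *: u + v) = c *: vec_in u + vec_in v.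
Proof. by congr pair; rewrite -[RHS]/(c *: 0 + 0) scaler0 addr0. Qed.

HB.instance Definition _ :=
  GRing.isLinear.Build K 'cV[K]_n (sl_semidirect K n) _ vec_in vec_in_linear.

Lemma split_vec_in (y : V) : y = (y.1, 0) + vec_in y.2.
Proof. by case: y => a z; congr pair; rewrite /= ?addr0 ?add0r. Qed.

Lemma br_vec_in z z' : br (vec_in z) (vec_in z') = 0.
Proof.
by congr pair; first apply: val_inj; rewrite /= ?mulmx0 ?mul0mx ?subrr.
Qed.

Lemma br_g (y a : V) : y.2 = 0 -> a.2 = 0 -> (br y a).2 = 0.
Proof. by move=> y0 a0; rewrite /= y0 a0 !mulmx0 subrr. Qed.

Section FilteredForms.
Variable W : lmodType K.
Implicit Types f g : seq V -> W.

(* The step F_p of the filtration: in its p last arguments, f factors through   *)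
(* the projection to I and is alternating.                                      *)
Definition wedge_fil p f :=
  (forall s1 y s2, (size s1 < p)%N -> y.2 = 0 -> f (s1 ++ y :: s2) = 0) /\
  (forall s1 y s2, ((size s1).+1 < p)%N -> f (s1 ++ y :: y :: s2) = 0).

Definition sl_invariant f := forall (a : V) s, a.2 = 0 -> act br (size s) a f s = 0.

Lemma wedge_fil0 f : wedge_fil 0 f.
Proof. by []. Qed.

Lemma wedge_fil_le p q f : (p <= q)%N -> wedge_fil q f -> wedge_fil p f.
Proof.
move=> pq [f1 f2]; split=> s1 y s2 sp; last by apply: f2; apply: leq_trans pq.
by apply: f1; apply: leq_trans pq.
Qed.

Lemma wedge_fil_fix_head p x f : wedge_fil p.+1 f -> wedge_fil p (fix_head x f).
Proof.
by move=> [f1 f2]; split=> s1 y s2 sp; [exact: (f1 (x :: s1)) | exact: (f2 (x :: s1))].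
Qed.

Lemma wedge_fil_add p f g : wedge_fil p f -> wedge_fil p g -> wedge_fil p (f + g).
Proof.
move=> [f1 f2] [g1 g2]; split=> s1 y s2 *; rewrite fct_addE.
  by rewrite f1 ?g1 ?addr0.
by rewrite f2 ?g2 ?addr0.
Qed.

Lemma wedge_fil_scale p c f : wedge_fil p f -> wedge_fil p (c *: f).
Proof.
move=> [f1 f2]; split=> s1 y s2 *; rewrite fct_scaleE.
  by rewrite f1 ?scaler0.
by rewrite f2 ?scaler0.
Qed.

Lemma wedge_fil_swap p f s1 y z s2 :
  mlinear f -> wedge_fil p f -> ((size s1).+1 < p)%N ->
  f (s1 ++ y :: z :: s2) = - f (s1 ++ z :: y :: s2).
Proof.
move=> fl [_ f2] sp; apply/eqP; rewrite -addr_eq0; apply/eqP.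
have := f2 s1 (y + z) s2 sp; rewrite mlinearD //.
have E x : f (s1 ++ x :: (y + z) :: s2) =
  f (s1 ++ x :: y :: s2) + f (s1 ++ x :: z :: s2).
  by have := mlinearD (rcons s1 x) s2 y z fl; rewrite !cat_rcons.
by rewrite !E !f2 // add0r addr0.
Qed.

Lemma wedge_fil_move p f s1 u x w :
  mlinear f -> wedge_fil p f -> (size s1 + size u < p)%N ->
  f (s1 ++ u ++ x :: w) = (-1) ^+ size u *: f (s1 ++ x :: u ++ w).
Proof.
move=> fl fp; elim: u s1 => [|y u IH] s1 /= sp; first by rewrite scale1r.
rewrite -cat_rcons IH ?size_rcons 1?addSnnS // cat_rcons (wedge_fil_swap _ _ _ fl fp) //.
  by rewrite exprS mulN1r scaleNr scalerN.
by apply: leq_ltn_trans sp; rewrite addnS ltnS leq_addr.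
Qed.

Lemma wedge_fil_proj p f u w : mlinear f ->
  (forall s1 y s2, (size s1 < p)%N -> y.2 = 0 -> f (s1 ++ y :: s2) = 0) ->
  (size u <= p)%N -> f (u ++ w) = f (map vec_in (map snd u) ++ w).
Proof.
elim: u p f => [|y u IH] [|p] f fl fp //= up.
rewrite {1}[y]split_vec_in (mlinearD [::]) //=.
rewrite (fp [::]) // add0r -/(fix_head _ f _) (IH p) //; first exact: mlinear_fix_head.
by move=> s1 z s2 sp; apply: (fp (_ :: s1)).
Qed.

Lemma act_eq0 q a f s : (forall t, f t = 0) -> act br q a f s = 0.
Proof. by move=> f0; rewrite /act big1. Qed.

(** The bracket with a maps g to itself. On a repeated pair y, y the terms with [y,a], y and with y,
    [y,a] cancel by antisymmetry; [p <= q] guarantees that both letters are acted on. *)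
Lemma wedge_fil_act p q a f : mlinear f -> wedge_fil p f -> (p <= q)%N -> a.2 = 0 ->
  wedge_fil p (act br q a f).
Proof.
move=> fl fp pq a0; split=> s1 y s2.
  elim: s1 p q f fl fp pq => [|x s1 IH] [|p] [|q] f fl fp pq //= sp y0.
    rewrite act_cons (fp.1 [::]) ?br_g // add0r act_eq0 // => t.
    exact: (fp.1 [::]).
  rewrite act_cons (fp.1 (_ :: s1)) // add0r (IH p) //;
    [exact: mlinear_fix_head | exact: wedge_fil_fix_head].
elim: s1 p q f fl fp pq => [|x s1 IH] [|p] [|q] f fl fp pq //= sp.
  case: q p fp sp pq => [|q] [|p] //= fp sp pq.
  rewrite !act_cons addrA {1}/fix_head (wedge_fil_swap (s1 := [::]) _ _ _ fl fp) // addNr add0r.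
  by rewrite act_eq0 // => t; apply: (fp.2 [::]).
by rewrite act_cons (fp.2 (_ :: s1)) // add0r (IH p) //;
  [exact: mlinear_fix_head | exact: wedge_fil_fix_head].
Qed.

Lemma wedge_fil_insert_at p q a f :
  wedge_fil p f -> (p <= q)%N -> wedge_fil p (insert_at q a f).
Proof.
move=> fp pq; split=> s1 y s2.
  elim: s1 p q f fp pq => [|x s1 IH] [|p] [|q] f fp pq //= sp y0; last first.
    by apply: (IH p) => //; apply: wedge_fil_fix_head.
  have : forall t, fix_head y f t = 0 by move=> t; apply: (fp.1 [::]).
  elim: (q) s2 (fix_head y f) => [|q' IH] s2 g g0; first exact: g0.
  by case: s2 => [|z s2] //=; apply: IH => t; apply: g0.
elim: s1 p q f fp pq => [|x s1 IH] [|p] [|q] f fp pq //= sp; last first.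
  by apply: (IH p) => //; apply: wedge_fil_fix_head.
case: q p fp sp pq => [|q] [|p] //= fp sp pq.
have : forall t, fix_head y (fix_head y f) t = 0 by move=> t; apply: (fp.2 [::]).
elim: (q) s2 (fix_head y (fix_head y f)) => [|q' IH] s2 g g0; first exact: g0.
by case: s2 => [|z s2] //=; apply: IH => t; apply: g0.
Qed.

Lemma cobdry_eq0 f s : (forall t, f t = 0) -> cobdry br f s = 0.
Proof. by move=> f0; rewrite /cobdry big1 // => ct _; rewrite f0 scaler0. Qed.

Lemma cobdry_after_eq0 q f s : (forall t, f t = 0) -> cobdry_after br q f s = 0.
Proof.
elim: q f s => [|q IH] f s f0; first exact: cobdry_eq0.
by case: s => [|x s] //=; apply: IH => t; apply: f0.
Qed.

Lemma wedge_fil_cobdry_after p q f :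
  wedge_fil p f -> (p <= q)%N -> wedge_fil p (cobdry_after br q f).
Proof.
move=> fp pq; split=> s1 y s2.
  elim: s1 p q f fp pq => [|x s1 IH] [|p] [|q] f fp pq //= sp y0; last first.
    by apply: (IH p) => //; apply: wedge_fil_fix_head.
  by apply: cobdry_after_eq0 => t; apply: (fp.1 [::]).
elim: s1 p q f fp pq => [|x s1 IH] [|p] [|q] f fp pq //= sp; last first.
  by apply: (IH p) => //; apply: wedge_fil_fix_head.
case: q p fp sp pq => [|q] [|p] //= fp sp pq.
by apply: cobdry_after_eq0 => t; apply: (fp.2 [::]).
Qed.

Lemma act_vec_in q z f l w : mlinear f -> 
  act br (size l + q) (vec_in z) f (map vec_in l ++ w) =
    act br q (vec_in z) (fix_prefix (map vec_in l) f) w.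
Proof.
elim: l f => [|x l IH] f fl //=.
by rewrite act_cons br_vec_in (mlinear0 [::]) // add0r IH //; apply: mlinear_fix_head.
Qed.

(* The terms in which a is bracketed with a letter of l recombine, because f is *)
(* alternating, into the action of a on l; invariance then cancels them against *)
(* the action of a on w.                                                        *)
Lemma cobdry_wedge_fil_g f l a w : mlinear f -> wedge_fil (size l) f -> a.2 = 0 ->
  cobdry br f (map vec_in l ++ a :: w) =
    cobdry br (fix_prefix (map vec_in l) f) (a :: w)
   + (-1) ^+ (size w).+1 *: act br (size l) a (fix_suffix w f) (map vec_in l).
Proof.
elim: l f => [|x l IH] f fl fp a0 /=.
  by rewrite act0 scaler0 addr0.
rewrite cobdry_cons IH //; [|exact: mlinear_fix_head | exact: wedge_fil_fix_head].
rewrite -addrA; congr (_ + _); rewrite [in RHS]act_cons scalerDr addrC; congr (_ + _).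
rewrite size_cat size_map /= act_vec_in // act_cons [act br _ _ _ _]act_eq0 ?addr0;
  last first.
  by move=> t; rewrite /fix_head /fix_prefix (fp.1) ?size_map.
rewrite /fix_prefix (wedge_fil_move (s1 := [::]) _ _ fl fp) ?size_map //= scalerA /fix_suffix.
rewrite sd_bracketC (mlinearN [::]) //= scalerN -scaleNr; congr (_ *: _).
by rewrite addnS !exprS exprD !mulN1r !opprK mulrAC -expr2 sqrr_sign mul1r.
Qed.

(** Letters of I have zero brackets with each other. The two copies of z act on w with opposite
    signs, and when a letter of l acts on w, the pair z, z stays among the alternating arguments. *)
Lemma cobdry_wedge_fil_vec_in f l z w : mlinear f -> wedge_fil (size l).+1 f ->
  cobdry br f (map vec_in l ++ vec_in z :: vec_in z :: w) =
  cobdry br (fix_prefix (map vec_in l ++ [:: vec_in z; vec_in z]) f) w.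
Proof.
elim: l f => [|x l IH] f fl fp /=.
  rewrite !cobdry_cons /= act_cons br_vec_in (mlinear0 [::]) // add0r -addrA -scalerDl.
  by rewrite [_ ^+ _.+2]exprS mulN1r subrr scale0r addr0.
rewrite cobdry_cons IH; [|exact: mlinear_fix_head | exact: wedge_fil_fix_head].
rewrite size_cat size_map /= act_vec_in // !act_cons !{1}/fix_head br_vec_in.
rewrite /fix_prefix !mlinear0 //.
rewrite /fix_head -[_ :: 0 :: w]cat1s catA mlinear0 // !add0r act_eq0 ?scaler0 ?addr0 //.
by move=> t; rewrite /fix_head fp.2 ?size_map.
Qed.

Lemma cobdry_cat_vec_in_g f p u a w :
  mlinear f -> wedge_fil p f -> sl_invariant f -> size u = p -> a.2 = 0 ->
  cobdry br f (map vec_in (map snd u) ++ a :: w) =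
    cobdry br (fix_prefix (rcons u a) f) w.
Proof.
move=> fl fp fi su a0;
  rewrite cobdry_wedge_fil_g ?size_map ?su // cobdry_cons -addrA -scalerDr.
set l := map snd u; have sl : size (map vec_in l) = p by rewrite !size_map.
have := fi a (map vec_in l ++ w) a0; rewrite size_cat act_add_fix_prefix sl.
rewrite [X in _ *: X]addrC => ->; rewrite scaler0 addr0.
apply: eq_cobdry => t _;
  rewrite /fix_head /fix_prefix cat_rcons [RHS](wedge_fil_proj _ fl fp.1) //.
by rewrite su.
Qed.

Lemma wedge_fil_cobdry p f : mlinear f -> wedge_fil p f -> sl_invariant f ->
  wedge_fil p (cobdry br f).
Proof.
move=> fl fp fi; have dfl := sd_cobdry_mlinear fl.
(* The formulas for the coboundary require a prefix made of letters of I. Membership in F_q, already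
   known, allows the first q letters to be replaced by their I-components, and this gives
   F_{q+1}. *)
suff: forall q, (q <= p)%N -> wedge_fil q (cobdry br f) by apply.
elim=> [|q IH] qp; first exact: wedge_fil0.
have {}IH := IH (ltnW qp); have fq := wedge_fil_le qp fp;
  have fq' := wedge_fil_le (ltnW qp) fp.
have f1 s1 y s2 : (size s1 < q.+1)%N -> y.2 = 0 -> cobdry br f (s1 ++ y :: s2) = 0.
  rewrite ltnS leq_eqVlt => /orP[/eqP sq|sq] y0; last exact: (IH.1).
  rewrite (wedge_fil_proj _ dfl IH.1) ?sq // (cobdry_cat_vec_in_g _ fl fq' fi) //.
  by apply: cobdry_eq0 => t; rewrite /fix_prefix cat_rcons fp.1 ?sq.
split=> // s1 y s2; rewrite ltnS => sq.
have [{}sq|sq'] := ltnP (size s1).+1 q; first exact: (IH.2).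
have {sq'}sq : (size s1).+1 = q by apply/eqP; rewrite eqn_leq sq.
rewrite -cat1s -[_ :: s2]cat1s !catA (wedge_fil_proj _ dfl f1);
  last by rewrite !size_cat !addn1 ltnS sq.
rewrite !map_cat -!catA /= cobdry_wedge_fil_vec_in //; last by rewrite size_map sq.
by apply: cobdry_eq0 => t; rewrite /fix_prefix -catA fp.2 // !size_map sq.
Qed.

(** The prefixes [rcons u a] here and [u ++ [:: vec_in z; vec_in z]] in the next lemma represent a
    spanning set of U_p. On both, the coboundary is that of the remaining arguments. *)
Lemma cobdry_cat_g p f u a w :
  mlinear f -> wedge_fil p f -> sl_invariant f -> size u = p -> a.2 = 0 ->
  cobdry br f (u ++ a :: w) = cobdry br (fix_prefix (rcons u a) f) w.
Proof.
move=> fl fp fi su a0.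
rewrite (wedge_fil_proj _ (sd_cobdry_mlinear fl) (wedge_fil_cobdry fl fp fi).1) ?su //.
exact: (cobdry_cat_vec_in_g _ fl fp).
Qed.

Lemma cobdry_cat_vec_in p f u z w :
  mlinear f -> wedge_fil p f -> sl_invariant f -> (size u).+1 = p ->
  cobdry br f (u ++ vec_in z :: vec_in z :: w) =
    cobdry br (fix_prefix (u ++ [:: vec_in z; vec_in z]) f) w.
Proof.
move=> fl fp fi su.
rewrite (wedge_fil_proj _ (sd_cobdry_mlinear fl) (wedge_fil_cobdry fl fp fi).1) -?su //.
rewrite cobdry_wedge_fil_vec_in ?size_map ?su //; apply: eq_cobdry => t _.
by rewrite /fix_prefix -!catA [RHS](wedge_fil_proj _ fl fp.1) // -su.
Qed.

End FilteredForms.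
End Filtration.

(** * Words and the tensor power *)

Section TensorWords.
Variables (K : fieldType) (V : vectType K).

Definition word_of q (x : {ffun 'I_q -> V}) : seq V := rev (codom x).

(** The universal form of degree q: every multilinear form of degree q is a linear map composed with
    it (see [tlift_tensor_word]). The value 0 at other lengths puts it in a single degree. *)
Definition tensor_word q (s : seq V) : tpow V q :=
  if size s == q then tensor [ffun i : 'I_q => nth 0 (rev s) i] else 0.

Lemma size_word_of q (x : {ffun 'I_q -> V}) : size (word_of x) = q.
Proof. by rewrite size_rev size_codom card_ord. Qed.

Lemma nth_word_of q (x : {ffun 'I_q -> V}) (i : 'I_q) : nth 0 (rev (word_of x)) i = x i.
Proof.
rewrite /word_of revK (nth_map i) ?size_enum_ord //.
by rewrite nth_ord_enum.
Qed.

Lemma word_of_ffun q s : size s = q -> word_of [ffun i : 'I_q => nth 0 (rev s) i] = s.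
Proof.
move=> sq; rewrite -[RHS]revK; congr rev; apply: (@eq_from_nth _ 0).
  by rewrite size_codom card_ord size_rev.
move=> i; rewrite size_codom card_ord => iq.
by have := nth_word_of [ffun i : 'I_q => nth 0 (rev s) i] (Ordinal iq);
  rewrite /word_of revK ffunE.
Qed.

Lemma tensor_word_word_of q (x : {ffun 'I_q -> V}) :
  tensor_word q (word_of x) = tensor x.
Proof.
by rewrite /tensor_word size_word_of eqxx; congr tensor; apply/ffunP=> i;
  rewrite ffunE nth_word_of.
Qed.

Lemma word_of_fupd q (x : {ffun 'I_q -> V}) i v :
  word_of (fupd x i v) = rev (drop i.+1 (codom x)) ++ v :: rev (take i (codom x)).
Proof.
rewrite -cat_rcons -rev_cons -rev_cat; congr rev; apply: (@eq_from_nth _ 0).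
  rewrite size_cat /= size_take size_drop !size_codom card_ord ltn_ord.
  by rewrite -subSn // subSS subnKC // ltnW.
move=> j; rewrite size_codom card_ord => jq.
have := nth_word_of (fupd x i v) (Ordinal jq); rewrite /word_of revK ffunE /= => ->.
have xj k (kq : (k < q)%N) : nth 0 (codom x) k = x (Ordinal kq).
  by have := nth_word_of x (Ordinal kq); rewrite /word_of revK.
rewrite nth_cat size_take size_codom card_ord ltn_ord -val_eqE /=.
case: ltngtP => [ji|ij|->]; last by rewrite subnn.
  by rewrite nth_take // xj.
have -> : (j - i = (j - i.+1).+1)%N by rewrite subnS prednK // subn_gt0.
by rewrite /= nth_drop subnKC // xj.
Qed.

Lemma mlinear_multilinear q (W : lmodType K) (f : seq V -> W) : mlinear f ->
  multilinear (fun x : {ffun 'I_q -> V} => f (word_of x)).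
Proof. by move=> fl x i a u v; rewrite !word_of_fupd fl. Qed.

Lemma tensor_word_mlinear q : mlinear (tensor_word q).
Proof.
move=> s1 s2 c u v; rewrite /tensor_word !size_cat /=; case: eqP => [sq|_]; last first.
  by rewrite scaler0 addr0.
have iq : (size s2 < q)%N by rewrite -sq addnS ltnS leq_addl.
pose x := [ffun i : 'I_q => nth 0 (rev (s1 ++ 0 :: s2)) i].
have E w : [ffun i : 'I_q => nth 0 (rev (s1 ++ w :: s2)) i] = fupd x (Ordinal iq) w.
  apply/ffunP=> j;
    rewrite !ffunE !rev_cat !rev_cons !cat_rcons !nth_cat size_rev -val_eqE /=.
  by case: ltngtP => // h;
    [rewrite -(prednK (_ : (0 < j - size s2)%N)) ?subn_gt0 // | rewrite h subnn].
by rewrite !E tensor_multilinear.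
Qed.

Lemma tlift_tensor_word q (W : lmodType K) (f : seq V -> W) s :
  mlinear f -> size s = q ->
  tlift (fun x : {ffun 'I_q -> V} => f (word_of x)) (tensor_word q s) = f s.
Proof.
move=> fl sq;
  rewrite -{1}(word_of_ffun sq) tensor_word_word_of tlift_tensor ?word_of_ffun //.
exact: mlinear_multilinear.
Qed.

End TensorWords.

(** * The Casimir operator and its self-adjointness *)

Section Casimir.
Variables (R : realFieldType) (n : nat).
Hypothesis n_gt0 : (0 < n)%N.
Local Notation V := (sl_semidirect R n).
Local Notation br := (@sd_bracket R n).

(** The projection of gl_n onto sl_n along the scalar matrices. Scalars being central, the
    elementary matrices keep their gl_n brackets (see [br_sl_in]). *)
Definition sl_in (M : 'M[R]_n) : V := (vsproj (slv R n) (M - (\tr M / n%:R)%:M), 0).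

Lemma trace_free_in (M : 'M[R]_n) : M - (\tr M / n%:R)%:M \in slv R n.
Proof.
rewrite mem_slv linearB /= mxtrace_scalar -[X in _ - X]mulr_natr divfK ?subrr //.
by rewrite pnatr_eq0 -lt0n.
Qed.

Lemma vsval_sl_in M : vsval (sl_in M).1 = M - (\tr M / n%:R)%:M.
Proof. by rewrite vsprojK // trace_free_in. Qed.

Lemma sl_in_linear c M N : sl_in (c *: M + N) = c *: sl_in M + sl_in N.
Proof.
congr pair; last by rewrite -[RHS]/(c *: 0 + 0) scaler0 addr0.
apply: val_inj; rewrite [LHS]vsprojK ?trace_free_in //.
have -> : val ((c *: sl_in M).1 + (sl_in N).1) =
  c *: vsval (sl_in M).1 + vsval (sl_in N).1.
  by rewrite -linearP.
rewrite !vsval_sl_in linearP /=.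
rewrite mulrDl -mulrA raddfD /= -scale_scalar_mx scalerBr.
by rewrite opprD addrACA.
Qed.

Lemma sl_in0 : sl_in 0 = 0.
Proof. by have := sl_in_linear (-1) 0 0; rewrite scaler0 addr0 scaleN1r addNr. Qed.

Lemma sl_in_sum I (r : seq I) (F : I -> 'M_n) :
  sl_in (\sum_(i <- r) F i) = \sum_(i <- r) sl_in (F i).
Proof.
by apply: (big_morph sl_in _ sl_in0) => M N; have := sl_in_linear 1 M N;
  rewrite !scale1r.
Qed.

Lemma sl_inZ c M : sl_in (c *: M) = c *: sl_in M.
Proof. by have := sl_in_linear c M 0; rewrite !addr0 sl_in0 addr0. Qed.

Lemma sl_inB M N : sl_in (M - N) = sl_in M - sl_in N.
Proof. by rewrite addrC -scaleN1r sl_in_linear scaleN1r addrC. Qed.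

Lemma sl_in_val (a : V) : a.2 = 0 -> sl_in (vsval a.1) = a.
Proof.
case: a => a z /= ->; congr pair; apply: val_inj;
  rewrite [LHS]vsprojK ?trace_free_in //.
have := subvsP a; rewrite mem_slv => /eqP ->.
by rewrite mul0r raddf0 subr0.
Qed.

Lemma br_sl_in M N : br (sl_in M) (sl_in N) = sl_in (M *m N - N *m M).
Proof.
congr pair; last by rewrite !mulmx0 subrr.
have tr0 : \tr (M *m N - N *m M) = 0 by rewrite linearB /= mxtrace_mulC subrr.
apply: val_inj; rewrite [RHS]vsprojK ?trace_free_in // tr0 mul0r raddf0 subr0.
rewrite [LHS]/= !vsval_sl_in.
have E (A B : 'M[R]_n) c d : (A - c%:M) *m (B - d%:M) - (B - d%:M) *m (A - c%:M) =
  A *m B - B *m A.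
  rewrite !mulmxBl !mulmxBr !mul_mx_scalar !mul_scalar_mx !scale_scalar_mx [d * c]mulrC.
  move: (A *m B) (B *m A) (c *: B) (d *: A) (_%:M) => X Y Z T U.
  by apply/matrixP=> i j; rewrite !mxE; ring.
exact: E.
Qed.

Lemma br_vec_in_sl_in z N : br (vec_in z) (sl_in N) =
  vec_in (- ((N - (\tr N / n%:R)%:M) *m z)).
Proof.
congr pair; first by apply: val_inj; rewrite /= mul0mx mulmx0 subrr.
by rewrite vsval_sl_in /= mulmx0 sub0r.
Qed.

Lemma mxtrace_delta_mx i j : \tr (delta_mx i j : 'M[R]_n) = (i == j)%:R.
Proof.
rewrite /mxtrace (bigD1 i) //= big1 ?addr0 => [|k /negPf ki]; first by rewrite mxE eqxx.
by rewrite mxE ki.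
Qed.

(* The images of the elementary matrices in sl_n, together with the basis of I. *)
(* It is only a spanning family, but the bracket with the image of E_ij has     *)
(* transpose the bracket with the image of E_ji in these coordinates.           *)
Definition frame (b : ('I_n * 'I_n) + 'I_n) : V :=
  match b with inl ij => sl_in (delta_mx ij.1 ij.2) | inr k => vec_in (delta_mx k ord0) end.

Notation a_ i j := (sl_in (delta_mx i j)).

Lemma br_frame_g k l i j : br (a_ k l) (a_ i j) =
  (l == i)%:R *: a_ k j - (k == j)%:R *: a_ i l.
Proof.
rewrite br_sl_in !mul_delta_mx_cond sl_inB -!scaler_nat !sl_inZ.
by rewrite (eq_sym j k).
Qed.

Lemma br_frame_vec_in k i j : br (vec_in (delta_mx k ord0)) (a_ i j) =
  (i == j)%:R / n%:R *: vec_in (delta_mx k ord0) - (k == j)%:R *: vec_in (delta_mx i ord0).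
Proof.
rewrite br_vec_in_sl_in mulmxBl mul_delta_mx_cond mul_scalar_mx opprB.
rewrite mxtrace_delta_mx -scaler_nat (eq_sym j k).
by rewrite linearB !linearZ.
Qed.

Lemma frame_span (x : V) : exists c :
  ('I_n * 'I_n) + 'I_n -> R, x = \sum_b c b *: frame b.
Proof.
exists (fun b => match b with inl ij => vsval x.1 ij.1 ij.2 | inr k => x.2 k ord0 end).
rewrite big_sumType /= {1}[x]split_vec_in; congr (_ + _).
  rewrite -[(x.1, 0)]sl_in_val //= {1}[vsval x.1]matrix_sum_delta pair_bigA sl_in_sum /=.
  by apply: eq_bigr => ij _; rewrite sl_inZ.
rewrite {1}[x.2]matrix_sum_delta (eq_bigr (fun k => x.2 k ord0 *: delta_mx k ord0));
  last first.
  by move=> k _; rewrite big_ord1.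
by rewrite linear_sum; apply: eq_bigr => k _; rewrite linearZ.
Qed.

Lemma sum_delta (F : 'I_n -> R) i : \sum_k (k == i)%:R * F k = F i.
Proof.
rewrite (bigD1 i) //= eqxx mul1r big1 ?addr0 // => k /negPf ->.
by rewrite mul0r.
Qed.

(** On the matrix part, the Kronecker symbols collapse both sides to the sum over k of b(a_kj, a_ki)
    minus the sum over l of b(a_il, a_jl). *)
Lemma frame_adj (b : V -> V -> R) (bl : forall c x y z, b (c *: x + y) z = c * b x z + b y z)
   (brr : forall c x y z, b z (c *: x + y) = c * b z x + b z y) i j :
  \sum_k b (br (frame k) (a_ i j)) (frame k) =
    \sum_k b (frame k) (br (frame k) (a_ j i)).
Proof.
have b0l z : b 0 z = 0 by have := bl (-1) 0 0 z; rewrite scaler0 addr0 mulN1r addNr.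
have b0r z : b z 0 = 0 by have := brr (-1) 0 0 z; rewrite scaler0 addr0 mulN1r addNr.
have bl2 c d x y z : b (c *: x - d *: y) z = c * b x z - d * b y z.
  by rewrite bl -scaleNr -[- d *: y]addr0 bl b0l addr0 mulNr.
have br2 c d x y z : b z (c *: x - d *: y) = c * b z x - d * b z y.
  by rewrite brr -scaleNr -[- d *: y]addr0 brr b0r addr0 mulNr.
rewrite !big_sumType /=; congr (_ + _).
  rewrite -(pair_bigA _ (fun k l => b (br (a_ k l) (a_ i j)) (a_ k l))) /=.
  rewrite -(pair_bigA _ (fun k l => b (a_ k l) (br (a_ k l) (a_ j i)))) /=.
  under eq_bigr => k _ do under eq_bigr => l _ do rewrite br_frame_g bl2.
  under [RHS]eq_bigr => k _ do under eq_bigr => l _ do rewrite br_frame_g br2.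
  under eq_bigr => k _ do rewrite sumrB sum_delta -mulr_sumr.
  under [RHS]eq_bigr => k _ do rewrite sumrB sum_delta -mulr_sumr.
  by rewrite !sumrB !sum_delta.
under eq_bigr => k _ do rewrite br_frame_vec_in bl2.
under [RHS]eq_bigr => k _ do rewrite br_frame_vec_in br2.
by rewrite !sumrB !sum_delta (eq_sym j i).
Qed.

Section InnerProduct.
Implicit Types f g : seq V -> R^o.

(** On the diagonal this is a sum of squares. It is definite on multilinear forms of degree q
    because the frame spans V. *)
Fixpoint frame_ip q f g : R :=
  if q is q'.+1 then \sum_b frame_ip q' (fix_head (frame b) f) (fix_head (frame b) g) else f [::] * g [::].

Lemma frame_ip_lin_l q c f f' g :
  frame_ip q (c *: f + f') g = c * frame_ip q f g + frame_ip q f' g.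
Proof.
elim: q f f' g => [|q IH] f f' g /=.
  by rewrite fct_addE fct_scaleE mulrDl -mulrA.
by rewrite mulr_sumr -big_split; apply: eq_bigr => b _; apply: IH.
Qed.

Lemma frame_ip_sym q f g : frame_ip q f g = frame_ip q g f.
Proof.
by elim: q f g => [|q IH] f g /=; [rewrite mulrC | apply: eq_bigr => b _].
Qed.

Lemma frame_ip_lin_r q c f f' g :
  frame_ip q g (c *: f + f') = c * frame_ip q g f + frame_ip q g f'.
Proof. by rewrite !(frame_ip_sym _ g) frame_ip_lin_l. Qed.

Lemma eq_frame_ip q f f' g g' : (forall s, size s = q -> f s = f' s) ->
  (forall s, size s = q -> g s = g' s) -> frame_ip q f g = frame_ip q f' g'.
Proof.
elim: q f f' g g' => [|q IH] f f' g g' ff gg /=; first by rewrite ff // gg.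
apply: eq_bigr => b _; apply: IH => s sq; rewrite /fix_head; [apply: ff | apply: gg];
by rewrite /= sq.
Qed.

Lemma frame_ip_adj q f g i j : mlinear f -> mlinear g ->
  frame_ip q (act br q (a_ i j) f) g = frame_ip q f (act br q (a_ j i) g).
Proof.
elim: q f g => [|q IH] f g fl gl /=; first by rewrite !act0 mulr0 mul0r.
have E h k : fix_head (frame k) (act br q.+1 h f) =
  1 *: fix_head (br (frame k) h) f + act br q h (fix_head (frame k) f).
  by rewrite scale1r act_fix_head.
have E' h k : fix_head (frame k) (act br q.+1 h g) =
  1 *: fix_head (br (frame k) h) g + act br q h (fix_head (frame k) g).
  by rewrite scale1r act_fix_head.
under eq_bigr => b _ do rewrite E frame_ip_lin_l mul1r.
under [RHS]eq_bigr => b _ do rewrite E' frame_ip_lin_r mul1r.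
rewrite !big_split /=; congr (_ + _).
  apply: (frame_adj (b := fun x y => frame_ip q (fix_head x f) (fix_head y g))) => c x y z.
    by rewrite fix_head_lin // frame_ip_lin_l.
  by rewrite fix_head_lin // frame_ip_lin_r.
by apply: eq_bigr => b _; apply: IH; apply: mlinear_fix_head.
Qed.

Lemma frame_ip_ge0 q f : 0 <= frame_ip q f f.
Proof.
elim: q f => [|q IH] f /=; first by rewrite -expr2 sqr_ge0.
by apply: sumr_ge0 => b _; apply: IH.
Qed.

Lemma frame_ip_eq0 q f : mlinear f -> frame_ip q f f = 0 -> forall s, size s = q ->
  f s = 0.
Proof.
elim: q f => [|q IH] f fl /=.
  by move=> /eqP; rewrite mulf_eq0 orbb => /eqP f0 [].
move/eqP; rewrite psumr_eq0 => [/allP ip0|b _]; last exact: frame_ip_ge0.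
case=> [|x s] // [sq]; have [c ->] := frame_span x.
rewrite -[_ :: s]cat0s mlinear_sum // big1 // => b _; rewrite mlinearZ //=.
have /eqP := ip0 b (mem_index_enum _); move/(IH _ (mlinear_fix_head _ fl)) => /(_ s sq).
by rewrite /fix_head => ->; rewrite scaler0.
Qed.

Lemma frame_ip0l q g : frame_ip q 0 g = 0.
Proof. by have := frame_ip_lin_l q (-1) 0 0 g; rewrite scaler0 addr0 mulN1r addNr. Qed.

Lemma frame_ip_sum_l q I (r : seq I) (F : I -> seq V -> R^o) g :
  frame_ip q (\sum_(i <- r) F i) g = \sum_(i <- r) frame_ip q (F i) g.
Proof.
apply: (big_morph (fun f => frame_ip q f g)); last exact: frame_ip0l.
by move=> f f'; have := frame_ip_lin_l q 1 f f' g; rewrite scale1r mul1r.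
Qed.

End InnerProduct.

Section CasimirOperator.
Variables (W : lmodType R).
Implicit Types f g : seq V -> W.

(** The Casimir element of the trace form, acting on the last q arguments. By [frame_ip_adj] it is
    the sum of the products of each action of a_ij with its adjoint on the left, hence
    nonnegative. *)
Definition casimir q (f : seq V -> W) :=
  \sum_(ij : 'I_n * 'I_n) act br q (a_ ij.2 ij.1) (act br q (a_ ij.1 ij.2) f).

Fixpoint casimir_poly q (d : seq R) (f : seq V -> W) : seq V -> W :=
  if d is x :: d' then x *: f + casimir q (casimir_poly q d' f) else 0.

Lemma act_zero q y : act br q y (0 : seq V -> W) = 0.
Proof. by have := actZ br q y 0 (0 : seq V -> W); rewrite !scale0r. Qed.

Lemma casimirD q f g : casimir q (f + g) = casimir q f + casimir q g.
Proof. by rewrite /casimir -big_split; apply: eq_bigr => ij _; rewrite !actD. Qed.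

Lemma casimirZ q c f : casimir q (c *: f) = c *: casimir q f.
Proof. by rewrite /casimir scaler_sumr; apply: eq_bigr => ij _; rewrite !actZ. Qed.

Lemma casimir0 q : casimir q 0 = 0.
Proof. by have := casimirZ q 0 0; rewrite !scale0r. Qed.

Lemma casimir_sum q I (r : seq I) (F : I -> seq V -> W) :
  casimir q (\sum_(i <- r) F i) = \sum_(i <- r) casimir q (F i).
Proof. exact: (big_morph (casimir q) (casimirD q) (casimir0 q)). Qed.

Lemma casimir_polyD q d f g : casimir_poly q d (f + g) = casimir_poly q d f +
  casimir_poly q d g.
Proof.
elim: d => [|x d IH] /=; first by rewrite addr0.
by rewrite IH casimirD scalerDr addrACA.
Qed.

Lemma casimir_polyZ q d c f : casimir_poly q d (c *: f) = c *: casimir_poly q d f.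
Proof.
elim: d => [|x d IH] /=; first by rewrite scaler0.
by rewrite IH casimirZ scalerDr !scalerA mulrC.
Qed.

Lemma casimir_poly_sum q d I (r : seq I) (F : I -> seq V -> W) :
  casimir_poly q d (\sum_(i <- r) F i) = \sum_(i <- r) casimir_poly q d (F i).
Proof.
apply: (big_morph (casimir_poly q d) (casimir_polyD q d)).
by have := casimir_polyZ q d 0 0; rewrite !scale0r.
Qed.

Lemma casimir_poly_casimir q d f :
  casimir q (casimir_poly q d f) = casimir_poly q d (casimir q f).
Proof.
elim: d => [|x d IH] /=; first exact: casimir0.
by rewrite casimirD casimirZ IH.
Qed.

Lemma casimir_polyE q d f : casimir_poly q d f =
  \sum_(i < size d) d`_i *: iter i (casimir q) f.
Proof.
elim: d => [|x d IH] /=; first by rewrite big_ord0.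
rewrite big_ord_recl IH casimir_sum; congr (_ + _).
by apply: eq_bigr => i _; rewrite casimirZ.
Qed.

End CasimirOperator.

Section Compat.
Variables (W W' : lmodType R) (q : nat) (P : (seq V -> W) -> (seq V -> W') -> Prop).

Implicit Types (f : seq V -> W) (g : seq V -> W').

(* Relations preserved by all linear combinations of products of operators of   *)
(* the action: predicates (invariant subspaces) as well as equivariant maps.    *)
Definition compat :=
  [/\ P 0 0, (forall f f' g g', P f g -> P f' g' -> P (f + f') (g + g')),
      (forall c f g, P f g -> P (c *: f) (c *: g)) &
      (forall (a : V) f g, a.2 = 0 -> P f g -> P (act br q a f) (act br q a g))].

Lemma compat_sum I (r : seq I) (F : I -> seq V -> W) (G : I -> seq V -> W') :
  compat -> (forall i, P (F i) (G i)) -> P (\sum_(i <- r) F i) (\sum_(i <- r) G i).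
Proof.
case=> P0 PD _ _ FG; elim: r => [|i r IH]; first by rewrite !big_nil.
by rewrite !big_cons; apply: PD.
Qed.

Lemma compat_casimir f g : compat -> P f g -> P (casimir q f) (casimir q g).
Proof.
move=> Pc fg; apply: compat_sum => // ij.
by by case: Pc => _ _ _ Pth; apply: (Pth) => //; apply: (Pth).
Qed.

Lemma compat_casimir_poly d f g :
  compat -> P f g -> P (casimir_poly q d f) (casimir_poly q d g).
Proof.
move=> Pc fg; have [P0 PD PZ _] := Pc; elim: d => [|x d IH] //=.
by apply: PD; [apply: PZ | apply: compat_casimir].
Qed.

End Compat.

Lemma compat_mlinear (W : lmodType R) q :
  compat q (fun f _ : seq V -> W => mlinear f).
Proof.
split=> [|f f' _ _|c f _|a f _ _].
- by move=> s1 s2 c u v; rewrite scaler0 addr0.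
- exact: mlinear_add.
- exact: mlinear_scale.
- exact: sd_act_mlinear.
Qed.

Lemma compat_fix_suffix (W : lmodType R) q w :
  compat q (fun f g : seq V -> W => forall u, size u = q -> f (u ++ w) = g u).
Proof.
split=> // [f f' g g' fg fg' u uq|c f g fg u uq|a f g _ fg u uq].
- by rewrite fct_addE fg // fg'.
- by rewrite fct_scaleE fg.
- by rewrite -uq act_fix_suffix; apply: eq_act => t; rewrite uq; apply: fg.
Qed.

Lemma compat_linear (W W' : lmodType R) q (h : {linear W -> W'}) :
  compat q (fun (f : seq V -> W') (g : seq V -> W) => forall u, size u = q -> f u = h (g u)).
Proof.
split=> // [u _|f f' g g' fg fg' u uq|c f g fg u uq|a f g _ fg u uq].
- by rewrite linear0.
- by rewrite !fct_addE fg // fg' // linearD.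
- by rewrite !fct_scaleE fg // linearZ.
- rewrite /act linear_sum; apply: eq_big_seq => t /size_act_words tu.
  by apply: fg; rewrite tu.
Qed.

(** Applied to the universal form, the powers of the Casimir give endomorphisms of the
    finite-dimensional space [tpow V q], so they are dependent. The relation passes to every f
    because the Casimir commutes with linear maps on the values. *)
Lemma casimir_dependent q : exists2 d : seq R, has (fun x => x != 0) d &
  forall f : seq V -> R^o, mlinear f -> forall s, size s = q -> casimir_poly q d f s =
    0.
Proof.
pose T : vectType R := tpow V q.
have itl i : mlinear (iter i (casimir q) (tensor_word q) : seq V -> T).
  elim: i => [|i IH]; first exact: tensor_word_mlinear.
  exact: (compat_casimir (f := iter i (casimir q) (tensor_word q)) (g := 0) (compat_mlinear T q) IH).
pose E i : 'Hom(T, T) :=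
  linfun (tlift (fun x : {ffun 'I_q -> V} => iter i (casimir q) (tensor_word q) (word_of x) : T)).
pose N := (\dim {:'Hom(T, T)}).+1.
have /freeP nf : ~~ free [tuple E i | i < N].
  rewrite /free size_tuple neq_ltn ltnS dimvS ?subvf //.
have {nf} : exists k : 'I_N ->
  R, ~ (\sum_(i < N) k i *: [tuple E i | i < N]`_i = 0 -> forall i, k i = 0).
  by apply/existsNP.
case=> k /not_implyP[kE /existsNP[i0 /eqP ki0]].
exists [seq k i | i <- enum 'I_N]; first by apply/hasP; exists (k i0);
  rewrite ?map_f ?mem_enum.
move=> f fl s sq.
have := compat_casimir_poly [seq k i | i <- enum 'I_N] (compat_linear q (tlift (fun x : {ffun 'I_q -> V} => f (word_of x)))) (f := f) (g := tensor_word q).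
move=> -> //; last by move=> u uq; rewrite /= tlift_tensor_word.
rewrite (_ : casimir_poly _ _ _ _ = 0) ?linear0 //.
rewrite casimir_polyE fct_sumE size_map size_enum_ord.
move/(congr1 (fun g : 'Hom(T, T) => g (tensor_word q s))): kE;
  rewrite sum_lfunE zero_lfunE => kE.
rewrite -[RHS]kE; apply: eq_bigr => i _.
rewrite (nth_map i0) ?size_enum_ord // nth_ord_enum fct_scaleE scale_lfunE.
by rewrite -tnth_nth tnth_mktuple lfunE /= tlift_tensor_word.
Qed.

(** For C self-adjoint, the pairing of C f with itself is the pairing of f with C C f, which is
    0. *)
Lemma casimir_casimir_eq0 q (f : seq V -> R^o) : mlinear f ->
  (forall s, size s = q -> casimir q (casimir q f) s = 0) -> forall s, size s = q ->
    casimir q f s = 0.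
Proof.
move=> fl CC; have Cl := compat_casimir (g := f) (compat_mlinear R^o q) fl.
have CS (g h : seq V -> R^o) : mlinear g -> mlinear h -> frame_ip q (casimir q g) h =
    \sum_(ij : 'I_n * 'I_n) frame_ip q (act br q (a_ ij.1 ij.2) g) (act br q (a_ ij.1 ij.2) h).
  by move=> gl hl; rewrite frame_ip_sum_l; apply: eq_bigr => ij _;
    rewrite [LHS]frame_ip_adj //; apply: sd_act_mlinear.
apply: frame_ip_eq0 => //; rewrite CS //.
transitivity (frame_ip q f (casimir q (casimir q f))).
  rewrite frame_ip_sym CS //.
  by apply: eq_bigr => ij _; rewrite frame_ip_sym.
by rewrite frame_ip_sym (@eq_frame_ip q _ 0 f f) ?frame_ip0l // => s sq; rewrite CC.
Qed.

(** The pairing of C f with f is the sum of the squared norms of the images of f under the a_ij, and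
    the a_ij span g. *)
Lemma casimir_eq0_act q (f : seq V -> R^o) : mlinear f ->
  (forall s, size s = q -> casimir q f s = 0) ->
  forall (a : V) s, a.2 = 0 -> size s = q -> act br q a f s = 0.
Proof.
move=> fl C0.
have ip0 : frame_ip q (casimir q f) f = 0.
  by rewrite (@eq_frame_ip q _ 0 f f) ?frame_ip0l // => s sq; rewrite C0.
have act0 i j s : size s = q -> act br q (a_ i j) f s = 0.
  apply: frame_ip_eq0; first exact: sd_act_mlinear.
  move/eqP: ip0; rewrite frame_ip_sum_l psumr_eq0 => [/allP ip0|ij _]; last first.
    by rewrite frame_ip_adj //; [exact: frame_ip_ge0 | exact: sd_act_mlinear].
  have /eqP := ip0 (i, j) (mem_index_enum _).
  by move=> /= ipij; rewrite -[RHS]ipij [RHS]frame_ip_adj //; exact: sd_act_mlinear.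
move=> a s a0 sq;
  rewrite -(sl_in_val a0) [vsval a.1]matrix_sum_delta pair_bigA /= sl_in_sum.
rewrite (act_sumr (@sd_bracket_r R n)) // big1 // => ij _; rewrite sl_inZ.
have := act_lin (@sd_bracket_r R n) q (vsval a.1 ij.1 ij.2) (a_ ij.1 ij.2) 0 s fl.
by rewrite !addr0 => ->; rewrite act0 // scaler0 add0r;
  have := act_sumr (@sd_bracket_r R n) q [::] (fun _ : 'I_0 => 0) s fl;
    rewrite !big_nil.
Qed.

(* If r(C) = 0 with r = X^a r1 and r1(0) = 1, then C^a r1(C) = 0, hence         *)
(* C r1(C) = 0 as C is self-adjoint, and r1(C) f is invariant.                  *)
Lemma casimir_split q : exists d : seq R, forall f : seq V -> R^o, mlinear f ->
  forall (a : V) u w, a.2 = 0 -> size u = q ->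
  act br q a (f + casimir q (casimir_poly q d f)) (u ++ w) = 0.
Proof.
suff [d dP] : exists d : seq R, forall f : seq V -> R^o, mlinear f ->
  forall s, size s = q ->
    casimir q (f + casimir q (casimir_poly q d f)) s = 0.
  exists d => f fl a u w a0 uq; rewrite -{1}uq act_fix_suffix uq.
  rewrite (@eq_act _ _ _ _ q a _ (fix_suffix w f + casimir q (casimir_poly q d (fix_suffix w f)))) => [|t tu].
    apply: casimir_eq0_act => // [|s sq]; last by apply: dP => //;
      apply: mlinear_fix_suffix.
    apply: mlinear_add; first exact: mlinear_fix_suffix.
    apply: (compat_casimir (g := f) (compat_mlinear _ q)).
    by apply: (compat_casimir_poly (g := f) _ (compat_mlinear _ q));
      apply: mlinear_fix_suffix.
  rewrite uq in tu; rewrite !fct_addE /fix_suffix fct_addE; congr (_ + _).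
  apply: (compat_casimir (compat_fix_suffix _ q w)) => //.
  by apply: (compat_casimir_poly _ (compat_fix_suffix _ q w)).
have [d0 nz dP] := casimir_dependent q.
(* One more factor C is put in front so that the relation survives the removal of a zero constant
   term: C C r' = 0 gives back C r' = 0. *)
have {dP} : forall f : seq V -> R^o, mlinear f -> forall s, size s = q ->
  casimir q (casimir_poly q d0 f) s = 0.
  move=> f fl s sq; rewrite casimir_poly_casimir; apply: dP => //.
  exact: (compat_casimir (g := f) (compat_mlinear _ q)).
elim: d0 nz => [|x d IH] //= nz dP; have [x0|x0] := eqVneq x 0.
  apply: IH => [|f fl s sq]; first by rewrite x0 eqxx in nz.
  apply: casimir_casimir_eq0 => // [|t tq];
    first exact: (compat_casimir_poly (g := f) _ (compat_mlinear _ q)).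
  by have := dP f fl t tq; rewrite x0 scale0r add0r.
exists [seq x^-1 * y | y <- d] => f fl s sq.
have -> : casimir_poly q [seq x^-1 * y | y <- d] f = x^-1 *: casimir_poly q d f.
  elim: (d) => [|y d' IHd] /=; first by rewrite scaler0.
  by rewrite IHd casimirZ scalerDr scalerA.
have := dP f fl s sq; rewrite !casimirD !casimirZ !fct_addE !fct_scaleE => E.
by rewrite -[X in X + _](scalerK x0) -scalerDr E scaler0.
Qed.

(** * Torus weights and the vanishing on U_p *)

Section Weights.
Hypothesis n_gt1 : (1 < n)%N.
Variable W : lmodType R.
Implicit Types f : seq V -> W.

Definition basis_vec (k : 'I_n) : V := vec_in (delta_mx k ord0).
Definition torus i j : V := sl_in (delta_mx i i - delta_mx j j).

Lemma br_basis_vec_torus k i j :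
  br (basis_vec k) (torus i j) = ((k == j)%:R - (k == i)%:R) *: basis_vec k.
Proof.
rewrite /torus sl_inB addrC -scaleN1r sd_bracket_r /basis_vec !br_frame_vec_in !eqxx scaleN1r opprB scalerBl.
have E l : (k == l)%:R *: vec_in (delta_mx l ord0) =
  (k == l)%:R *: vec_in (delta_mx k ord0) :> V.
  by have [->|] := eqVneq k l; rewrite ?scale0r.
by rewrite !E addrA subrK.
Qed.

Lemma br_sl_in_torus i j : i != j -> br (a_ i j) (torus i j) = (-2) *: a_ i j.
Proof.
move=> /negPf ij; rewrite /torus br_sl_in mulmxBr mulmxBl !mul_delta_mx_cond.
rewrite (eq_sym j i) ij !eqxx !mulr1n !mulr0n sub0r subr0 -opprD -sl_inZ scaleNr.
by rewrite scaler_nat mulr2n.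
Qed.

Lemma wedge_fil_uniq p f l w :
  mlinear f -> wedge_fil p f -> (size l <= p)%N -> ~~ uniq l ->
  f (map basis_vec l ++ w) = 0.
Proof.
elim: l p f => [|k l IH] [|p] f //= fl fp lp.
rewrite negb_and negbK => /orP[kl|]; last first.
  by apply: (IH p (fix_head (basis_vec k) f)) => //;
    [exact: mlinear_fix_head | exact: wedge_fil_fix_head].
have [l1 [l2 El]] : exists l1 l2, l = l1 ++ k :: l2.
  by case/splitPr: kl => l1 l2; exists l1, l2.
rewrite El map_cat /= -catA /= in lp *.
rewrite size_cat /= in lp.
have := wedge_fil_move (s1 := [:: basis_vec k]) (u := map basis_vec l1) (basis_vec k) (map basis_vec l2 ++ w) fl fp.
rewrite size_map /= => ->; last by lia.
by rewrite (fp.2 [::]) ?scaler0 //=; move: lp => /=; lia.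
Qed.

(** The eigenvalue of [torus i j] on the basis word l. Since g acts by brackets on the right, a
    letter i counts -1 and a letter j counts +1. *)
Definition weight i j (l : seq 'I_n) : R := (count_mem j l)%:R - (count_mem i l)%:R.

Lemma weight_le1 i j l : uniq l -> weight i j l <= 1 - (i \in l)%:R.
Proof.
move=> ul; rewrite /weight !count_uniq_mem // lerD2r.
by case: (_ \in _); rewrite ?lexx ?ler01.
Qed.

(** Both the letter a_ij and the pair e_i, e_i have weight -2, while distinct letters contribute at
    most 1. The total weight is therefore nonzero and an invariant form vanishes there. *)
Lemma weight_subr2 i j l : uniq l -> weight i j l - 2 != 0.
Proof.
move=> ul; have := weight_le1 i j ul; have := ler0n R (i \in l).
clear ul; move: (_%:R) (weight _ _ _) => x y x0 yx; apply/eqP => E; lra.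
Qed.

Lemma act_weight i j f l : mlinear f ->
  act br (size l) (torus i j) f (map basis_vec l) = weight i j l *: f (map basis_vec l).
Proof.
elim: l f => [|k l IH] f fl /=; first by rewrite act0 /weight subrr scale0r.
rewrite act_cons IH; last exact: mlinear_fix_head.
rewrite br_basis_vec_torus (mlinearZ [::]) //= -scalerDl; congr (_ *: _).
by rewrite /weight /= !natrD; ring.
Qed.

Lemma expand_basis_vec p f : mlinear f ->
  (forall l, size l = p -> f (map basis_vec l) = 0) ->
  forall z, size z = p -> f (map (@vec_in R n) z) = 0.
Proof.
elim: p f => [|p IH] f fl f0 [|x z] //= => [_|[zp]]; first exact: (f0 [::]).
have -> : vec_in x = \sum_k x k ord0 *: basis_vec k.
  rewrite {1}[x]matrix_sum_delta linear_sum; apply: eq_bigr => k _.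
  by rewrite big_ord1 linearZ.
rewrite (mlinear_sum [::]) // big1 // => k _; rewrite (mlinearZ [::]) //.
have := IH (fix_head (basis_vec k) f) (mlinear_fix_head _ fl) _ z zp;
  rewrite /fix_head /= => ->; first by rewrite scaler0.
by move=> l lp; apply: (f0 (k :: l)); rewrite /= lp.
Qed.

Section Kill.
Variables (p : nat) (f : seq V -> W).
Hypotheses (fl : mlinear f) (fp : wedge_fil p f)
  (fi : forall (a : V) u, a.2 = 0 -> size u = p.+1 -> act br p.+1 a f u = 0).

Lemma expand_wedge_fil (w : seq V) q : (q <= p)%N ->
  (forall l, size l = q -> uniq l -> f (map basis_vec l ++ w) = 0) ->
  forall u, size u = q -> f (u ++ w) = 0.
Proof.
move=> qp f0 u uq; rewrite (wedge_fil_proj _ fl fp.1) ?uq // -/(fix_suffix w f _).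
apply: (expand_basis_vec (p := q)); rewrite ?size_map //;
  first exact: mlinear_fix_suffix.
move=> l lq; have [ul|nul] := boolP (uniq l); first exact: f0.
by apply: (wedge_fil_uniq _ fl fp) => //; rewrite lq.
Qed.

Lemma torus2 i j : (torus i j).2 = 0.
Proof. by []. Qed.

Lemma act_split u v a : a.2 = 0 -> (size u + size v = p.+1)%N ->
  act br (size u) a (fix_suffix v f) u + act br (size v) a (fix_prefix u f) v = 0.
Proof. by move=> a0 uv; rewrite -act_add_fix_prefix uv fi // size_cat. Qed.

Lemma kill_offdiag u i j : i != j -> size u = p -> f (u ++ [:: a_ i j]) = 0.
Proof.
move=> ij; apply: expand_wedge_fil => // l lp ul.
have := @act_split (map basis_vec l) [:: a_ i j] (torus i j) (torus2 i j).
rewrite size_map lp addn1 => /(_ erefl); rewrite -{1}lp act_weight;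
  last exact: mlinear_fix_suffix.
rewrite /= act_cons act0 addr0 br_sl_in_torus // /fix_prefix mlinearZ // /fix_suffix -scalerDl.
move/eqP; rewrite scaler_eq0 => /orP[|/eqP//]; by rewrite (negPf (weight_subr2 i j ul)).
Qed.

(** The diagonal letters have weight 0 themselves. Letting a_ki act on (u, a_ik), where
    [kill_offdiag] removes the action on u, gives f(u, a_ii) = f(u, a_kk). The a_ii sum to the image
    of the identity, which is 0, so n times the common value vanishes. *)
Lemma kill_g u a : size u = p -> a.2 = 0 -> f (u ++ [:: a]) = 0.
Proof.
move=> up a0.
have diag i k : f (u ++ [:: a_ i i]) = f (u ++ [:: a_ k k]).
  have [->//|ik] := eqVneq i k.
  have := @act_split u [:: a_ i k] (a_ k i) erefl; rewrite up addn1 => /(_ erefl).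
  rewrite [X in X + _](_ : _ = 0) ?add0r; last first.
    rewrite /act big_seq big1 // => t /size_act_words tu; apply: kill_offdiag => //.
    by rewrite tu.
  rewrite /= act_cons act0 addr0 br_sl_in !mul_delta_mx sl_inB /fix_prefix -[- sl_in _]scale1r.
  rewrite -[u ++ _]/(u ++ _ :: [::]) addrC scale1r mlinearD // mlinearN // addrC.
  by move/eqP; rewrite subr_eq0 => /eqP.
have d0 i : f (u ++ [:: a_ i i]) = 0.
  have : f (u ++ [:: sl_in 1%:M]) = 0.
    rewrite (_ : sl_in _ = 0) ?mlinear0 //; congr pair; apply: val_inj.
    rewrite [LHS]vsprojK ?trace_free_in // mxtrace_scalar -[1 *+ n]/(n%:R) divff ?subrr //.
    by rewrite pnatr_eq0 -lt0n.
  have -> : 1%:M = \sum_k delta_mx k k :> 'M[R]_n.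
    rewrite [LHS]matrix_sum_delta; apply: eq_bigr => k _.
    rewrite (bigD1 k) //= big1 ?addr0 => [|l /negPf lk];
      first by rewrite mxE eqxx scale1r.
    by rewrite mxE eq_sym lk scale0r.
  rewrite sl_in_sum mlinear_sum // (eq_bigr (fun=> f (u ++ [:: a_ i i]))) => [|k _];
    last exact: diag.
  rewrite sumr_const card_ord -scaler_nat => /eqP; rewrite scaler_eq0 pnatr_eq0.
  by rewrite eqn0Ngt n_gt0 => /eqP.
rewrite -(sl_in_val a0) [vsval a.1]matrix_sum_delta pair_bigA /= sl_in_sum mlinear_sum //.
rewrite big1 // => -[i j] _ /=; rewrite sl_inZ mlinearZ //.
have [->|ij] := eqVneq i j; first by rewrite d0 scaler0.
by rewrite kill_offdiag ?scaler0.
Qed.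

Lemma kill_sym u z : (size u).+1 = p -> f (u ++ [:: vec_in z; vec_in z]) = 0.
Proof.
move=> up.
have pp q (lq : q.+1 = p) : (q <= p)%N by rewrite -lq.
have sq i v : (size v).+1 = p -> f (v ++ [:: basis_vec i; basis_vec i]) = 0.
  move=> vp; apply: (expand_wedge_fil (q := size v)) => //; first exact: pp.
  move=> l lp ul; have [il|il] := boolP (i \in l).
    have := @wedge_fil_uniq p f (rcons l i) [:: basis_vec i] fl fp.
    rewrite size_rcons lp vp map_rcons cat_rcons => -> //.
    by rewrite rcons_uniq il.
  (* A torus element needs a second index, which is where n >= 2 enters. *)
  have [j ij] : exists j, i != j.
    pose j0 := Ordinal n_gt0; pose j1 := Ordinal n_gt1.
    by have [->|] := eqVneq i j0; [exists j1 | exists j0].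
  have := @act_split (map basis_vec l) (map basis_vec [:: i; i]) (torus i j) (torus2 i j).
  rewrite !size_map lp addn2 vp => /(_ erefl).
  rewrite -{1}lp (act_weight i j l (mlinear_fix_suffix _ fl)) [X in _ + X](act_weight i j [:: i; i] (mlinear_fix_prefix _ fl)).
  rewrite /fix_suffix /fix_prefix /= -scalerDl => /eqP;
    rewrite scaler_eq0 => /orP[|/eqP//].
  by rewrite {2}/weight /= eqxx (negPf ij) sub0r (negPf (weight_subr2 i j ul)).
have anti i j : f (u ++ [:: basis_vec i; basis_vec j]) =
  - f (u ++ [:: basis_vec j; basis_vec i]).
  have [->|ij] := eqVneq i j; first by rewrite sq ?oppr0.
  have := @act_split u [:: basis_vec i; basis_vec i] (a_ j i) erefl;
    rewrite addn2 up => /(_ erefl).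
  rewrite [X in X + _](_ : _ = 0) ?add0r; last first.
    rewrite /act big_seq big1 // => t /size_act_words tu; apply: sq.
    by rewrite tu.
  rewrite /= !act_cons act0 addr0 /basis_vec br_frame_vec_in eqxx (eq_sym j i) (negPf ij) mul0r scale0r sub0r scale1r.
  have -> : fix_head (vec_in (delta_mx i ord0)) (fix_prefix u f) [:: - vec_in (delta_mx j ord0)] =
      - f (u ++ [:: basis_vec i; basis_vec j]).
    by rewrite /fix_head /fix_prefix -cat_rcons mlinearN // cat_rcons.
  have -> : fix_prefix u f [:: - vec_in (delta_mx j ord0); vec_in (delta_mx i ord0)] =
      - f (u ++ [:: basis_vec j; basis_vec i]) by rewrite /fix_prefix mlinearN.
  by rewrite -opprD => /eqP; rewrite oppr_eq0 addrC addr_eq0 => /eqP.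
have -> : vec_in z = \sum_k z k ord0 *: basis_vec k.
  rewrite {1}[z]matrix_sum_delta linear_sum; apply: eq_bigr => k _.
  by rewrite big_ord1 linearZ.
set S := f _.
have SE : S = \sum_k \sum_l (z k ord0 * z l ord0) *: f (u ++ [:: basis_vec k; basis_vec l]).
  rewrite /S mlinear_sum //; apply: eq_bigr => k _.
  rewrite mlinearZ // -cat_rcons mlinear_sum // scaler_sumr; apply: eq_bigr => l _.
  by rewrite mlinearZ // cat_rcons scalerA.
have : S = - S.
  rewrite {2}SE exchange_big SE -sumrN; apply: eq_bigr => k _; rewrite -sumrN.
  by apply: eq_bigr => l _; rewrite anti scalerN mulrC.
move/eqP; rewrite -addr_eq0 -mulr2n -scaler_nat scaler_eq0 pnatr_eq0 /=.
by move/eqP.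
Qed.

End Kill.

(* U_p has no coinvariants: a form that is invariant in its p+1 last arguments  *)
(* vanishes on U_p.                                                             *)
Lemma wedge_fil_kill p f : mlinear f -> wedge_fil p f ->
  (forall (a : V) u w, a.2 = 0 -> size u = p.+1 -> act br p.+1 a f (u ++ w) = 0) ->
  wedge_fil p.+1 f.
Proof.
move=> fl fp fi.
have pw w : wedge_fil p (fix_suffix w f).
  split=> s1 y s2 sp; rewrite /fix_suffix -catA /= => *; [exact: fp.1 | exact: fp.2].
have pl w : mlinear (fix_suffix w f) by apply: mlinear_fix_suffix.
have pi w (a : V) u : a.2 = 0 -> size u = p.+1 -> act br p.+1 a (fix_suffix w f) u = 0.
  by move=> a0 up; rewrite -up -act_fix_suffix up fi.
have f1 s1 (y : V) s2 : (size s1 < p.+1)%N -> y.2 = 0 -> f (s1 ++ y :: s2) = 0.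
  rewrite ltnS leq_eqVlt => /orP[/eqP sp|sp] y0; last exact: fp.1.
  rewrite -cat1s catA; exact: (kill_g (pl s2) (pw s2) (pi s2)).
split=> // s1 y s2; rewrite ltnS => sp.
have [{}sp|sp'] := ltnP (size s1).+1 p; first exact: fp.2.
have {sp'}sp : (size s1).+1 = p by apply/eqP; rewrite eqn_leq sp.
rewrite -[_ :: _ :: s2]/([:: y; y] ++ s2) catA (wedge_fil_proj _ fl f1) ?size_cat ?addn2 ?sp //.
rewrite !map_cat /=.
by apply: (kill_sym (pl s2) (pw s2) (pi s2)); rewrite !size_map.
Qed.

End Weights.
End Casimir.

(** * Reduction of cocycles to invariant alternating forms on I *)

Section Cohomology.
Variables (R : realFieldType) (n : nat).
Hypothesis n_gt1 : (1 < n)%N.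
Let n_gt0 : (0 < n)%N := ltnW n_gt1.
Local Notation V := (sl_semidirect R n).
Local Notation br := (@sd_bracket R n).
Local Notation form := (seq V -> R^o).
Notation a_ i j := (sl_in (delta_mx i j)).
Implicit Types f g e : form.

Lemma fct_zeroE (T : Type) (W : zmodType) (s : T) : (0 : T -> W) s = 0.
Proof. by []. Qed.

Lemma compat_wedge_fil p q : (p <= q)%N ->
  compat q (fun f _ : form => mlinear f /\ wedge_fil p f).
Proof.
move=> pq; split=> [|f f' _ _ [fl fp] [fl' fp']|c f _ [fl fp]|a f _ a0 [fl fp]].
- by split=> // s1 s2 c u v; rewrite scaler0 addr0.
- by split; [exact: mlinear_add | exact: wedge_fil_add].
- by split; [exact: mlinear_scale | exact: wedge_fil_scale].
- by split; [exact: sd_act_mlinear | exact: wedge_fil_act].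
Qed.

Lemma compat_supp k q : compat q (fun f _ : form => supp_size k f).
Proof.
split=> [//|f f' _ _|c f _|a f _ _];
  [exact: supp_add|exact: supp_scale|exact: supp_act].
Qed.

(** Viewing the graph of [cobdry_after] as a [compat] relation yields at once its commutation with
    polynomials in the Casimir of the last q arguments. *)
Lemma compat_cobdry_after q : compat q (fun f g : form => cobdry_after br q f = g).
Proof.
have dsq0 : cobdry_after br q (0 : form) = 0 by apply: funext => s;
  apply: cobdry_after_eq0.
split=> [//|f f' g g' <- <-|c f g <-|a f g _ <-]; apply: funext => s.
- exact: cobdry_afterD.
- exact: cobdry_afterZ.
- by rewrite (cobdry_after_act br q a f s).
Qed.

Lemma cobdry_after_act_supp m q y f :
  mlinear f -> supp_size m f -> cobdry_after br q (act br m.+1 y f) =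
    act br m.+1 y (cobdry_after br q f).
Proof.
move=> fl fm; apply: funext => s; have [sm|sm] := leqP (size s) m.+1.
  by apply: cobdry_after_act_total => //; exact: sd_bracket_leibniz.
rewrite (supp_cobdry_after _ _ (supp_act _ _ _ fm)) ?gtn_eqF //.
by rewrite (supp_act _ _ _ (supp_cobdry_after _ _ fm)) ?gtn_eqF.
Qed.

Lemma compat_cobdry_after_total m q :
  compat m.+1 (fun f g : form => [/\ mlinear f, supp_size m f & cobdry_after br q f = g]).
Proof.
have dsq0 : cobdry_after br q (0 : form) = 0 by apply: funext => s;
  apply: cobdry_after_eq0.
split=> [|f f' g g' [fl fm <-] [fl' fm' <-]|c f g [fl fm <-]|a f g _ [fl fm <-]].
- by split=> // s1 s2 c u v; rewrite scaler0 addr0.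
- by split;
  [exact: mlinear_add|exact: supp_add|apply: funext => s; exact: cobdry_afterD].
- by split;
  [exact: mlinear_scale|exact: supp_scale|apply: funext => s; exact: cobdry_afterZ].
- by split; [exact: sd_act_mlinear|exact: supp_act|exact: cobdry_after_act_supp].
Qed.

Lemma sl_invariant_supp k f : supp_size k f ->
  (forall (a : V) s, a.2 = 0 -> size s = k -> act br k a f s = 0) -> sl_invariant f.
Proof.
move=> fk f0 a s a0; have [sk|sk] := eqVneq (size s) k; first by rewrite sk f0.
exact: (supp_act _ _ _ fk).
Qed.

Lemma sl_invariant_act k f (a : V) :
  sl_invariant f -> supp_size k f -> a.2 = 0 -> act br k a f = 0.
Proof.
move=> fi fk a0; apply: funext => s.
have [sk|sk] := eqVneq (size s) k; first by rewrite -sk fi.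
exact: (supp_act _ _ _ fk).
Qed.

(* f = f0 - r(C) C f, where C is the Casimir of the q last arguments and f0 is  *)
(* zero on U_p. By invariance, q-prefix actions on f can be traded for actions  *)
(* on the remaining arguments, which the cocycle condition turns into           *)
(* coboundaries modulo F_{p+1}.                                                 *)
Lemma cocycle_mod_prefix p m f :
  mlinear f -> supp_size m.+1 f -> sl_invariant f -> cobdry br f = 0 -> wedge_fil p f ->
  (p <= m)%N -> exists e, [/\ mlinear e, supp_size m e, wedge_fil p e & wedge_fil p.+1 (f - cobdry_after br p.+1 e)].
Proof.
move=> fl fm fi df fp pm; set q := p.+1; have pq : (p <= q)%N by exact: leqnSn.
have [d dP] := casimir_split R n_gt0 q.
pose I : form -> Prop := fun f => mlinear f /\ wedge_fil p f.
have If : I f by [].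
have f0q : wedge_fil q (f + casimir q (casimir_poly q d f)).
  have [Cl Cp] := compat_casimir (g := f) (compat_wedge_fil pq) (compat_casimir_poly (g := f) d (compat_wedge_fil pq) If).
  apply: (wedge_fil_kill n_gt0 n_gt1); [exact: mlinear_add|exact: wedge_fil_add|].
  by move=> a u w a0 uq; apply: dP.
(* At u ++ w, [psi A] is meant to be the coboundary of f with u frozen, taken at A :: w. There A
   acts on the m-p letters of w with sign (-1)^(m-p+1); invariance trades this for minus the action
   on u, whence [ep]. As f is a cocycle, [psi A] then vanishes on U_p. *)
pose ep : R := (-1) ^+ (m - p).
have ep2 : ep * ep = 1 by rewrite -expr2 sqrr_sign.
pose psi (A : V) : form := ep *: act br q A f + cobdry_after br q (insert_at q A f).
have psil A : mlinear (psi A).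
  apply: mlinear_add; first by apply/mlinear_scale/sd_act_mlinear.
  exact/sd_cobdry_after_mlinear/insert_at_mlinear.
have psip (A : V) : A.2 = 0 -> wedge_fil p (psi A).
  move=> A0; apply: wedge_fil_add; first by apply/wedge_fil_scale/wedge_fil_act.
  by apply: wedge_fil_cobdry_after => //; apply: wedge_fil_insert_at.
have psim A : supp_size m.+1 (psi A).
  by apply: supp_add;
    [apply/supp_scale/supp_act | apply/supp_cobdry_after/supp_insert_at].
have psiE (A : V) u w : A.2 = 0 -> size u = q -> (size u + size w)%N = m.+1 ->
    psi A (u ++ w) = cobdry br f (u ++ A :: w) + (cobdry br (fix_prefix u f) (A :: w) - cobdry br f (u ++ A :: w)).
  move=> A0 uq uw;
    rewrite addrC subrK cobdry_cons /psi fct_addE fct_scaleE -{2}uq cobdry_after_cat.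
  rewrite addrC; congr (_ + _); first by apply: eq_cobdry => t _;
    rewrite /fix_prefix /fix_head -uq insert_at_cat.
  have := fi A (u ++ w) A0;
    rewrite size_cat act_add_fix_prefix -act_fix_suffix uq => /eqP.
  rewrite addr_eq0 => /eqP ->; rewrite scalerN -scaleNr.
  have -> : size w = (m - p)%N by move: uw; rewrite uq /q; lia.
  by rewrite exprS mulN1r.
have psiq (A : V) : A.2 = 0 -> wedge_fil q (psi A).
  move=> A0.
  have f1 s1 (y : V) s2 : (size s1 < q)%N -> y.2 = 0 -> psi A (s1 ++ y :: s2) = 0.
    rewrite ltnS leq_eqVlt => /orP[/eqP sp|sp] y0; last exact: (psip A A0).1.
    have [sm|sm] := eqVneq (size (s1 ++ y :: s2)) m.+1; last exact: psim.
    rewrite -cat_rcons psiE ?size_rcons ?sp //; last first.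
      by rewrite -sm size_cat /= addSnnS sp.
    rewrite df fct_zeroE subr0 add0r -(cobdry_cat_g (A :: s2) fl fp fi sp y0).
    by rewrite df.
  split=> // s1 y s2; rewrite ltnS => sp.
  have [{}sp|sp'] := ltnP (size s1).+1 p; first exact: (psip A A0).2.
  have {sp'}sp : (size s1).+1 = p by apply/eqP; rewrite eqn_leq sp.
  have [sm|sm] := eqVneq (size (s1 ++ [:: y, y & s2])) m.+1; last exact: psim.
  rewrite -[_ :: _ :: s2]/([:: y; y] ++ s2) catA (wedge_fil_proj _ (psil A) f1);
    last first.
    by rewrite size_cat /= addn2 sp.
  rewrite psiE //; last first.
  - by rewrite -sm !size_map !size_cat /=; lia.
  - by rewrite !size_map size_cat /= addn2 sp.
  rewrite df fct_zeroE subr0 add0r !map_cat /=.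
  rewrite -(cobdry_cat_vec_in y.2 (A :: s2) fl fp fi); last by rewrite !size_map.
  by rewrite df.
pose E (ij : 'I_n * 'I_n) : form := act br q (a_ ij.2 ij.1) (insert_at q (a_ ij.1 ij.2) f).
(* Modulo F_{p+1}, [psi] makes the action of A on the last q arguments equal to -ep times a partial
   coboundary. Substituting this for the inner action in - r(C) C f gives the partial coboundary of
   e. *)
pose e := ep *: \sum_ij casimir_poly q d (E ij).
have IE ij : I (casimir_poly q d (E ij)).
  apply: (compat_casimir_poly (g := E ij) d (compat_wedge_fil pq)); split.
    exact/sd_act_mlinear/insert_at_mlinear.
  by apply: wedge_fil_act => //; [exact: insert_at_mlinear|exact: wedge_fil_insert_at].
have Ie : I e.
  have [_ _ IZ _] := compat_wedge_fil pq; apply: (IZ ep _ 0).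
  exact: (compat_sum (G := fun _ => 0) _ (compat_wedge_fil pq) IE).
exists e; split; [exact: Ie.1| |exact: Ie.2|].
  apply: supp_scale; apply: (compat_sum (G := fun _ => 0) _ (compat_supp m q)) => ij.
  by apply: (compat_casimir_poly (g := 0) d (compat_supp m q));
    apply/supp_act/supp_insert_at.
have dsqE : cobdry_after br q e =
  ep *: \sum_ij casimir_poly q d (act br q (a_ ij.2 ij.1) (cobdry_after br q (insert_at q (a_ ij.1 ij.2) f))).
  have [_ _ cZ cth] := compat_cobdry_after q; apply: cZ.
  apply: (compat_sum _ (compat_cobdry_after q)) => ij.
  by apply: (compat_casimir_poly d (compat_cobdry_after q)); apply: cth.
have fE : f = (f + casimir q (casimir_poly q d f)) -
    \sum_(ij : 'I_n * 'I_n) casimir_poly q d (act br q (a_ ij.2 ij.1) (act br q (a_ ij.1 ij.2) f)).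
  by rewrite -casimir_poly_sum -/(casimir q f) casimir_poly_casimir addrK.
rewrite dsqE {1}fE -addrA -opprD.
have -> : \sum_(ij : 'I_n * 'I_n) casimir_poly q d (act br q (a_ ij.2 ij.1) (act br q (a_ ij.1 ij.2) f)) +
    ep *: \sum_(ij : 'I_n * 'I_n) casimir_poly q d (act br q (a_ ij.2 ij.1) (cobdry_after br q (insert_at q (a_ ij.1 ij.2) f))) =
    ep *: \sum_(ij : 'I_n * 'I_n) casimir_poly q d (act br q (a_ ij.2 ij.1) (psi (a_ ij.1 ij.2))).
  rewrite -[X in X + _]scale1r -ep2 -scalerA -scalerDr; congr (_ *: _).
  rewrite scaler_sumr -big_split; apply: eq_bigr => ij _ /=.
  by rewrite /psi actD actZ casimir_polyD casimir_polyZ.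
apply: wedge_fil_add => //; rewrite -scaleN1r; apply/wedge_fil_scale/wedge_fil_scale.
have [] // : mlinear (\sum_(ij : 'I_n * 'I_n) casimir_poly q d (act br q (a_ ij.2 ij.1) (psi (a_ ij.1 ij.2)))) /\
  wedge_fil q (\sum_(ij : 'I_n * 'I_n) casimir_poly q d (act br q (a_ ij.2 ij.1) (psi (a_ ij.1 ij.2)))).
have cq := compat_wedge_fil (leqnn q).
apply: (compat_sum (G := fun _ => 0) _ cq) => ij.
apply: (compat_casimir_poly (g := 0) d cq); have [_ _ _ cth] := cq.
by apply: (cth _ _ 0) => //; split; [exact: psil|exact: psiq].
Qed.

Lemma casimir_sl_invariant k f : sl_invariant f -> supp_size k f -> casimir k f = 0.
Proof.
move=> fi fk; rewrite /casimir big1 // => ij _.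
by rewrite (sl_invariant_act fi fk) // act_zero.
Qed.

Lemma casimir_fuel m N f : (m <= N)%N -> supp_size m f -> casimir N f = casimir m f.
Proof.
move=> mN fm.
have thE a g : supp_size m g -> act br N a g = act br m a g.
  move=> gm; apply: funext => s; have [sm|sm] := eqVneq (size s) m.
    by rewrite act_fuel ?sm.
  by rewrite !(supp_act _ _ _ gm).
by apply: eq_bigr => ij _; rewrite !thE //; apply: supp_act.
Qed.

Lemma casimir_poly_fuel m N d f :
  (m <= N)%N -> supp_size m f -> casimir_poly N d f = casimir_poly m d f.
Proof.
move=> mN fm; elim: d => [|x d IH] //=.
by rewrite IH (casimir_fuel mN) //;
  apply: (compat_casimir_poly (g := f) d (compat_supp m m)).
Qed.

Lemma sl_invariant_project m d f : mlinear f -> supp_size m f ->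
  (forall f, mlinear f -> forall (a : V) u w, a.2 = 0 -> size u = m ->
     act br m a (f + casimir m (casimir_poly m d f)) (u ++ w) = 0) ->
  sl_invariant (f + casimir m (casimir_poly m d f)).
Proof.
move=> fl fm dP; apply: (sl_invariant_supp (k := m)) => [|a s a0 sm].
  apply: supp_add => //; apply: (compat_casimir (g := f) (compat_supp m m)).
  exact: (compat_casimir_poly (g := f) d (compat_supp m m)).
by rewrite -[s]cats0 dP.
Qed.

(** By [cobdry_cat_g] and [cobdry_cat_vec_in] the two coboundaries coincide on representatives of
    U_p. *)
Lemma cobdry_prefix p m e : mlinear e -> supp_size m e -> sl_invariant e ->
  wedge_fil p e ->
  wedge_fil p.+1 (cobdry br e - cobdry_after br p.+1 e).
Proof.
move=> el em ei ep; set h := cobdry br e - _.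
have hl : mlinear h.
  apply: mlinear_add; first exact: sd_cobdry_mlinear.
  by rewrite -scaleN1r; apply/mlinear_scale/sd_cobdry_after_mlinear.
have hp : wedge_fil p h.
  apply: wedge_fil_add; first exact: wedge_fil_cobdry.
  by rewrite -scaleN1r; apply/wedge_fil_scale/wedge_fil_cobdry_after.
have hE u w : size u = p.+1 -> h (u ++ w) =
  cobdry br e (u ++ w) - cobdry br (fix_prefix u e) w.
  by move=> up; rewrite -cobdry_after_cat up.
have f1 s1 (y : V) s2 : (size s1 < p.+1)%N -> y.2 = 0 -> h (s1 ++ y :: s2) = 0.
  rewrite ltnS leq_eqVlt => /orP[/eqP sp|sp] y0; last exact: hp.1.
  rewrite -cat_rcons hE ?size_rcons ?sp // cat_rcons.
  by rewrite (cobdry_cat_g s2 el ep ei sp y0) subrr.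
split=> // s1 y s2; rewrite ltnS => sp.
have [{}sp|sp'] := ltnP (size s1).+1 p; first exact: hp.2.
have {sp'}sp : (size s1).+1 = p by apply/eqP; rewrite eqn_leq sp.
rewrite -[_ :: _ :: s2]/([:: y; y] ++ s2) catA (wedge_fil_proj _ hl f1); last first.
  by rewrite size_cat /= addn2 sp.
rewrite hE; last by rewrite !size_map size_cat /= addn2 sp.
rewrite !map_cat -catA /= (cobdry_cat_vec_in y.2 s2 el ep ei) ?subrr //.
by rewrite !size_map.
Qed.

(** With C now the Casimir of all arguments, the operator 1 + C d(C) makes the e of
    [cocycle_mod_prefix] invariant. It fixes the invariant f, commutes with [cobdry_after] and
    preserves F_{p+1}, so the congruence survives; [cobdry_prefix] then brings in the full
    coboundary. *)
Lemma cocycle_step p m f : mlinear f -> supp_size m.+1 f -> sl_invariant f ->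
  cobdry br f = 0 -> wedge_fil p f ->
  (p <= m)%N -> exists e, [/\ mlinear e, supp_size m e, sl_invariant (f - cobdry br e) & wedge_fil p.+1 (f - cobdry br e)].
Proof.
move=> fl fm fi df fp pm.
have [e [el em ep eq]] := cocycle_mod_prefix fl fm fi df fp pm.
have [d dP] := casimir_split R n_gt0 m.
pose e' := e + casimir m (casimir_poly m d e).
have e'i : sl_invariant e' by apply: sl_invariant_project.
(* The same operator has to act on all letters of e, of degree m, and of f, of degree m+1;
   [casimir_fuel] absorbs the difference. *)
pose N := m.+1.
have e'E : e' = e + casimir N (casimir_poly N d e).
  rewrite /e' (casimir_poly_fuel _ (leqnSn m)) // (casimir_fuel (leqnSn m)) //.
  exact: (compat_casimir_poly (g := e) d (compat_supp m m)).
have pN : (p <= N)%N by rewrite leqW.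
have [e'l e'p] : mlinear e' /\ wedge_fil p e'.
  have c := compat_wedge_fil pN; have [_ cD _ _] := c; rewrite e'E.
  apply: (cD _ _ 0 0) => //; apply: (compat_casimir (g := e) c).
  exact: (compat_casimir_poly (g := e) d c).
have e'm : supp_size m e'.
  have c := compat_supp m N; have [_ cD _ _] := c; rewrite e'E.
  apply: (cD _ _ 0 0) => //; apply: (compat_casimir (g := e) c).
  exact: (compat_casimir_poly (g := e) d c).
have dsqe' : cobdry_after br p.+1 e' =
  cobdry_after br p.+1 e + casimir N (casimir_poly N d (cobdry_after br p.+1 e)).
  have c := compat_cobdry_after_total m p.+1; have [_ cD _ _] := c.
  have [||_ _ //] := cD e (casimir N (casimir_poly N d e)) (cobdry_after br p.+1 e) (casimir N (casimir_poly N d (cobdry_after br p.+1 e))).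
  - by split.
  - by apply: (compat_casimir c); apply: (compat_casimir_poly d c).
  by rewrite -e'E.
have r1 : wedge_fil p.+1 (f - cobdry_after br p.+1 e').
  pose r := f - cobdry_after br p.+1 e.
  have -> : f - cobdry_after br p.+1 e' = r + casimir N (casimir_poly N d r).
    rewrite dsqe' /r casimir_polyD -[- cobdry_after br _ _]scaleN1r casimir_polyZ casimirD casimirZ !scaleN1r.
    have -> : casimir N (casimir_poly N d f) = 0.
      by rewrite casimir_poly_casimir (casimir_sl_invariant fi fm);
        have := casimir_polyZ N d 0 (0 : form); rewrite !scale0r.
    by rewrite opprD addrA add0r.
  have rl : mlinear r.
    by apply: mlinear_add => //; rewrite -scaleN1r;
      apply/mlinear_scale/sd_cobdry_after_mlinear.
  have c := compat_wedge_fil (pm : p.+1 <= N)%N; have [_ cD _ _] := c.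
  have [] // := cD r (casimir N (casimir_poly N d r)) 0 0 _ _.
  by apply: (compat_casimir (g := r) c); apply: (compat_casimir_poly (g := r) d c).
exists e'; split=> //.
  move=> a s a0; rewrite actD -scaleN1r actZ fct_addE fct_scaleE fi // add0r.
  rewrite -cobdry_act //; [|exact: sd_bracket_leibniz].
  rewrite (@eq_cobdry _ _ _ _ _ 0) => [|t ts]; first by rewrite cobdry_eq0 ?scaler0.
  by rewrite -ts act_fuel // e'i.
have -> : f - cobdry br e' = (f - cobdry_after br p.+1 e') + (-1) *: (cobdry br e' - cobdry_after br p.+1 e').
  by rewrite scaleN1r opprB addrA subrK.
by apply: wedge_fil_add => //; apply/wedge_fil_scale/(cobdry_prefix (m := m)).
Qed.

(** The form g = act a_ij f is again a cocycle by [cobdry_act]. Evaluating its coboundary at a_ji ::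
    s exhibits the action of a_ji on g as a coboundary, up to the sign in [E]. *)
Lemma exact_casimir m f : mlinear f -> supp_size m.+1 f -> cobdry br f = 0 ->
  exists e, [/\ mlinear e, supp_size m e & casimir m.+1 f = cobdry br e].
Proof.
move=> fl fm df; set N := m.+1.
pose E (ij : 'I_n * 'I_n) : form := (-1) ^+ N *: fix_head (a_ ij.2 ij.1) (act br N (a_ ij.1 ij.2) f).
exists (\sum_ij E ij); split.
- by elim/big_ind: _ => [s1 s2 c u v|g h|ij _];
    [rewrite scaler0 addr0 | exact: mlinear_add | apply/mlinear_scale/mlinear_fix_head/sd_act_mlinear].
- by elim/big_ind: _ => [//|g h|ij _];
  [exact: supp_add | apply/supp_scale/supp_fix_head/supp_act].
rewrite cobdry_sum; apply: eq_bigr => ij _; rewrite /E cobdryZ.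
set a := a_ ij.2 ij.1; set g := act br N (a_ ij.1 ij.2) f.
have gN : supp_size N g by apply: supp_act.
have dg : cobdry br g = 0.
  apply: funext => s; have [sN|sN] := eqVneq (size s) N.+1; last first.
    by rewrite (supp_cobdry _ gN).
  rewrite (@eq_cobdry _ _ _ _ _ (act br N.+1 (a_ ij.1 ij.2) f)) => [|t ts]; last first.
    by rewrite /g act_fuel ?[in RHS]act_fuel //; lia.
  by rewrite cobdry_act ?sN ?df ?act_zero //; exact: sd_bracket_leibniz.
apply: funext => s; rewrite fct_scaleE.
have [sN|sN] := eqVneq (size s) N; last first.
  rewrite (supp_act _ _ _ gN) // (@supp_cobdry _ _ _ _ m) ?scaler0 //.
  exact: supp_fix_head.
have := congr1 (fun h : form => h (a :: s)) dg;
  rewrite cobdry_cons sN fct_zeroE => /eqP.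
rewrite addr_eq0 => /eqP ->;
  rewrite exprS mulN1r scaleNr opprK scalerA -expr2 sqrr_sign.
by rewrite scale1r.
Qed.

Theorem cocycle_normal_form m f : mlinear f -> supp_size m.+1 f -> cobdry br f = 0 ->
  exists e F, [/\ mlinear e, supp_size m e & f = cobdry br e + F] /\
              [/\ mlinear F, supp_size m.+1 F, sl_invariant F & wedge_fil m.+1 F].
Proof.
move=> fl fm df; set N := m.+1.
suff: forall p, (p <= N)%N -> exists e F, [/\ mlinear e, supp_size m e & f = cobdry br e + F] /\
    [/\ mlinear F, supp_size m.+1 F, sl_invariant F & wedge_fil p F] by apply.
elim=> [_|p IH pN].
  (* Passing to the invariant form 1 + C d(C) applied to f adds C g, where g = d(C) f is still a
     cocycle; so only a coboundary is added. *)
  have [d dP] := casimir_split R n_gt0 N; pose g := casimir_poly N d f.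
  have gi := sl_invariant_project fl fm dP.
  have gm : supp_size N g by apply: (compat_casimir_poly (g := f) d (compat_supp N N)).
  have gl : mlinear g by exact: (compat_casimir_poly (f := f) (g := f) d (compat_mlinear n R^o N) fl).
  have dg : cobdry br g = 0.
    rewrite /g -(casimir_poly_fuel d (leqnSn N) fm).
    have [//|_ _ /= ->] := @compat_casimir_poly _ _ _ _ _ _ d f (cobdry br f) (compat_cobdry_after_total N 0).
    by rewrite df; have := casimir_polyZ N.+1 d 0 (0 : form); rewrite !scale0r.
  have [e [el em eE]] := exact_casimir gl gm dg.
  exists (- e), (f + casimir N g); split; split=> //.
  - by rewrite -scaleN1r; apply: mlinear_scale.
  - by rewrite -scaleN1r; apply: supp_scale.
  - by rewrite -scaleN1r cobdryZ scaleN1r eE addrCA addNr addr0.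
  - apply: mlinear_add => //; rewrite eE; exact: sd_cobdry_mlinear.
  - by apply: supp_add => //; rewrite eE; apply: supp_cobdry.
have [e [F [[el em fE] [Fl Fm Fi Fp]]]] := IH (ltnW pN).
have dF : cobdry br F = 0.
  have := df; rewrite fE cobdryD cobdry_cobdry ?add0r //; exact: sd_bracket_leibniz.
have [e' [e'l e'm Fi' Fp']] := cocycle_step Fl Fm Fi dF Fp pN.
exists (e + e'), (F - cobdry br e'); split; split=> //.
- exact: mlinear_add.
- exact: supp_add.
- by rewrite cobdryD fE addrACA subrr addr0.
- by apply: mlinear_add => //; rewrite -scaleN1r; apply/mlinear_scale/sd_cobdry_mlinear.
- by apply: supp_add => //; rewrite -scaleN1r; apply/supp_scale/supp_cobdry.
Qed.

End Cohomology.

(** * Degrees and the top coefficient in the exterior algebra *)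

Section ExteriorDegree.
Variables (K : fieldType) (n : nat).
Local Notation ext := (exterior K n).
Implicit Types (a b : ext) (S T : {set 'I_n}).

Definition homog p a := forall S, #|S| != p -> ext_coef a S = 0.

Lemma homogM p q a b : homog p a -> homog q b -> homog (p + q) (a * b).
Proof.
move=> ap bq U Un; rewrite ext_coef_mul big1 // => S sSU.
have [Sp|Sp] := eqVneq #|S| p; last by rewrite ap // mul0r mulr0.
rewrite [X in _ * X]mulrC bq ?mul0r ?mulr0 //; apply: contra Un => /eqP <-.
by rewrite -Sp -(cardsID S U) (setIidPr sSU).
Qed.

Lemma homog1 : homog 0 1.
Proof. by move=> S; rewrite cards_eq0 ext_coef_basis => /negPf ->. Qed.

Lemma homogZ p c a : homog p a -> homog p (c *: a).
Proof. by move=> ap S Sp; rewrite ext_coefZ ap // mulr0. Qed.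

Lemma homogD p a b : homog p a -> homog p b -> homog p (a + b).
Proof. by move=> ap bp S Sp; rewrite ext_coefD ap // bp // addr0. Qed.

Lemma homog0 p : homog p 0.
Proof. by move=> S _; apply: ext_coef0. Qed.

Lemma homog_basis S : homog #|S| (ebasis K S).
Proof.
move=> T ST; rewrite ext_coef_basis; case: eqP => [TS|//].
by rewrite TS eqxx in ST.
Qed.

Lemma homog_sum p I (r : seq I) (P : pred I) (F : I -> ext) :
  (forall i, P i -> homog p (F i)) -> homog p (\sum_(i <- r | P i) F i).
Proof. by move=> Fp; elim/big_ind: _ => //; [exact: homog0 | exact: homogD]. Qed.

Lemma homog_vec (v : 'cV_n) : homog 1 (ext_vec v).
Proof.
by apply: homog_sum => i _; apply: homogZ; have := @homog_basis [set i]; rewrite cards1.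
Qed.

Lemma homog_prod I (r : seq I) (F : I -> 'cV_n) :
  homog (size r) (\prod_(i <- r) ext_vec (F i)).
Proof.
elim: r => [|i r IH]; first by rewrite big_nil; apply: homog1.
by rewrite big_cons; apply: (@homogM 1) => //; apply: homog_vec.
Qed.

Lemma homog_act A p a : homog p a -> homog p (ext_act A a).
Proof.
move=> ap; apply: homog_sum => S _.
have [Sp|Sp] := eqVneq #|S| p; last by rewrite ap // scale0r; apply: homog0.
apply/homogZ/homog_sum => i _; rewrite -Sp cardE; exact: homog_prod.
Qed.

(** The subalgebra generated by the e_j with j different from i. Its elements have no top
    coefficient. *)
Definition avoid i a := forall S, i \in S -> ext_coef a S = 0.

Lemma avoidM i a b : avoid i a -> avoid i b -> avoid i (a * b).
Proof.
move=> ai bi U iU; rewrite ext_coef_mul big1 // => S sSU.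
have [iS|iS] := boolP (i \in S); first by rewrite ai // mul0r mulr0.
by rewrite [X in _ * X]mulrC bi ?mul0r ?mulr0 // inE iS.
Qed.

Lemma avoid_prod i I (r : seq I) (F : I -> 'cV_n) :
  (forall k, F k i ord0 = 0) -> avoid i (\prod_(k <- r) ext_vec (F k)).
Proof.
move=> F0; elim/big_ind: _ => [S iS||k _]; last 2 first.
- exact: avoidM.
- move=> S iS; rewrite /ext_vec.
  have -> : \sum_j F k j ord0 *: ebasis K [set j] =
     \sum_(j | j != i) F k j ord0 *: ebasis K [set j].
    by rewrite (bigD1 i) //= F0 scale0r add0r.
  elim/big_ind: _ => [|a b a0 b0|j ji]; first exact: ext_coef0.
    by rewrite ext_coefD a0 b0 addr0.
  rewrite ext_coefZ ext_coef_basis; case: eqP => [SE|]; rewrite ?mulr0 //.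
  by move: iS; rewrite SE inE eq_sym (negPf ji).
- rewrite ext_coef_basis; case: eqP => // SE.
  by rewrite SE inE in iS.
Qed.

Lemma ext_volumeE : ext_volume K n = ebasis K setT.
Proof.
by rewrite ebasisE enum_setT /ext_word /ext_volume [in LHS]/index_enum unlock.
Qed.

Lemma homog_top a : homog n a -> a = ext_coef a setT *: ebasis K setT.
Proof.
move=> an; apply: extP => S; rewrite ext_coefZ ext_coef_basis.
have [->|ST] := eqVneq S setT; first by rewrite mulr1.
rewrite mulr0 an //; apply: contra ST => /eqP Sn.
by rewrite eqEcard subsetT cardsT card_ord Sn leqnn.
Qed.

Lemma split_uniq_mem (T : eqType) (i : T) (l : seq T) : uniq l -> i \in l ->
  exists r1 r2, [/\ l = r1 ++ i :: r2, i \notin r1 & i \notin r2].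
Proof.
move=> + il; case/splitPr: il => r1 r2; rewrite cat_uniq /= negb_or.
by case/and3P=> _ /andP[i1 _] /andP[i2 _]; exists r1, r2.
Qed.

(** In the term where A e_i replaces e_i, the part of A e_i off the line of e_i leaves a product
    that avoids e_i, with no top coefficient. The term therefore contributes A i i. *)
Lemma ext_act_top (A : 'M[K]_n) : ext_act A (ebasis K setT) = \tr A *: ebasis K setT.
Proof.
have /homog_top -> : homog n (ext_act A (ebasis K setT)).
  by apply: homog_act; have := @homog_basis [set: 'I_n]; rewrite cardsT card_ord.
congr (_ *: _).
rewrite /ext_act (bigD1 [set: 'I_n]) //= [X in _ + X]big1 ?addr0 => [|S /negPf ST];
  last first.
  by rewrite ext_coef_basis ST scale0r.
rewrite ext_coef_basis eqxx scale1r.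
have csum I (r : seq I) (P : pred I) (F : I -> ext) :
    ext_coef (\sum_(i <- r | P i) F i) setT = \sum_(i <- r | P i) ext_coef (F i) setT.
  apply: (big_morph (fun a => ext_coef a setT)) => [x y|]; last exact: ext_coef0.
  exact: ext_coefD.
rewrite csum /mxtrace (eq_bigl predT) => [|i]; last by rewrite inE.
apply: eq_bigr => i _.
have [|r1 [r2 [E i1 i2]]] := split_uniq_mem (enum_uniq [set: 'I_n]) (_ : i \in _).
  by rewrite mem_enum inE.
have topE : ext_coef (ext_word K r1 * (ext_vec (ext_partial K i) * ext_word K r2)) setT = 1.
  rewrite -ext_word_cons -ext_word_cat -E -ebasisE ext_coef_basis.
  by rewrite eqxx.
have drop r (v : 'I_n -> 'cV_n) : i \notin r ->
    \prod_(j <- r) ext_vec (if j == i then v j else ext_partial K j) = ext_word K r.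
  move=> ir; apply: eq_big_seq => j jr; case: eqP => // ji.
  by rewrite ji (negPf ir) in jr.
rewrite E big_cat big_cons eqxx !drop // -/(ext_word K _).
have -> : A *m ext_partial K i =
  A i i *: ext_partial K i + (A *m ext_partial K i - A i i *: ext_partial K i).
  by rewrite addrC subrK.
rewrite linearP /= mulrDl mulrDr -scalerAl -scalerAr ext_coefD ext_coefZ topE mulr1.
rewrite [X in _ + X](_ : _ = 0) ?addr0 //.
have av r : i \notin r -> avoid i (ext_word K r).
  move=> ir; rewrite /ext_word big_seq; elim/big_ind: _ => [||j jr].
  - move=> S iS; rewrite ext_coef_basis; case: eqP => // SE.
    by rewrite SE inE in iS.
  - exact: avoidM.
  - have := @avoid_prod i _ [:: tt] (fun=> ext_partial K j).
    rewrite big_seq1; apply => _; rewrite mxE andbT; case: eqP => // ij.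
    by rewrite ij jr in ir.
apply: (avoidM (av _ i1) (avoidM _ (av _ i2))); last by rewrite inE.
have := @avoid_prod i _ [:: tt] (fun=> A *m ext_partial K i - A i i *: ext_partial K i).
rewrite big_seq1; apply => _; rewrite !mxE (bigD1 i) //= big1 ?addr0 => [|j /negPf ji].
  by rewrite !mxE !eqxx mulr1 subrr.
by rewrite !mxE ji mulr0.
Qed.

Lemma ext_coef_act_top (A : 'M[K]_n) a :
  ext_coef (ext_act A a) setT = \tr A * ext_coef a setT.
Proof.
have -> : a = ext_coef a setT *: ebasis K setT + (a - ext_coef a setT *: ebasis K setT).
  by rewrite addrC subrK.
set b := a - _; have b0 : ext_coef b setT = 0.
  by rewrite /b -scaleN1r ext_coefD !ext_coefZ ext_coef_basis eqxx mulr1 mulN1r subrr.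
move: (ext_coef a setT) b b0 => c b b0.
rewrite linearP /= ext_act_top !ext_coefD !ext_coefZ ext_coef_basis eqxx b0 !mulr1 addr0.
rewrite [c * _]mulrC [X in _ + X](_ : _ = 0) ?addr0 //.
rewrite [b]ext_sum_basis linear_sum.
elim/big_ind: _ => [|x y x0 y0|S _]; first exact: ext_coef0.
  by rewrite ext_coefD x0 y0 addr0.
rewrite linearZ /= ext_coefZ; have [->|ST] := eqVneq S setT; first by rewrite b0 mul0r.
rewrite (homog_act _ (@homog_basis S)) ?mulr0 //.
apply: contra ST => /eqP Sn; by rewrite eqEcard subsetT Sn leqnn.
Qed.

End ExteriorDegree.

(** * The volume form and the cocycles it represents *)

Section VolumeForm.
Variables (R : realFieldType) (n : nat).
Hypothesis n_gt1 : (1 < n)%N.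
Let n_gt0 : (0 < n)%N := ltnW n_gt1.
Local Notation V := (sl_semidirect R n).
Local Notation br := (@sd_bracket R n).
Local Notation form := (seq V -> R^o).
Implicit Types f g F : form.

Lemma wedge_fil_words k F : mlinear F -> supp_size k F -> wedge_fil k F ->
  (forall l, size l = k -> uniq l -> F (map (@basis_vec R n) l) = 0) -> F = 0.
Proof.
move=> Fl Fk Fp F0; apply: funext => s.
have [sk|sk] := eqVneq (size s) k; last exact: Fk.
rewrite -[s]cats0 (wedge_fil_proj _ Fl Fp.1) ?sk // cats0.
apply: (expand_basis_vec (p := k)); rewrite ?size_map // => l lk.
have [ul|nul] := boolP (uniq l); first exact: F0.
by rewrite -[map _ _]cats0 (wedge_fil_uniq n_gt0 n_gt1 _ Fl Fp) ?lk.
Qed.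

(** For 0 < k < n, a word of k distinct basis vectors contains some i and misses some j, so
    [torus i j] has eigenvalue -1 on it. For k > n there are no such words. *)
Lemma wedge_fil_sl_invariant_eq0 k F : (0 < k)%N -> k != n ->
  mlinear F -> supp_size k F -> sl_invariant F -> wedge_fil k F -> F = 0.
Proof.
move=> k0 kn Fl Fk Fi Fp; apply: (wedge_fil_words Fl Fk Fp) => l lk ul.
have ln : (size l < n)%N.
  by rewrite ltn_neqAle lk kn -lk -(card_uniqP ul) -[X in (_ <= X)%N]card_ord max_card.
have [i il] : exists i, i \in l by case: (l) lk k0 => [<- //|i l' _ _]; exists i;
  rewrite mem_head.
have [j jl] : exists j, j \notin l.
  apply/existsP; rewrite -negb_forall; apply: contraL ln => /forallP lP.
  by rewrite -leqNgt -(card_uniqP ul) -[X in (X <= _)%N]card_ord;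
    apply/subset_leq_card/subsetP.
have := Fi (torus R i j) (map (@basis_vec R n) l) erefl; rewrite size_map act_weight //.
rewrite /weight !count_uniq_mem // il (negPf jl) sub0r scaleN1r => /eqP.
by rewrite oppr_eq0 => /eqP.
Qed.

Lemma wedge_fil_perm_eq0 F k l l' :
  mlinear F -> wedge_fil k F -> size l = k -> perm_eq l l' ->
  F (map (@basis_vec R n) l) = 0 -> F (map (@basis_vec R n) l') = 0.
Proof.
move=> Fl Fp lk pll F0; suff: forall u, (size u + size l')%N = k ->
    F (u ++ map (@basis_vec R n) l) = 0 -> F (u ++ map (@basis_vec R n) l') = 0.
  by move/(_ [::]); apply; rewrite // add0n -lk (perm_size pll).
elim: l' l pll {F0 lk} => [|x l' IH] l pll u uk.
  by move/perm_size: pll; case: l.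
have xl : x \in l by rewrite (perm_mem pll) mem_head.
have [l1 [l2 El]] : exists l1 l2, l = l1 ++ x :: l2.
  by case/splitPr: xl => l1 l2; exists l1, l2.
have pll2 : perm_eq (l1 ++ l2) l'.
  by rewrite -(perm_cons x) -(permPr pll) El perm_sym -cat1s perm_catCA.
rewrite El map_cat /= (wedge_fil_move _ _ Fl Fp); last first.
  rewrite size_map -uk; move/perm_size: pll2; rewrite size_cat /=; lia.
move/eqP; rewrite scaler_eq0 signr_eq0 /= => /eqP E.
rewrite -cat_rcons; apply: (IH (l1 ++ l2)) => //.
  by rewrite size_rcons -uk /=; lia.
by rewrite cat_rcons map_cat.
Qed.

Lemma wedge_fil_top_eq0 F : mlinear F -> supp_size n F -> wedge_fil n F ->
  F (map (@basis_vec R n) (enum 'I_n)) = 0 -> F = 0.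
Proof.
move=> Fl Fk Fp F0; apply: (wedge_fil_words Fl Fk Fp) => l ln ul.
apply: (wedge_fil_perm_eq0 Fl Fp _ _ F0); first by rewrite size_enum_ord.
apply: uniq_perm => //; first exact: enum_uniq.
move=> i; rewrite mem_enum inE; symmetry.
have := uniq_min_size ul (s2 := enum 'I_n) (fun i _ => mem_enum 'I_n i).
rewrite size_enum_ord ln leqnn => /(_ isT) [_ /(_ i)].
by rewrite mem_enum inE.
Qed.

Definition wedge (s : seq V) : exterior R n := \prod_(x <- s) ext_vec x.2.

(** Words being reversed, this is the determinant of the I-components up to the sign of the
    order-reversing permutation. *)
Definition volume_form : form := fun s => if size s == n then ext_coef (wedge s) setT else 0.

Lemma wedge_mlinear : mlinear wedge.
Proof.
move=> s1 s2 c u v; rewrite /wedge !big_cat !big_cons /=.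
rewrite linearP /=.
by rewrite mulrDl mulrDr -scalerAl -scalerAr.
Qed.

Lemma volume_mlinear : mlinear volume_form.
Proof.
move=> s1 s2 c u v; rewrite /volume_form !size_cat /=.
case: eqP => _; last by rewrite scaler0 addr0.
by rewrite wedge_mlinear ext_coefD ext_coefZ.
Qed.

Lemma volume_supp : supp_size n volume_form.
Proof. by move=> s sn; rewrite /volume_form (negPf sn). Qed.

Lemma volume_wedge_fil : wedge_fil n volume_form.
Proof.
split=> s1 y s2 _ => [y0|]; rewrite /volume_form; case: eqP => _ //.
  rewrite /wedge big_cat big_cons y0.
  by rewrite [ext_vec 0]linear0 /= mul0r mulr0 ext_coef0.
by rewrite /wedge big_cat !big_cons /= [ext_vec _ * (_ * _)]mulrA ext_vec_sq mul0r mulr0 ext_coef0.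
Qed.

Lemma act_wedge (a : V) s : a.2 = 0 ->
  act br (size s) a wedge s = - ext_act (vsval a.1) (wedge s).
Proof.
move=> a0; elim: s => [|x s IH].
  rewrite act0 /wedge big_nil -[1]/(ebasis R set0) ext_act_basis enum_set0 /=.
  by rewrite oppr0.
rewrite /= act_cons /wedge !big_cons ext_actM ext_act_vec opprD; congr (_ + _).
  by rewrite /= a0 mulmx0 sub0r linearN mulNr.
rewrite -/(wedge s) -mulrN -IH /act mulr_sumr; apply: eq_bigr => t _.
by rewrite /fix_head big_cons.
Qed.

Lemma volume_sl_invariant : sl_invariant volume_form.
Proof.
apply: (sl_invariant_supp volume_supp) => a s a0 sn.
have cl : linear (fun w : exterior R n => ext_coef w setT : R^o).
  by move=> c u v; rewrite ext_coefD ext_coefZ.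
pose h : {linear exterior R n ->
  R^o} := HB.pack (fun w : exterior R n => ext_coef w setT : R^o)
  (GRing.isLinear.Build R _ R^o _ _ cl).
have [_ _ _ cth] := compat_linear n n h.
rewrite (cth a volume_form wedge) // => [|u un]; last by rewrite /volume_form un eqxx.
have -> : act br n a wedge s = act br (size s) a wedge s by rewrite sn.
rewrite act_wedge // linearN /= ext_coef_act_top.
by have := subvsP a.1; rewrite mem_slv => /eqP ->; rewrite mul0r oppr0.
Qed.

Lemma volume_basis_vec : volume_form (map (@basis_vec R n) (enum 'I_n)) = 1.
Proof.
rewrite /volume_form size_map size_enum_ord eqxx.
have -> : wedge (map (@basis_vec R n) (enum 'I_n)) = ebasis R setT.
  rewrite /wedge big_map -ext_volumeE /ext_volume [in RHS]/index_enum unlock.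
  by rewrite enumT.
by rewrite ext_coef_basis eqxx.
Qed.

Lemma cobdry_vec_in (W : lmodType R) (f : seq V -> W) l :
  mlinear f -> cobdry br f (map (@vec_in R n) l) = 0.
Proof.
elim: l f => [|x l IH] f fl /=; first exact: cobdry_nil.
rewrite cobdry_cons IH ?add0r; last exact: mlinear_fix_head.
have := act_vec_in 0 x l [::] fl; rewrite addn0 cats0 size_map => ->.
by rewrite act0 scaler0.
Qed.

Lemma cobdry_volume : cobdry br volume_form = 0.
Proof.
have fd : wedge_fil n (cobdry br volume_form).
  by apply: wedge_fil_cobdry;
    [exact: volume_mlinear|exact: volume_wedge_fil|exact: volume_sl_invariant].
have dl := sd_cobdry_mlinear volume_mlinear.
apply: funext => s; have [sn|sn] := eqVneq (size s) n.+1; last first.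
  by rewrite (supp_cobdry _ volume_supp).
(* The letter y, the first tensor factor, is the only one outside the n alternating arguments. Its
   g-part leaves a coboundary on the empty word, and its I-part a word of I, where all brackets
   vanish. *)
case/lastP: s sn => // u y; rewrite size_rcons => -[un].
rewrite -cats1 (wedge_fil_proj _ dl fd.1) ?un // [y]split_vec_in mlinearD //.
rewrite (cobdry_cat_g [::] volume_mlinear volume_wedge_fil volume_sl_invariant) ?size_map //.
rewrite cobdry_nil add0r -[[:: vec_in _]]/(map (@vec_in R n) [:: y.2]) -map_cat.
exact: cobdry_vec_in volume_mlinear.
Qed.

Lemma cocycle_volume k f : mlinear f -> supp_size k.+1 f -> cobdry br f = 0 ->
  exists e c, [/\ mlinear e, supp_size k e & f = cobdry br e + (if k.+1 == n then c *: volume_form else 0)].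
Proof.
move=> fl fk df.
have [e [F [[el ek fE] [Fl Fk Fi Fp]]]] := cocycle_normal_form n_gt1 fl fk df.
have [kn|kn] := eqVneq k.+1 n; last first.
  by exists e, 0; rewrite fE (wedge_fil_sl_invariant_eq0 _ kn Fl Fk Fi Fp).
exists e, (F (map (@basis_vec R n) (enum 'I_n))); split=> //; rewrite fE; congr (_ + _).
apply/eqP; rewrite -subr_eq0; apply/eqP; rewrite kn in Fk Fp.
rewrite -scaleN1r; apply: wedge_fil_top_eq0.
- by do 2?apply: mlinear_add => //; apply/mlinear_scale/mlinear_scale/volume_mlinear.
- by apply: supp_add => //; apply/supp_scale/supp_scale/volume_supp.
- by apply: wedge_fil_add => //; apply/wedge_fil_scale/wedge_fil_scale/volume_wedge_fil.
by rewrite fct_addE !fct_scaleE volume_basis_vec scaleN1r -[_ *: 1]/(_ * 1) mulr1 subrr.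
Qed.

End VolumeForm.

(** * Comparison with the index formula for the boundary *)

Section Transfer.
Variables (K : fieldType) (V : vectType K) (br : V -> V -> V).

(** The counterpart of [leibniz_face] with natural numbers as indices, which allows faces of words
    of different lengths to be compared. *)
Definition face_word (s : seq V) i j :=
  [seq if bump j l == i then br s`_i s`_j else s`_(bump j l) | l <- iota 0 (size s).-1].

Lemma map_iota_rcons (T : Type) (g : nat -> T) m :
  [seq g l | l <- iota 0 m.+1] = rcons [seq g l | l <- iota 0 m] (g m).
Proof. by rewrite -addn1 iotaD map_cat cats1. Qed.

Lemma act_rev (W : lmodType K) (f : seq V -> W) s y : act br (size s) y f (rev s) =
  \sum_(i < size s) f (rev [seq if l == i :> nat then br s`_i y else s`_l | l <- iota 0 (size s)]).
Proof.
elim/last_ind: s f => [|s x IH] f; first by rewrite act0 big_ord0.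
rewrite size_rcons rev_rcons act_cons IH big_ord_recr [LHS]addrC.
congr (_ + _).
  apply: eq_bigr => i _; rewrite /fix_head map_iota_rcons rev_rcons;
    congr (f (_ :: rev _)).
    by rewrite /= (gtn_eqF (ltn_ord i)) nth_rcons ltnn eqxx.
  apply/eq_in_map => l; rewrite mem_iota add0n => /andP[_ ls].
  by rewrite !nth_rcons ls (ltn_ord i).
rewrite map_iota_rcons rev_rcons /= eqxx nth_rcons ltnn eqxx; congr (f (_ :: rev _)).
rewrite -[LHS](mkseq_nth 0) /mkseq; apply/eq_in_map => l;
  rewrite mem_iota add0n => /andP[_ ls].
by rewrite (ltn_eqF ls) nth_rcons ls.
Qed.

Lemma face_word_rcons s y i j :
  (i < j < size s)%N -> face_word (rcons s y) i j = rcons (face_word s i j) y.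
Proof.
case/andP=> ij js; rewrite /face_word size_rcons /=.
have [m sm] : exists m, size s = m.+1 by exists (size s).-1;
  rewrite prednK // (leq_ltn_trans _ js).
have jm : (j <= m)%N by rewrite -ltnS -sm.
rewrite sm map_iota_rcons; congr rcons.
  apply/eq_in_map => l; rewrite mem_iota add0n => /andP[_ lm].
  have bs : (bump j l < size s)%N.
    by rewrite sm ltnS /bump; case: (j <= l)%N; rewrite ?add1n ?add0n // ltnW.
  by rewrite !nth_rcons bs js (ltn_trans ij js).
have -> : bump j m = size s by rewrite /bump jm add1n sm.
by rewrite gtn_eqF ?nth_rcons ?ltnn ?eqxx // (ltn_trans ij js).
Qed.

Lemma cobdry_rev (W : lmodType K) (f : seq V -> W) s : cobdry br f (rev s) =
  \sum_(j < size s) \sum_(i < j) (-1) ^+ j.+1 *: f (rev (face_word s i j)).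
Proof.
elim/last_ind: s f => [|s y IH] f; first by rewrite cobdry_nil big_ord0.
rewrite size_rcons rev_rcons cobdry_cons IH size_rev act_rev big_ord_recr.
congr (_ + _).
  apply: eq_bigr => j _; apply: eq_bigr => i _; congr (_ *: _).
  by rewrite /fix_head -rev_rcons face_word_rcons //= ltn_ord ltn_ord.
rewrite scaler_sumr /=; apply: eq_bigr => i _; congr (_ *: f (rev _)).
rewrite /face_word size_rcons /=; apply/eq_in_map => l;
  rewrite mem_iota add0n => /andP[_ ls].
have -> : bump (size s) l = l by rewrite /bump leqNgt ls.
by rewrite !nth_rcons ls ltn_ord ltnn eqxx.
Qed.

Lemma codom_face k (x : {ffun 'I_k -> V}) (i j : 'I_k) :
  codom (leibniz_face br x i j) = face_word (codom x) i j.
Proof.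
have cx (l : 'I_k) : (codom x)`_l = x l by have := nth_word_of x l;
  rewrite /word_of revK.
rewrite /face_word size_codom card_ord -val_enum_ord -map_comp /codom /image_mem.
apply: eq_map => l /=; rewrite ffunE -(cx (lift j l)) !cx.
by rewrite -[lift j l == i]val_eqE /= -(cx (lift j l)).
Qed.

(** The boundary is the coboundary of the universal form. Composing with linear maps carries
    statements on coboundaries over to it. *)
Lemma leibniz_formula_cobdry k (x : {ffun 'I_k -> V}) :
  leibniz_formula br x = cobdry br (tensor_word k.-1) (word_of x).
Proof.
rewrite /word_of cobdry_rev size_codom card_ord /leibniz_formula.
rewrite (exchange_big_dep predT) //=; apply: eq_bigr => j _.
rewrite (big_ord_widen k (fun i => (-1) ^+ j.+1 *: tensor_word k.-1 (rev (face_word (codom x) i j))) (ltnW (ltn_ord j))).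
by apply: eq_bigr => i _; rewrite -codom_face -/(word_of _) tensor_word_word_of.
Qed.

End Transfer.

(** * From linear maps on tensors to homology *)

Section TensorExt.
Variables (K : fieldType) (V : vectType K).

Lemma tpow_ext k (W : vectType K) (f g : 'Hom(tpow V k, W)) :
  (forall s, size s = k -> f (tensor_word k s) = g (tensor_word k s)) -> f = g.
Proof.
move=> fg; apply/lfunP => w; rewrite (tlift_unique f) (tlift_unique g).
by apply: eq_bigr => s _; rewrite /= -tensor_word_word_of fg ?size_word_of.
Qed.

End TensorExt.

Section Separation.
Variables (K : fieldType) (V : vectType K).

(** The functional is a coordinate of the projection along U that does not vanish at z. *)
Lemma separating_functional (U : {vspace V}) z : z \notin U ->
  exists2 p : 'Hom(V, K^o), (forall u, u \in U -> p u = 0) & p z != 0.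
Proof.
move=> zU; have dUC : (U^C :&: U = 0)%VS by rewrite capvC capv_compl.
pose d := daddv_pi U^C U.
have dz : d z != 0.
  apply: contra zU => /eqP dz.
  have := daddv_pi_add dUC (w := z);
    rewrite -/d dz add0r addvC addv_complf memvf => /(_ isT) <-.
  exact: memv_pi.
have du u : u \in U -> d u = 0.
  move=> uU; have := daddv_pi_add dUC (w := u);
    rewrite addvC addv_complf memvf => /(_ isT).
  rewrite (daddv_pi_id (u := u) _ uU); last by rewrite capvC.
  by rewrite -[in RHS](add0r u) => /addIr.
have [i di] : exists i, coord (vbasis {:V}) i (d z) != 0.
  apply/existsP; rewrite -negb_forall; apply: contra dz => /forallP c0.
  rewrite (coord_vbasis (memvf (d z))) big1 // => i _.
  by rewrite (eqP (c0 i)) scale0r.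
have cl : linear (fun v => coord (vbasis {:V}) i (d v) : K^o).
  by move=> c u v; rewrite !linearP.
pose L : {linear V -> K^o} := HB.pack (fun v => coord (vbasis {:V}) i (d v) : K^o)
  (GRing.isLinear.Build K V K^o _ _ cl).
exists (linfun L) => [u uU|]; rewrite lfunE //=.
by rewrite du // linear0.
Qed.

End Separation.

Section HomologyIso.
Variables (K : fieldType) (V : vectType K) (br : V -> V -> V) (W : vectType K).
Variables (E : {vspace W}) (k : nat) (h : 'Hom(tpow V k, W)).
Hypothesis h_ker : forall z, leibniz_d br k z = 0 ->
  (z \in limg (leibniz_d br k.+1) <-> h z = 0).
Hypothesis h_im : forall z, leibniz_d br k z = 0 -> h z \in E.
Hypothesis h_surj : forall v, v \in E -> exists2 z, leibniz_d br k z = 0 & h z = v.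

Local Notation Z := (lker (leibniz_d br k)).
Local Notation B := (leibniz_boundaries br k).

Lemma cycleP (x : subvs_of Z) : leibniz_d br k (vsval x) = 0.
Proof. by apply/eqP; rewrite -memv_ker subvsP. Qed.

Lemma mem_boundaries (x : subvs_of Z) : (x \in B) <-> h (vsval x) = 0.
Proof.
rewrite -h_ker ?cycleP // /leibniz_boundaries -memv_preim lfunE.
by [].
Qed.

Definition HL_map (q : HL br k) : subvs_of E := vsproj E (h (vsval (repr q))).

Lemma HL_map_pi x : vsval (HL_map (quotv_pi B x)) = h (vsval x).
Proof.
rewrite /HL_map vsprojK; last exact/h_im/cycleP.
apply/eqP; rewrite -subr_eq0 -linearB /= -linearB; apply/eqP/mem_boundaries.
by rewrite -quotv_pi_eq /quotv_pi reprK.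
Qed.

Lemma HL_map_linear : linear HL_map.
Proof.
move=> c q q'; have [x ->] := quotv_pi_surj q; have [y ->] := quotv_pi_surj q'.
rewrite -(quotv_pi_is_linear B c x y); apply: val_inj.
transitivity (c *: vsval (HL_map (quotv_pi B x)) + vsval (HL_map (quotv_pi B y))).
  by rewrite [LHS]HL_map_pi !HL_map_pi !linearP.
by rewrite -linearP.
Qed.

(** The first isomorphism theorem for h restricted to cycles, with boundaries as kernel and E as
    image. *)
Lemma HL_iso : exists f : {linear HL br k -> subvs_of E}, bijective f.
Proof.
pose f : {linear HL br k -> subvs_of E} := HB.pack HL_map
  (GRing.isLinear.Build K (HL br k) (subvs_of E) _ HL_map HL_map_linear).
exists f.
have inj : injective f.
  move=> q q'; have [x ->] := quotv_pi_surj q; have [y ->] := quotv_pi_surj q'.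
  move/(congr1 vsval); rewrite /f /= !HL_map_pi => hxy; apply/eqP.
  by rewrite quotv_pi_eq; apply/mem_boundaries; rewrite !linearB /= hxy subrr.
have surj v : exists q, f q = v.
  have [z dz hz] := h_surj (subvsP v).
  have zZ : z \in Z by rewrite memv_ker dz.
  exists (quotv_pi B (Subvs zZ)); apply: val_inj.
  by rewrite -[LHS]/(vsval _) /f /= HL_map_pi.
pose g v := projT1 (cid (surj v)).
have fg : cancel g f by move=> v; rewrite /g; case: cid.
by exists g => // q; apply: inj; rewrite fg.
Qed.

End HomologyIso.

(** * The invariants of the exterior algebra *)

Section ExteriorInvariants.
Variables (R : realFieldType) (n : nat).
Hypothesis n_gt0 : (0 < n)%N.
Local Notation ext := (exterior R n).
Local Notation vol := (ext_volume R n).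
Implicit Types (a : ext) (S : {set 'I_n}).

Lemma ext_act_diag (A : 'M[R]_n) (d : 'I_n -> R) S :
  (forall k, A *m ext_partial R k = d k *: ext_partial R k) ->
  ext_act A (ebasis R S) = (\sum_(i in S) d i) *: ebasis R S.
Proof.
move=> Ad; rewrite ext_act_basis ebasisE -big_enum.
elim: (enum S) => [|i l IH] /=; first by rewrite big_nil scale0r.
rewrite IH Ad linearZ /= -scalerAl -scalerAr big_cons scalerDl.
by rewrite ext_word_cons.
Qed.

(** For i in S and j outside S, the traceless matrix E_ii - E_jj has every basis monomial as an
    eigenvector and the eigenvalue 1 on that of S. *)
Lemma ext_sl_inv_coef a S : a \in ext_sl_inv R n -> S != set0 -> S != setT ->
  ext_coef a S = 0.
Proof.
move=> /ext_sl_invP inv_a /set0Pn[i iS] ST.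
have [j jS] : exists j, j \notin S.
  apply/existsP; rewrite -negb_forall; apply: contra ST => /forallP ST.
  by apply/eqP/setP => j; rewrite inE ST.
pose A : 'M[R]_n := delta_mx i i - delta_mx j j.
pose d k : R := (k == i)%:R - (k == j)%:R.
have Ad k : A *m ext_partial R k = d k *: ext_partial R k.
  rewrite /A /ext_partial mulmxBl !mul_delta_mx_cond scalerBl !(eq_sym k).
  by rewrite !scaler_nat; congr (_ - _); case: eqP => [->|].
have trA : \tr A = 0 by rewrite linearB /= !mxtrace_delta_mx !eqxx subrr.
have := congr1 (fun b => ext_coef b S) (inv_a A trA).
rewrite {1}[a]ext_sum_basis linear_sum ext_coef0.
have csum (F : {set 'I_n} -> ext) : ext_coef (\sum_T F T) S = \sum_T ext_coef (F T) S.
  apply: (big_morph (fun a => ext_coef a S)) => [x y|]; last exact: ext_coef0.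
  exact: ext_coefD.
rewrite csum (bigD1 S) //= big1 => [|T TS]; last first.
  rewrite linearZ /= (ext_act_diag _ Ad) !ext_coefZ ext_coef_basis.
  by rewrite eq_sym (negPf TS) !mulr0.
rewrite linearZ /= (ext_act_diag _ Ad) !ext_coefZ ext_coef_basis eqxx addr0 mulr1.
have -> : \sum_(k in S) d k = 1; last by rewrite mulr1.
rewrite /d sumrB (bigD1 i) //= eqxx big1 ?addr0 => [|k /andP[_ /negPf -> //]].
rewrite big1 ?subr0 // => k kS; case: eqP => // kj.
by rewrite kj (negPf jS) in kS.
Qed.

Lemma ext_sl_inv_decomp a : a \in ext_sl_inv R n ->
  a = ext_coef a set0 *: 1 + ext_coef a setT *: vol.
Proof.
move=> inv_a; have T0 : [set: 'I_n] != set0.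
  by rewrite -cards_eq0 cardsT card_ord -lt0n.
apply: extP => S; rewrite ext_volumeE ext_coefD !ext_coefZ !ext_coef_basis.
have [->|S0] := eqVneq S set0; first by rewrite eq_sym (negPf T0) mulr1 mulr0 addr0.
have [->|ST] := eqVneq S setT; first by rewrite mulr1 mulr0 add0r.
by rewrite ext_sl_inv_coef // !mulr0 addr0.
Qed.

Lemma ext_sl_inv1 : 1 \in ext_sl_inv R n.
Proof.
apply/ext_sl_invP => A _; rewrite -[1]/(ebasis R set0) ext_act_basis.
by rewrite enum_set0.
Qed.

Lemma ext_sl_inv_volume : vol \in ext_sl_inv R n.
Proof. by apply/ext_sl_invP => A trA; rewrite ext_volumeE ext_act_top trA scale0r. Qed.

Lemma ext_sl_invE : ext_sl_inv R n = (1 + <[vol]>)%VS.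
Proof.
apply/eqP; rewrite eqEsubv; apply/andP; split.
  apply/subvP => a /ext_sl_inv_decomp ->; rewrite memv_add ?memvZ ?memv_line //.
by rewrite subv_add -!memvE ext_sl_inv1 ext_sl_inv_volume.
Qed.

(** The volume element has square 0, so the span of 1 and the volume element is already closed under
    products. *)
Lemma agenv_volume : <<1; vol>>%VS = (1 + <[vol]>)%VS.
Proof.
apply/eqP; rewrite eqEsubv; apply/andP; split; last first.
  by rewrite subv_add sub1_agenv -memvE memv_adjoin.
apply: agenv_sub_modl; first exact: addvSl.
apply/prodvP => _ _ /memv_addP[_ /vlineP[c ->] [_ /vlineP[d ->] ->]]
  /memv_addP[_ /vlineP[c' ->] [_ /vlineP[d' ->] ->]].
have vol2 : vol * vol = 0.
  rewrite ext_volumeE ebasisM; case: ifP => //; rewrite -setI_eq0 setIid.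
  by rewrite -cards_eq0 cardsT card_ord => /eqP n0; move: n_gt0; rewrite n0.
rewrite mulrDl !mulrDr -!scalerAl -!scalerAr vol2 !scaler0 addr0 !mul1r mulr1 !scalerA.
by rewrite -addrA -scalerDl memv_add ?memvZ ?memv_line.
Qed.

Lemma ext_deg_homog k a : a \in ext_deg R n k -> homog k a.
Proof.
pose H k : {vspace ext} := (\sum_(S : {set 'I_n} | #|S| == k) <[ebasis R S]>)%VS.
have HP m b : (b \in H m) <-> homog m b.
  split=> [/memv_sumP[v vS ->]|bm].
    apply: homog_sum => S Sm; have /vlineP[c ->] := vS S Sm.
    by apply: homogZ; rewrite -(eqP Sm); apply: homog_basis.
  rewrite [b]ext_sum_basis (bigID (fun S : {set 'I_n} => #|S| == m)) /=.
  rewrite [X in _ + X]big1 ?addr0 => [|S Sm]; last by rewrite bm // scale0r.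
  by apply/memv_sumP; exists (fun S => ext_coef b S *: ebasis R S) => // S _;
    rewrite memvZ ?memv_line.
suff: (ext_deg R n k <= H k)%VS by move=> /subvP sub /sub /HP.
rewrite /ext_deg; elim: k => [|k IH].
  by rewrite expv0 -memvE; apply/HP; apply: homog1.
rewrite expvSl; apply: subv_trans (prodvSr _ IH) _; apply/prodvP => u v.
case/memv_imgP => w _ ->; rewrite lfunE /= => /HP vk; apply/HP.
by apply: (@homogM _ _ 1) => //; apply: homog_vec.
Qed.

Lemma ext_deg_prod I (r : seq I) (F : I -> 'cV[R]_n) :
  \prod_(i <- r) ext_vec (F i) \in ext_deg R n (size r).
Proof.
elim: r => [|i r IH]; first by rewrite big_nil; apply: memv_line.
rewrite big_cons /ext_deg /= expvSl memv_mul //.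
by rewrite -[ext_vec _](lfunE (@ext_vec R n)) memv_img ?memvf.
Qed.

Lemma ext_deg_volume : vol \in ext_deg R n n.
Proof.
have := ext_deg_prod (enum 'I_n) (fun i => ext_partial R i).
rewrite size_enum_ord /ext_volume [in X in _ -> X]/index_enum unlock.
by rewrite enumT.
Qed.

Lemma ext_inv_deg k a : a \in (ext_sl_inv R n :&: ext_deg R n k)%VS ->
  a = if k == 0 then ext_coef a set0 *: 1 else if k == n then ext_coef a setT *: vol else 0.
Proof.
rewrite memv_cap => /andP[/ext_sl_inv_decomp aE /ext_deg_homog ak].
have a0 : k != 0%N -> ext_coef a set0 = 0 by move=> k0; rewrite ak // cards0 eq_sym.
have aT : k != n -> ext_coef a setT = 0 by move=> kn;
  rewrite ak // cardsT card_ord eq_sym.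
rewrite {1}aE; case: eqP => [k0|/eqP k0].
  by rewrite aT ?scale0r ?addr0 // k0 eq_sym -lt0n.
rewrite a0 // scale0r add0r; case: eqP => [//|/eqP kn].
by rewrite aT // scale0r.
Qed.

End ExteriorInvariants.

(** * Homology in each degree *)

Section Main.
Variables (R : realFieldType) (n : nat).
Hypothesis n_gt1 : (1 < n)%N.
Let n_gt0 : (0 < n)%N := ltnW n_gt1.
Local Notation V := (sl_semidirect R n).
Local Notation br := (@sd_bracket R n).
Local Notation d := (leibniz_d br).
Local Notation vol := (ext_volume R n).
Local Notation E k := (ext_sl_inv R n :&: ext_deg R n k)%VS.

Lemma leibniz_d_tensor_word k (s : seq V) :
  size s = k -> d k (tensor_word k s) = cobdry br (tensor_word k.-1) s.
Proof.
move=> sk;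
  rewrite -{1 2}(word_of_ffun sk) tensor_word_word_of leibniz_d_tensor ?leibniz_formula_cobdry ?word_of_ffun //.
  exact: sd_bracket_linearr.
exact: sd_bracket_linearl.
Qed.

Lemma cobdry_lin (W W' : lmodType R) (h : {linear W -> W'}) (F : seq V -> W) s :
  h (cobdry br F s) = cobdry br (h \o F) s.
Proof. by rewrite /cobdry linear_sum; apply: eq_bigr => ct _; rewrite linearZ. Qed.

(** The tensor power of degree 0 is a line, and the differentials into and out of it vanish because
    words of length at most 1 contain no pair of letters. *)
Lemma HL_degree0 : exists f : {linear HL br 0 -> subvs_of (E 0)}, bijective f.
Proof.
pose g (_ : {ffun 'I_0 -> V}) : exterior R n := 1.
pose h : 'Hom(tpow V 0, exterior R n) := linfun (tlift g).
have s0 : {ffun 'I_0 -> 'I_(\dim {:V})} by apply: finfun; case.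
have u (s : {ffun 'I_0 -> 'I_(\dim {:V})}) : s = s0 by apply/ffunP; case.
have hE (z : tpow V 0) : h z = (z : {ffun _ -> _}) s0 *: 1.
  rewrite lfunE /= /tlift (bigD1 s0) //= big1 ?addr0 // => s.
  by rewrite (u s) eqxx.
have d1 z : d 1 z = 0.
  rewrite (_ : d 1 = 0) ?zero_lfunE //; apply: tpow_ext => -[|x []] // _.
  by rewrite zero_lfunE leibniz_d_tensor_word // cobdry_cons cobdry_nil act0 scaler0 addr0.
have d0 z : d 0 z = 0.
  rewrite (_ : d 0 = 0) ?zero_lfunE //; apply: tpow_ext => -[] // _.
  by rewrite zero_lfunE leibniz_d_tensor_word // cobdry_nil.
apply: (@HL_iso _ _ _ _ _ _ h).
- move=> z _; split=> [/memv_imgP[y _ ->]|hz]; first by rewrite d1 linear0.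
  have -> : z = 0; last exact: mem0v.
  apply/ffunP => s; rewrite (u s) ffunE; move: hz; rewrite hE => /eqP.
  by rewrite scaler_eq0 oner_eq0 orbF => /eqP.
- move=> z _; rewrite hE memvZ // memv_cap ext_sl_inv1 /ext_deg expv0.
  exact: memv_line.
move=> v /(ext_inv_deg n_gt0) /= vE.
exists ([ffun _ => ext_coef v set0] : tpow V 0); first exact: d0.
by rewrite hE ffunE [RHS]vE.
Qed.

Definition vol_form (s : seq V) : exterior R n := volume_form s *: vol.

Lemma vol_form_mlinear : mlinear vol_form.
Proof.
move=> s1 s2 c u v; rewrite /vol_form volume_mlinear scalerDl.
by rewrite -[c *: volume_form _]/(c * _) -scalerA.
Qed.

(** This is 0 unless k = n, so one map gives the isomorphism in every positive degree. *)
Definition vol_hom k : 'Hom(tpow V k, exterior R n) :=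
  linfun (tlift (fun x : {ffun 'I_k -> V} => vol_form (word_of x))).

Lemma vol_hom_tensor_word k s : size s = k -> vol_hom k (tensor_word k s) = vol_form s.
Proof. by move=> sk; rewrite lfunE /= tlift_tensor_word //;
  apply: vol_form_mlinear. Qed.

Lemma vol_hom_boundary k y : vol_hom k (d k.+1 y) = 0.
Proof.
rewrite -[LHS]comp_lfunE (_ : (_ \o _)%VF = 0) ?zero_lfunE //; apply: tpow_ext => s sk.
rewrite comp_lfunE zero_lfunE leibniz_d_tensor_word // cobdry_lin.
rewrite (@eq_cobdry _ _ _ _ _ vol_form) => [|t ts]; last first.
  by rewrite /= vol_hom_tensor_word //; move: ts; rewrite sk => -[].
have := congr1 (fun f => f s) (cobdry_volume R n).
rewrite /cobdry => /(congr1 (fun c => c *: vol)); rewrite scale0r scaler_suml => E0.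
rewrite -[RHS]E0; apply: eq_bigr => ct _.
by rewrite /vol_form scalerA.
Qed.

Lemma vol_hom_exact k z : d k.+1 z = 0 -> vol_hom k.+1 z = 0 -> z \in limg (d k.+2).
Proof.
move=> dz hz; apply/negPn/negP => /separating_functional[p pB pz].
pose f : seq V -> R^o := p \o tensor_word k.+1.
have fl : mlinear f by move=> s1 s2 c u v; rewrite /f /= tensor_word_mlinear linearP.
have fk : supp_size k.+1 f by move=> s sk;
  rewrite /f /= /tensor_word (negPf sk) linear0.
have df : cobdry br f = 0.
  apply: funext => s; have [sk|sk] := eqVneq (size s) k.+2;
    last by rewrite (supp_cobdry _ fk).
  transitivity (p (d k.+2 (tensor_word k.+2 s)));
    first by rewrite leibniz_d_tensor_word // cobdry_lin.
  by rewrite pB ?memv_img ?memvf.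
have [e [c [el ek fE]]] := cocycle_volume n_gt1 fl fk df.
pose he : 'Hom(tpow V k, R^o) := linfun (tlift (fun x : {ffun 'I_k -> V} => e (word_of x))).
have cl : linear (fun w : exterior R n => ext_coef w setT : R^o).
  by move=> x v w; rewrite ext_coefD ext_coefZ.
pose ct : 'Hom(exterior R n, R^o) := linfun (HB.pack (fun w : exterior R n => ext_coef w setT : R^o)
  (GRing.isLinear.Build R _ R^o _ _ cl) : {linear exterior R n -> R^o}).
have ctE w : ct w = ext_coef w setT by rewrite lfunE.
(* At z the first term vanishes because z is a cycle and the second by [hz], against the choice of
   p. *)
have pE : p = (he \o d k.+1 + c *: (ct \o vol_hom k.+1))%VF.
  apply: tpow_ext => s sk.
  rewrite add_lfunE scale_lfunE !comp_lfunE leibniz_d_tensor_word // cobdry_lin vol_hom_tensor_word //.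
  rewrite ctE /vol_form ext_coefZ ext_volumeE ext_coef_basis eqxx mulr1.
  rewrite -[LHS]/(f s) fE fct_addE; congr (_ + _).
    apply: eq_cobdry => t; rewrite sk => -[tk].
    by rewrite /= lfunE /= tlift_tensor_word.
  case: eqP => [_|kn]; first by rewrite fct_scaleE.
  by rewrite /volume_form sk; case: eqP => // _; rewrite scaler0.
move: pz; rewrite pE add_lfunE scale_lfunE !comp_lfunE dz hz !linear0 addr0.
by rewrite eqxx.
Qed.

Lemma HL_degreeS k : exists f : {linear HL br k.+1 -> subvs_of (E k.+1)}, bijective f.
Proof.
apply: (@HL_iso _ _ _ _ _ _ (vol_hom k.+1)).
- move=> z dz; split=> [/memv_imgP[y _ ->]|]; first exact: vol_hom_boundary.
  exact: vol_hom_exact.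
- move=> z _; rewrite lfunE /= /tlift memv_suml // => s _; rewrite memvZ //.
  rewrite /vol_form /volume_form size_word_of; case: eqP => [kn|_];
    last by rewrite scale0r mem0v.
  by rewrite memvZ // memv_cap ext_sl_inv_volume kn ext_deg_volume.
move=> v /(ext_inv_deg n_gt0) /=; case: eqP => [kn|_] ->; last first.
  by exists 0; rewrite linear0.
(* A word in I is a cycle because I is abelian, and [volume_form] takes the value 1 on this one. *)
pose l := map (@basis_vec R n) (enum 'I_n).
have lE : l = map (@vec_in R n) (map (fun i => delta_mx i ord0) (enum 'I_n)).
  by rewrite -map_comp.
have sl : size l = k.+1 by rewrite size_map size_enum_ord.
exists (ext_coef v setT *: tensor_word k.+1 l); rewrite linearZ /=.
  rewrite leibniz_d_tensor_word // lE cobdry_vec_in ?scaler0 //;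
    exact: tensor_word_mlinear.
by rewrite vol_hom_tensor_word // /vol_form volume_basis_vec scale1r.
Qed.

End Main.

Theorem corollary4p2 (R : realType) (n : nat) (hn : (2 <= n)%N) :
  (forall k : nat,
     exists f : {linear HL (@sd_bracket R n) k
                  -> subvs_of (ext_sl_inv R n :&: ext_deg R n k)%VS},
       bijective f)
  /\ ext_sl_inv R n = <<1; ext_volume R n>>%VS
  /\ <<1; ext_volume R n>>%VS = (1 + <[ext_volume R n]>)%VS.
Proof.
have n_gt0 : (0 < n)%N by exact: ltnW.
rewrite agenv_volume // ext_sl_invE //; split=> // -[|k].
  by rewrite -ext_sl_invE //; apply: HL_degree0.
by rewrite -ext_sl_invE //; apply: HL_degreeS.
Qed.
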